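(* Let $(\mathbf{Y},\mathbf{X})$ be a $(q+p)$-dimensional random vector with $\mathbf{Y}=(Y_1,\dots,Y_q)$, and let $(\mathbf{Y}_n,\mathbf{X}_n)_{n\in\mathbb{N}}$, $\mathbf{Y}_n=(Y_{1,n},\dots,Y_{q,n})$, be a sequence of $(q+p)$-dimensional random vectors; assume all $Y_i$ and $Y_{i,n}$ are non-degenerate. Let $V_1\subset\mathbb{R}^p$ be open such that $P(\mathbf{X}\in V_1)=1$ and, for all $i\in\{2,\dots,q\}$, let $U_i\subset\mathbb{R}^{i-1}$ and $V_i\subset\mathbb{R}^{p+i-1}$ be open such that $P((Y_1,\dots,Y_{i-1})\in U_i)=1$ and $P((Y_1,\dots,Y_{i-1},\mathbf{X})\in V_i)=1$. Consider the following conditions: (i) $(\mathbf{Y}_n,\mathbf{X}_n)\to(\mathbf{Y},\mathbf{X})$ in distribution; (ii) $(\mathbb{E}[u(Y_{1,n})\mid\mathbf{X}_n=\,\cdot\,])_{n\in\mathbb{N}}$ is asymptotically equicontinuous on $V_1$, $(\mathbb{E}[u(Y_{i,n})\mid(Y_{1,n},\dots,Y_{i-1,n},\mathbf{X}_n)=\,\cdot\,])_{n\in\mathbb{N}}$ is asymptotically equicontinuous on $V_i$, and $(\mathbb{E}[u(Y_{i,n})\mid(Y_{1,n},\dots,Y_{i-1,n})=\,\cdot\,])_{n\in\mathbb{N}}$ is asymptotically equicontinuous on $U_i$, for all $i\in\{2,\dots,q\}$ and all $u\in\mathcal{U}(\mathbb{R})$; (iii) the Markov product of $(Y_{1,n},\mathbf{X}_n)$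 converges weakly to the Markov product of $(Y_1,\mathbf{X})$, and, for all $i\in\{2,\dots,q\}$, the Markov product of $(Y_{i,n},(Y_{1,n},\dots,Y_{i-1,n},\mathbf{X}_n))$ converges weakly to the Markov product of $(Y_i,(Y_1,\dots,Y_{i-1},\mathbf{X}))$ and the Markov product of $(Y_{i,n},(Y_{1,n},\dots,Y_{i-1,n}))$ converges weakly to the Markov product of $(Y_i,(Y_1,\dots,Y_{i-1}))$; (iv) $(F_{Y_{i,n}}\circ F_{Y_{i,n}}^{-1})(t)\to(F_{Y_i}\circ F_{Y_i}^{-1})(t)$ as $n\to\infty$ for Lebesgue-almost all $t\in(0,1)$ and for all $i\in\{1,\dots,q\}$. Then the following assertions hold: (a) (i) and (ii) together imply (iii). (b) (iii) and (iv) together imply $\lim_{n\to\infty}T(\mathbf{Y}_n,\mathbf{X}_n)=T(\mathbf{Y},\mathbf{X})$.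
   Context: For a non-degenerate real random variable $Y$ and a random vector $\mathbf{X}$, Chatterjee's rank correlation is $$\xi(Y,\mathbf{X}) := \frac{\int_{\mathbb{R}} \mathrm{Var}(P(Y\ge y\mid \mathbf{X}))\,\mathrm{d}P^{Y}(y)}{\int_{\mathbb{R}} \mathrm{Var}(\mathbf{1}_{\{Y\ge y\}})\,\mathrm{d}P^{Y}(y)}.$$ For $\mathbf{Y}=(Y_1,\dots,Y_q)$ with non-degenerate components, $$T(\mathbf{Y},\mathbf{X}):=1-\frac{q-\sum_{i=1}^q\xi(Y_i,(\mathbf{X},Y_{i-1},\dots,Y_1))}{q-\sum_{i=1}^q\xi(Y_i,(Y_{i-1},\dots,Y_1))},\qquad \xi(Y_1,\emptyset):=0.$$ The Markov product of a random vector $(Y,\mathbf{Z})$ ($Y$ real-valued) is the distribution of $(Y,Y')$, where the conditional distribution of $Y'$ given $\mathbf{Z}=\mathbf{z}$ equals that of $Y$ given $\mathbf{Z}=\mathbf{z}$ for $P^{\mathbf{Z}}$-almost all $\mathbf{z}$, and $Y$ and $Y'$ are conditionally independent given $\mathbf{Z}$. $\mathcal{U}(\mathbb{R})$ denotes a (fixed) class of bounded, continuous, weak convergence-determining functions from $\mathbb{R}$ to $\mathbb{C}$ (i.e. for distributions $\mu_n,\mu$ on $\mathbb{R}$, $\int f\,\mathrm{d}\mu_n\to\int f\,\mathrm{d}\mu$ for all $f$ in the class implies $\mu_n\to\mu$ weakly). A sequence $(f_n)$ of functions from $\mathbb{R}^d$ to $\mathbb{C}$ is asymptotically equicontinuous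 on an open set $V\subset\mathbb{R}^d$ if for all $\varepsilon>0$ and $\mathbf{x}\in V$ there exist $\delta>0$ and $n_0\in\mathbb{N}$ (depending on $\mathbf{x},\varepsilon$) such that $|\mathbf{x}'-\mathbf{x}|\le\delta$ implies $|f_n(\mathbf{x}')-f_n(\mathbf{x})|<\varepsilon$ for all $n>n_0$. Conditional expectations are understood with respect to fixed versions of the regular conditional distributions. $F_Y$ is the distribution function of $Y$ and $F_Y^{-1}(t)=\inf\{y: F_Y(y)\ge t\}$ its generalized inverse. *)

(* Defs.v *)
From HB Require Import structures.
From mathcomp Require Import all_boot all_order all_algebra.
From mathcomp Require Import all_classical all_reals all_analysis.
From mathcomp Require Import complex.
Set Implicit Arguments.
Unset Strict Implicit.
Unset Printing Implicit Defensive.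
Import Order.TTheory GRing.Theory Num.Theory.
Import numFieldNormedType.Exports.
Local Open Scope classical_set_scope.
Local Open Scope ring_scope.

(* Row vectors carry the product sigma-algebra, as n.-tuple T does in the
   library; on 'rV[R]_m it is the Borel sigma-algebra. *)
Definition rV_display : measure_display -> measure_display.
Proof. exact. Qed.

Section measurable_rV.
Context d (T : measurableType d) (m : nat).

Let coors : 'I_m -> 'rV[T]_m -> T := fun i x => x ord0 i.

Let rV_set0 : g_sigma_preimage coors set0.
Proof. exact: sigma_algebra0. Qed.

Let rV_setC A : g_sigma_preimage coors A -> g_sigma_preimage coors (~` A).
Proof. exact: sigma_algebraC. Qed.

Let rV_bigcup (F : (set 'rV[T]_m)^nat) :
  (forall i, g_sigma_preimage coors (F i)) ->
  g_sigma_preimage coors (\bigcup_i (F i)).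
Proof. exact: sigma_algebra_bigcup. Qed.

HB.instance Definition _ := @isMeasurable.Build (rV_display d)
  'rV[T]_m (g_sigma_preimage coors) rV_set0 rV_setC rV_bigcup.

End measurable_rV.

Lemma measurable_coord d (T : measurableType d) m (i : 'I_m) :
  measurable_fun [set: 'rV[T]_m] (fun x => x ord0 i).
Proof.
move=> _ B mB; rewrite setTI; apply: sub_sigma_algebra => /=.
rewrite -bigcup_seq/=; exists i => /=; first by rewrite mem_index_enum.
by exists B => //; rewrite setTI.
Qed.

Lemma measurable_fun_rV d d' (S : measurableType d) (T : measurableType d') m
    (f : S -> 'rV[T]_m) :
  (forall i, measurable_fun [set: S] (fun x => f x ord0 i)) ->
  measurable_fun [set: S] f.
Proof.
move=> mf _ A mA; rewrite setTI.
have : preimage_set_system [set: S] f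
    (g_sigma_preimage (fun (i : 'I_m) (x : 'rV[T]_m) => x ord0 i)) (f @^-1` A).
  by exists A => //; rewrite setTI.
rewrite -g_sigma_preimage_comp; apply: smallest_sub.
  exact: sigma_algebra_measurable.
case: m => [|m] in f mf A mA *; first by rewrite big_ord0.
rewrite -bigcup_mkord_ord; apply: bigcup_sub => i Ii.
by move=> B [C mC <-]; exact: mf.
Qed.


Section random_vectors.
Context d (Om : measurableType d) d' (T : measurableType d').

Definition rv_coord q (Y : {mfun Om >-> 'rV[T]_q}) (i : 'I_q) (w : Om) : T :=
  Y w ord0 i.

Lemma measurable_coord_mfun q (Y : {mfun Om >-> 'rV[T]_q}) i :
  measurable_fun [set: Om] (rv_coord Y i).
Proof. exact: measurableT_comp (measurable_coord i) (measurable_funPT Y). Qed.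

HB.instance Definition _ q (Y : {mfun Om >-> 'rV[T]_q}) (i : 'I_q) :=
  isMeasurableFun.Build _ _ Om T (rv_coord Y i) (@measurable_coord_mfun q Y i).

(* With indices starting at 0, rv_past Y i is the vector of the i coordinates
   Y 0, ..., Y (i - 1), and rv_rpast Y i is Y (i - 1), ..., Y 0; both are the
   empty vector for i = 0, so that rv_joint (rv_past Y i) X is then X. *)
Definition rv_past q (Y : {mfun Om >-> 'rV[T]_q}) (i : 'I_q) (w : Om)
    : 'rV[T]_i :=
  \row_(j < i) Y w ord0 (widen_ord (ltnW (ltn_ord i)) j).

Definition rv_rpast q (Y : {mfun Om >-> 'rV[T]_q}) (i : 'I_q) (w : Om)
    : 'rV[T]_i :=
  \row_(j < i) Y w ord0 (widen_ord (ltnW (ltn_ord i)) (rev_ord j)).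

Lemma measurable_past q (Y : {mfun Om >-> 'rV[T]_q}) i :
  measurable_fun [set: Om] (rv_past Y i).
Proof.
apply: measurable_fun_rV => j; under eq_fun do rewrite mxE.
exact: measurable_coord_mfun.
Qed.

Lemma measurable_rpast q (Y : {mfun Om >-> 'rV[T]_q}) i :
  measurable_fun [set: Om] (rv_rpast Y i).
Proof.
apply: measurable_fun_rV => j; under eq_fun do rewrite mxE.
exact: measurable_coord_mfun.
Qed.

HB.instance Definition _ q (Y : {mfun Om >-> 'rV[T]_q}) (i : 'I_q) :=
  isMeasurableFun.Build _ _ Om 'rV[T]_i (rv_past Y i) (@measurable_past q Y i).

HB.instance Definition _ q (Y : {mfun Om >-> 'rV[T]_q}) (i : 'I_q) :=
  isMeasurableFun.Build _ _ Om 'rV[T]_i (rv_rpast Y i)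
    (@measurable_rpast q Y i).

Definition rv_joint m n (Y : {mfun Om >-> 'rV[T]_m})
  (X : {mfun Om >-> 'rV[T]_n})
  (w : Om) : 'rV[T]_(m + n) := row_mx (Y w) (X w).

Lemma measurable_joint m n (Y : {mfun Om >-> 'rV[T]_m})
    (X : {mfun Om >-> 'rV[T]_n}) :
  measurable_fun [set: Om] (rv_joint Y X).
Proof.
apply: measurable_fun_rV => j; rewrite -(fintype.splitK j);
  case: (fintype.split j) => k /=.
- by under eq_fun do rewrite row_mxEl; exact: measurable_coord_mfun.
- by under eq_fun do rewrite row_mxEr; exact: measurable_coord_mfun.
Qed.

HB.instance Definition _ m n (Y : {mfun Om >-> 'rV[T]_m})
    (X : {mfun Om >-> 'rV[T]_n}) :=
  isMeasurableFun.Build _ _ Om 'rV[T]_(m + n) (rv_joint Y X)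
    (@measurable_joint m n Y X).

End random_vectors.

Section conditioning.
Context (R : realType) d (Om : measurableType d) (P : probability Om R).
Context d' (S : measurableType d').

(* g is a version of z |-> P(E | Z = z). *)
Definition cond_prob_version (Z : {RV P >-> S}) (E : set Om) (g : S -> R) :=
  (distribution P Z).-integrable [set: S] (EFin \o g) /\
  forall C, measurable C ->
    P (E `&` Z @^-1` C) = (\int[distribution P Z]_(z in C) (g z)%:E)%E.

Definition cond_prob (Z : {RV P >-> S}) (E : set Om) : S -> R :=
  xget (cst 0) [set g | cond_prob_version Z E g].

(* kappa is a version of the regular conditional distribution of Y given Z. *)
Definition reg_cond_distr d1 (T : measurableType d1) (Y : {RV P >-> T})
    (Z : {RV P >-> S}) (kappa : R.-pker S ~> T) :=
  forall B, measurable B ->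
    cond_prob_version Z (Y @^-1` B) (fun z => fine (kappa z B)).

Definition cond_indep d1 (T1 : measurableType d1) d2 (T2 : measurableType d2)
    (Y1 : {RV P >-> T1}) (Y2 : {RV P >-> T2}) (Z : {RV P >-> S}) :=
  forall A B, measurable A -> measurable B ->
    \forall w \ae P, cond_prob Z (Y1 @^-1` A `&` Y2 @^-1` B) (Z w) =
      cond_prob Z (Y1 @^-1` A) (Z w) * cond_prob Z (Y2 @^-1` B) (Z w).

Lemma cond_probP (Z : {RV P >-> S}) (E : set Om) : measurable E ->
  cond_prob_version Z E (cond_prob Z E).
Proof.
move=> mE; rewrite /cond_prob; case: xgetP => [g _ //|noversion].
have [nu0 nu0E] : exists nu0 : {measure set S -> \bar R},
    forall C, nu0 C = P (Z @^-1` C `&` E).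
  unshelve eexists; first exact: (pushforward (mrestr P mE) Z).
  by [].
have fnu0 : fin_num_fun nu0.
  move=> A mA; rewrite nu0E; apply: fin_num_measure; apply: measurableI => //.
  exact: measurable_funPTI.
have snu0 : sigma_finite [set: S] nu0.
  by apply: fin_num_fun_sigma_finite; first rewrite measure0.
pose H1 := isFinite.Build _ _ _ _ fnu0.
pose H2 := isSFinite.Build _ _ _ _ (sfinite_measure_sigma_finite snu0).
pose H3 := isSigmaFinite.Build _ _ _ _ snu0.
pose nu : {finite_measure set S -> \bar R} :=
  HB.pack (Measure.sort nu0) H1 H2 H3.
pose mu : {sigma_finite_measure set S -> \bar R} := distribution P Z.
have numu : charge_of_finite_measure nu `<< mu.
  apply/null_content_dominatesP => A mA muA0; apply/eqP.
  rewrite eq_le measure_ge0 andbT -muA0 [leLHS]nu0E.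
  apply: le_measure; rewrite ?inE//.
  - by apply: measurableI => //; exact: measurable_funPTI.
  - exact: measurable_funPTI.
pose f := Radon_Nikodym (charge_of_finite_measure nu) mu.
have fE z : (fine (f z))%:E = f z.
  by rewrite fineK//; exact: Radon_Nikodym_fin_num.
have [] := noversion (fine \o f); split.
  rewrite (_ : _ \o _ = f); first exact: Radon_Nikodym_integrable.
  by apply/funext => z /=; exact: fE.
move=> C mC; under eq_integral do rewrite fE.
by rewrite -Radon_Nikodym_integral// [RHS]nu0E setIC.
Qed.

End conditioning.

Arguments cond_prob_version {R d Om} P {d' S}.
Arguments cond_prob {R d Om} P {d' S}.
Arguments reg_cond_distr {R d Om} P {d' S d1 T}.
Arguments cond_indep {R d Om} P {d' S d1 T1 d2 T2}.

Section chatterjee.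
Context (R : realType) d (Om : measurableType d) (P : probability Om R).

Definition nondegenerate_RV (Y : {RV P >-> R}) :=
  ~ exists c : R, P [set w | Y w = c] = 1%E.

Definition xi d' (S : measurableType d') (Y : {RV P >-> R}) (Z : {RV P >-> S})
    : R :=
  fine (\int[distribution P Y]_y
          'V_P[cond_prob P Z [set w | y <= Y w]%R \o Z])%E /
  fine (\int[distribution P Y]_y 'V_P[\1_[set w | y <= Y w]%R])%E.

(* The convention is xi(Y_1, emptyset) = 0. *)
Definition xi_past q (Y : {RV P >-> 'rV[R]_q}) (i : 'I_q) : R :=
  if i == 0%N :> nat then 0 else xi (rv_coord Y i) (rv_rpast Y i).

Definition chatterjee_T q p (Y : {RV P >-> 'rV[R]_q}) (X : {RV P >-> 'rV[R]_p})
    : R :=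
  1 - (q%:R - \sum_(i < q) xi (rv_coord Y i) (rv_joint X (rv_rpast Y i))) /
      (q%:R - \sum_(i < q) xi_past Y i).

End chatterjee.

Arguments nondegenerate_RV {R d Om} P.
Arguments xi {R d Om} P {d' S}.
Arguments xi_past {R d Om} P {q}.
Arguments chatterjee_T {R d Om} P {q p}.

(* The Markov product of (Y, Z) is mu: the law of a pair (Y1, Y2) such that,
   on some probability space, (Y1, Z1) is a copy of (Y, Z), Y2 has the same
   conditional distribution kappa given Z1 as Y given Z, and Y1 and Y2 are
   conditionally independent given Z1. *)
Definition is_markov_product (R : realType) d (Om : measurableType d)
    (P : probability Om R) d' (S : measurableType d')
    (Y : {RV P >-> R}) (Z : {RV P >-> S}) (kappa : R.-pker S ~> R)
    (mu : probability (R * R)%type R) : Prop :=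
  exists (d1 : measure_display) (Om1 : measurableType d1)
    (P1 : probability Om1 R) (Y1 Y2 : {RV P1 >-> R}) (Z1 : {RV P1 >-> S}),
  [/\ (forall C : set (R * S), measurable C ->
         P1 [set w | C (Y1 w, Z1 w)] = P [set w | C (Y w, Z w)]),
      reg_cond_distr P1 Y2 Z1 kappa,
      cond_indep P1 Y1 Y2 Z1 &
      forall C : set (R * R), measurable C ->
        mu C = P1 [set w | C (Y1 w, Y2 w)]].

Definition cvg_in_distribution (R : realType) (S : topologicalType)
    (dn : nat -> measure_display) (Omn : forall n, measurableType (dn n))
    (Pn : forall n, probability (Omn n) R) (Zn : forall n, Omn n -> S)
    d (Om : measurableType d) (P : probability Om R) (Z : Om -> S) : Prop :=
  forall f : S -> R, continuous f -> (exists M : R, forall x, `|f x| <= M) ->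
    ('E_(Pn n)[f \o Zn n] @[n --> \oo] --> 'E_P[f \o Z])%E.

Definition weak_cvg_R (R : realType) (mun : nat -> probability R R)
    (mu : probability R R) : Prop :=
  cvg_in_distribution mun (fun _ (x : R) => x) mu (fun x : R => x).

Definition weak_cvg_R2 (R : realType)
    (mun : nat -> probability (R * R)%type R)
    (mu : probability (R * R)%type R) : Prop :=
  cvg_in_distribution mun (fun _ (x : R * R) => x) mu (fun x : R * R => x).

(* The ascription gives R[i] the topology and norm of a numFieldType. *)
Definition cplx (R : realType) : numFieldType := R[i].

Definition cintegral (R : realType) d (S : measurableType d)
    (mu : {measure set S -> \bar R}) (u : S -> cplx R) : cplx R :=
  ((\int[mu]_x complex.Re (u x)) +i* (\int[mu]_x complex.Im (u x)))%C.

Definition cvg_determining_class (R : realType) (U : set (R -> cplx R))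
    : Prop :=
  (forall u, U u -> continuous u /\ exists M : cplx R, forall y, `|u y| <= M) /\
  (forall (mun : nat -> probability R R) (mu : probability R R),
     (forall u, U u ->
        cintegral (mun n) u @[n --> \oo] --> cintegral mu u) ->
     weak_cvg_R mun mu).

Definition asymp_equicontinuous (R : realType) m (f : nat -> 'rV[R]_m -> cplx R)
    (V : set 'rV[R]_m) : Prop :=
  forall (e : R) x, 0 < e -> V x ->
    exists (delta : R) (n0 : nat), 0 < delta /\
      forall n x', (n0 < n)%N -> `|x' - x| <= delta ->
        `|f n x' - f n x| < (e%:C)%C.

(* E[u(Y) | Z = z], for a fixed version kappa of the regular conditional
   distribution of Y given Z. *)
Definition cond_expectation (R : realType) d (S : measurableType d)
    (kappa : R.-pker S ~> R) (u : R -> cplx R) (z : S) : cplx R :=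
  cintegral (kappa z) u.

Definition quantile (R : realType) d (Om : measurableType d)
    (P : probability Om R) (Y : {RV P >-> R}) (t : R) : R :=
  inf [set y | (t%:E <= cdf Y y)%E].

Arguments is_markov_product {R d Om} P {d' S}.
Arguments quantile {R d Om} P.

(* Main.v *)
Require Import Defs.
From HB Require Import structures.
From mathcomp Require Import all_boot all_order all_algebra.
From mathcomp Require Import all_classical all_reals all_analysis.
From mathcomp Require Import measurable_realfun.
From mathcomp Require Import complex lra ring.
Set Implicit Arguments.
Unset Strict Implicit.
Unset Printing Implicit Defensive.
Import Order.TTheory GRing.Theory Num.Theory.
Import numFieldNormedType.Exports.
Local Open Scope classical_set_scope.
Local Open Scope ring_scope.

(** (a) Let g_n(z) = E[u(Y_n) | Z_n = z] and let g be its analogue in the limit.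
    On a compact subset of V of almost full measure, asymptotic equicontinuity
    and a partition of unity phi_k give a fixed continuous function
    G = sum_k c_k phi_k, with c_k = E[g(Z) phi_k(Z)] / E[phi_k(Z)], that is close
    to g_n in L1(P^{Z_n}) for large n, hence also close to g in L1(P^Z).
    Therefore E[h(Y_n) g_n(Z_n)] -> E[h(Y) g(Z)] for all bounded continuous h,
    that is, E[h(Y_n) u(Y_n')] -> E[h(Y) u(Y')] for the Markov products. For a
    fixed weight h this is a statement about convergence of laws of Y_n' weighted
    by h(Y_n), so the convergence-determining property of the class of the u
    replaces u by an arbitrary bounded continuous function; products of such
    functions determine weak convergence on the plane.

    (b) If mu is the Markov product of (Y, Z), the numerator of xi(Y, Z) is the
    integral of mu([y, oo[^2) - P(Y >= y)^2 over P^Y(dy), i.e. the integral over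
    ]0, 1[ of the same expression at y = q(t), with q the quantile function.
    Condition (iv) forces P(Y_n < q_n(t)) -> P(Y < q(t)) for almost all t: the
    lower bound is weak convergence and, on a plateau of q, the values
    q_n(s) with s slightly above P(Y < q(t)) already exhaust the atom. Sandwiching
    mu_n([q_n(t), oo[^2) by a ramp function then gives convergence of the
    integrand, and dominated convergence concludes. *)

(** * Integrals of bounded measurable functions *)

(** In (a) nothing makes the kernels themselves converge: the limit regression g need not be
    continuous, and each g_n is tied to a law that changes with n. The continuous G is a common
    reference that can be integrated against all these laws, and g meets it only through test
    integrals. Equicontinuity is given for u in the class only, so the passage to general functions
    cannot be made on g_n; it is made on laws of Y_n' weighted by h(Y_n). In (b) the threshold y is
    drawn from a law that also changes with n; the quantile transform moves all integrals to
    Lebesgue measure on ]0, 1[, where dominated convergence applies. An abstract Markov product is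
    reached through its values E[K(Z, A) K(Z, B)] on rectangles. The denominator of T is positive
    because the limiting xi are at most 1 and the first summand is 0 by convention. *)

Section bounded_measurable.
Context d (T : measurableType d) (R : realType).
Implicit Types f g : T -> R.

(** The bound is uniform in x, so such functions are integrable for every probability measure at
    once. *)
Definition bounded_measurable f :=
  measurable_fun [set: T] f /\ exists M, forall x, `|f x| <= M.

Lemma bounded_measurable_cst c : bounded_measurable (cst c).
Proof. by split; [exact: measurable_cst|exists `|c|]. Qed.

Lemma bounded_measurable_indic A : measurable A -> bounded_measurable \1_A.
Proof.
move=> mA; split; first exact: measurable_indic.
by exists 1 => x; rewrite indicE ger0_norm// lern1 leq_b1.
Qed.

Lemma bounded_measurableD f g : bounded_measurable f -> bounded_measurable g ->
  bounded_measurable (fun x => f x + g x).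
Proof.
move=> [mf [M fM]] [mg [N gN]]; split; first exact: measurable_funD.
exists (M + N) => x; exact: le_trans (ler_normD _ _) (lerD _ _).
Qed.

Lemma bounded_measurableN f : bounded_measurable f ->
  bounded_measurable (fun x => - f x).
Proof.
move=> [mf [M fM]]; split; first exact: measurableT_comp.
by exists M => x; rewrite normrN.
Qed.

Lemma bounded_measurableB f g : bounded_measurable f -> bounded_measurable g ->
  bounded_measurable (fun x => f x - g x).
Proof. by move=> bf bg; apply: bounded_measurableD => //; exact: bounded_measurableN. Qed.

Lemma bounded_measurableM f g : bounded_measurable f -> bounded_measurable g ->
  bounded_measurable (fun x => f x * g x).
Proof.
move=> [mf [M fM]] [mg [N gN]]; split; first exact: measurable_funM.
by exists (M * N) => x; rewrite normrM ler_pM.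
Qed.

Lemma bounded_measurable_norm f : bounded_measurable f ->
  bounded_measurable (fun x => `|f x|).
Proof.
move=> [mf [M fM]]; split; first exact: measurableT_comp.
by exists M => x; rewrite normr_id.
Qed.

Lemma bounded_measurable_sum I (s : seq I) (F : I -> T -> R) :
  (forall i, bounded_measurable (F i)) ->
  bounded_measurable (fun x => \sum_(i <- s) F i x).
Proof.
move=> bF; elim: s => [|i s IHs].
  under eq_fun do rewrite big_nil; exact: bounded_measurable_cst.
under eq_fun do rewrite big_cons; exact: bounded_measurableD.
Qed.

Variable P : probability T R.

Lemma bounded_integrable f : bounded_measurable f ->
  P.-integrable setT (EFin \o f).
Proof.
move=> [mf [M fM]].
apply: (@le_integrable _ _ _ _ _ measurableT _ (EFin \o cst M)).
- exact/measurable_EFinP.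
- by move=> x _ /=; rewrite lee_fin (le_trans (fM x))// ler_norm.
- exact: finite_measure_integrable_cst.
Qed.

Lemma EFin_Rintegral f : bounded_measurable f ->
  (\int[P]_x (f x)%:E = (\int[P]_x f x)%:E)%E.
Proof. by move=> bf; rewrite /Rintegral fineK//; exact/integrable_fin_num/bounded_integrable. Qed.

Lemma Rint_cst c : \int[P]_x c = c.
Proof. by rewrite Rintegral_cst// [X in fine X]probability_setT mulr1. Qed.

Lemma RintD f g : bounded_measurable f -> bounded_measurable g ->
  \int[P]_x (f x + g x) = \int[P]_x f x + \int[P]_x g x.
Proof. by move=> bf bg; apply: RintegralD => //; exact: bounded_integrable. Qed.

Lemma RintB f g : bounded_measurable f -> bounded_measurable g ->
  \int[P]_x (f x - g x) = \int[P]_x f x - \int[P]_x g x.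
Proof. by move=> bf bg; apply: RintegralB => //; exact: bounded_integrable. Qed.

Lemma RintZ c f : bounded_measurable f ->
  \int[P]_x (c * f x) = c * \int[P]_x f x.
Proof. by move=> bf; apply: RintegralZl => //; exact: bounded_integrable. Qed.

Lemma Rint_sum I (s : seq I) (F : I -> T -> R) :
  (forall i, bounded_measurable (F i)) ->
  \int[P]_x (\sum_(i <- s) F i x) = \sum_(i <- s) \int[P]_x F i x.
Proof.
move=> bF; elim: s => [|i s IHs].
  by under eq_Rintegral do rewrite big_nil; rewrite Rint_cst big_nil.
under eq_Rintegral do rewrite big_cons.
by rewrite RintD// ?big_cons ?IHs//; exact: bounded_measurable_sum.
Qed.

Lemma le_Rint f g : bounded_measurable f -> bounded_measurable g ->
  (forall x, f x <= g x) -> \int[P]_x f x <= \int[P]_x g x.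
Proof. by move=> bf bg fg; apply: le_Rintegral => //; exact: bounded_integrable. Qed.

Lemma Rint_ge0 f : (forall x, 0 <= f x) -> 0 <= \int[P]_x f x.
Proof. by move=> f0; apply: Rintegral_ge0. Qed.

Lemma Rint_le_cst f c : bounded_measurable f ->
  (forall x, f x <= c) -> \int[P]_x f x <= c.
Proof.
by move=> bf fc; rewrite -[leRHS]Rint_cst; apply: le_Rint => //; exact: bounded_measurable_cst.
Qed.

Lemma normr_Rint f : bounded_measurable f ->
  `|\int[P]_x f x| <= \int[P]_x `|f x|.
Proof. by move=> bf; apply: le_normr_Rintegral => //; exact: bounded_integrable. Qed.

Lemma Rint_indic A : measurable A -> \int[P]_x (\1_A x) = fine (P A).
Proof. by move=> mA; rewrite /Rintegral integral_indic// setIT. Qed.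

Lemma cvg_Rint_ae (f_ : nat -> T -> R) f (M : R) :
  (forall n, measurable_fun setT (f_ n)) -> (forall n x, `|f_ n x| <= M) ->
  bounded_measurable f ->
  (\forall x \ae P, f_ n x @[n --> \oo] --> f x) ->
  \int[P]_x f_ n x @[n --> \oo] --> \int[P]_x f x.
Proof.
move=> mf_ fM bf cf.
have cE : \forall x \ae P, setT x -> (f_ n x)%:E @[n --> \oo] --> (f x)%:E.
  apply: filterS cf => x cx _; apply: cvg_EFin; [exact: nearW|exact: cx].
have [_ _ h] := @dominated_convergence _ _ _ P setT measurableT
  (fun n => EFin \o f_ n) (EFin \o f) (cst M%:E)
  (fun n => (measurable_EFinP _ _).2 (mf_ n)) ((measurable_EFinP _ _).2 bf.1) cE
  (finite_measure_integrable_cst P M measurableT)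
  (@aeW _ _ _ P _ (fun x n _ => fM n x)).
by apply: fine_cvg; rewrite -EFin_Rintegral.
Qed.

Lemma cvg_Rint (f_ : nat -> T -> R) f (M : R) :
  (forall n, measurable_fun setT (f_ n)) -> (forall n x, `|f_ n x| <= M) ->
  (forall x, f_ n x @[n --> \oo] --> f x) ->
  \int[P]_x f_ n x @[n --> \oo] --> \int[P]_x f x.
Proof.
move=> mf_ fM cf; apply: (cvg_Rint_ae mf_ fM); last exact: aeW.
split; first by apply: (measurable_fun_cvg mf_) => x _; exact: cf.
by exists M => x; apply: cvgr_to_le (cvg_norm (cf x)) _; exact: nearW.
Qed.

End bounded_measurable.

(** * Continuous functions and the Borel sets of row vectors *)

Section real_continuity.
Context (R : realType) (T : topologicalType).
Implicit Types f g : T -> R.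

Lemma continuous_realD f g : continuous f -> continuous g -> continuous (fun x => f x + g x).
Proof. by move=> cf cg x; exact: cvgD (cf x) (cg x). Qed.

Lemma continuous_realB f g : continuous f -> continuous g -> continuous (fun x => f x - g x).
Proof. by move=> cf cg x; exact: cvgB (cf x) (cg x). Qed.

Lemma continuous_realM f g : continuous f -> continuous g -> continuous (fun x => f x * g x).
Proof. by move=> cf cg x; exact: cvgM (cf x) (cg x). Qed.

Lemma continuous_real_cst (c : R) : continuous (fun _ : T => c).
Proof. by move=> x; exact: cvg_cst. Qed.

Lemma continuous_real_sum I (s : seq I) (F : I -> T -> R) : (forall i, continuous (F i)) ->
  continuous (fun x => \sum_(i <- s) F i x).
Proof.
move=> cF; elim: s => [|i s IHs].
  by under eq_fun do rewrite big_nil; exact: continuous_real_cst.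
by under eq_fun do rewrite big_cons; exact: continuous_realD.
Qed.

Lemma continuous_realV f : (forall x, f x != 0) -> continuous f -> continuous (fun x => (f x)^-1).
Proof. by move=> f0 cf x; exact: cvgV (f0 x) (cf x). Qed.

End real_continuity.

Section clamp.
Context (R : realType).

(** All cut-off functions below are built from it: approximate half-spaces, bumps of a partition of
    unity, ramps. *)
Definition clamp (x : R) := Num.max 0 (Num.min 1 x).

Lemma clamp_ge0 x : 0 <= clamp x.
Proof. by rewrite /clamp le_max lexx. Qed.

Lemma clamp_le1 x : clamp x <= 1.
Proof. by rewrite /clamp ge_max ler01 ge_min lexx. Qed.

Lemma clamp_eq0 x : x <= 0 -> clamp x = 0.
Proof. by move=> x0; rewrite /clamp; apply/max_idPl; rewrite ge_min x0 orbT. Qed.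

Lemma clamp_eq1 x : 1 <= x -> clamp x = 1.
Proof. by move=> x1; rewrite /clamp (min_idPl x1); apply/max_idPr. Qed.

Lemma clamp_continuous (T : topologicalType) (f : T -> R) :
  continuous f -> continuous (clamp \o f).
Proof.
move=> cf; apply: (@max_fun_continuous _ T R (cst 0) (cst 1 \min f)).
  by move=> x; exact: cvg_cst.
by apply: min_fun_continuous => // x; exact: cvg_cst.
Qed.

End clamp.

Lemma bounded_measurable_comp (R : realType) d (T : measurableType d)
    d' (T' : measurableType d') (phi : T' -> T) (f : T -> R) :
  measurable_fun setT phi -> bounded_measurable f -> bounded_measurable (f \o phi).
Proof.
move=> mphi [mf [M fM]]; split; first exact: measurableT_comp.
by exists M => x; exact: fM.
Qed.

Section borel_rV.
Context (R : realType) (m : nat).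

(** The sigma-algebra is generated by coordinates, so countability has to enter: an open set is the
    union of the boxes with rational centre and radius 1/(k+1) that it contains. *)
Lemma open_measurable_rV (A : set 'rV[R]_m) : open A -> measurable A.
Proof.
move=> oA.
pose box (ck : 'rV[rat]_m * nat) : set 'rV[R]_m :=
  [set x | forall i, `|ratr (ck.1 ord0 i) - x ord0 i : R| < ck.2.+1%:R^-1].
have mbox ck : measurable (box ck).
  rewrite (_ : box ck = \bigcap_(i in [set` enum 'I_m])
      [set x | `|ratr (ck.1 ord0 i) - x ord0 i : R| < ck.2.+1%:R^-1]); last first.
    apply/seteqP; split => x bx i; first by move=> _; exact: bx.
    by apply: (bx i); rewrite /= mem_enum.
  apply: fin_bigcap_measurable => [|i _]; first exact: finite_seq.
  rewrite [X in measurable X](_ : _ = (fun x : 'rV[R]_m => x ord0 i) @^-1`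
      (ball (ratr (ck.1 ord0 i) : R) ck.2.+1%:R^-1 : set R)); last first.
    by rewrite -ball_normE.
  rewrite -[X in measurable X]setTI; apply: measurable_coord => //.
  by apply: open_measurable; exact: ball_open.
rewrite (_ : A = \bigcup_ck [set x | box ck x /\ box ck `<=` A]); last first.
  apply/seteqP; split => x; last by move=> [ck _ [bx]]; exact.
  move=> Ax.
  have /nbhs_ballP[e /= e0 eA] : nbhs x A by exact: open_nbhs_nbhs.
  (* A box of radius below e / 2 that contains x lies in the ball of radius e around x. *)
  have [k ke] : exists k : nat, 0 + k.+1%:R^-1 < e / 2.
    by apply: ltr_add_invr; rewrite divr_gt0.
  rewrite add0r in ke.
  have qP i : exists q : rat, `|ratr q - x ord0 i| < k.+1%:R^-1.
    have [|q] := @rat_in_itvoo R (x ord0 i - k.+1%:R^-1) (x ord0 i + k.+1%:R^-1).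
      by rewrite ltrBlDr -addrA ltrDl addr_gt0// invr_gt0.
    by rewrite in_itv/= => /andP[q1 q2]; exists q; rewrite ltr_distl; apply/andP.
  have [q {}qP] := choice qP.
  exists (\row_i q i, k) => //; split => [i|y yb]; first by rewrite mxE.
  apply: eA; split => // i j; rewrite (ord1 i) -ball_normE /=.
  rewrite (splitr e) (le_lt_trans (ler_distD (ratr (q j)) _ _))// ltrD//.
    by rewrite distrC (lt_trans (qP j)).
  by have := yb j; rewrite mxE => /lt_trans; apply.
apply: countable_bigcupT_measurable => [|ck]; first exact: countableP.
have [bA|nbA] := pselect (box ck `<=` A).
  by rewrite (_ : mkset _ = box ck)//; apply/seteqP; split => x // [].
by rewrite (_ : mkset _ = set0)//; apply/seteqP; split => x // [].
Qed.

Lemma continuous_measurable_rV (f : 'rV[R]_m -> R) :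
  continuous f -> measurable_fun setT f.
Proof.
move=> cf; apply: (measurability (@RGenOpens.G R)).
  exact: RGenOpens.measurableE.
move=> _ [_ [a [b ->] <-]]; rewrite setTI; apply: open_measurable_rV.
by move/continuousP : cf; apply; exact: interval_open.
Qed.

End borel_rV.

(** * Approximation of indicators by continuous functions in L1 *)

Section density.
Context (R : realType) (m : nat) (nu : probability 'rV[R]_m R).

(** The sets with such approximations at every precision form a sigma-algebra that contains the
    half-spaces x_i > a, and these generate the measurable sets. *)
Lemma measurable_approx_continuous (A : set 'rV[R]_m) : measurable A ->
  forall e, 0 < e -> exists psi : 'rV[R]_m -> R,
    [/\ continuous psi, forall x, 0 <= psi x <= 1 &
        \int[nu]_x `|\1_A x - psi x| <= e].
Proof.
move=> mA; pose appr (B : set 'rV[R]_m) := forall e, 0 < e ->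
  exists psi : 'rV[R]_m -> R, [/\ continuous psi, forall x, 0 <= psi x <= 1 &
        \int[nu]_x `|\1_B x - psi x| <= e].
have bm (psi : 'rV[R]_m -> R) : continuous psi -> (forall x, 0 <= psi x <= 1) ->
    bounded_measurable psi.
  move=> cpsi psi01; split; first exact: continuous_measurable_rV.
  by exists 1 => x; have /andP[p0 p1] := psi01 x; rewrite ger0_norm.
suff: [set B | measurable B /\ appr B] A by case.
have appr0 : appr set0.
  move=> e e0; exists (cst 0); split => [|x|].
  - exact: cst_continuous.
  - by rewrite /= lexx ler01.
  - under eq_Rintegral do rewrite indic0 /= subrr normr0.
    by rewrite Rint_cst ltW.
have apprC B : appr B -> appr (~` B).
  move=> aB e e0; have [psi [cpsi psi01 psie]] := aB _ e0.
  exists (fun x => 1 - psi x); split => [|x|].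
  - by apply: continuous_realB => //; exact: continuous_real_cst.
  - by have /andP[p0 p1] := psi01 x; rewrite subr_ge0 p1 gerBl.
  - apply: le_trans psie; rewrite le_eqVlt; apply/orP; left; apply/eqP.
    apply: eq_Rintegral => x _; rewrite !indicE in_setC -normrN opprB.
    by case: (x \in B) => /=; congr (`|_|); ring.
have apprU B C : measurable B -> measurable C ->
    appr B -> appr C -> appr (B `|` C).
  move=> mB mC aB aC e e0.
  have e20 : 0 < e / 2 by rewrite divr_gt0.
  have [f [cf f01 fe]] := aB _ e20; have [g [cg g01 ge]] := aC _ e20.
  (* The analogue of a union for functions with values in [0, 1]; its error is at most the sum of
     the two errors. *)
  exists (fun x => 1 - (1 - f x) * (1 - g x)).
  have fg01 x : 0 <= 1 - (1 - f x) * (1 - g x) <= 1.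
    have /andP[f0 f1] := f01 x; have /andP[g0 g1] := g01 x.
    by apply/andP; split; nra.
  have cfg : continuous (fun x => 1 - (1 - f x) * (1 - g x) : R).
    apply: continuous_realB; first exact: continuous_real_cst.
    by apply: continuous_realM; apply: continuous_realB => //; exact: continuous_real_cst.
  split => //.
  rewrite (splitr e) (le_trans _ (lerD fe ge))// -RintD; last 2 first.
  - apply: bounded_measurable_norm; apply: bounded_measurableB (bm _ cf f01).
    exact: bounded_measurable_indic.
  - apply: bounded_measurable_norm; apply: bounded_measurableB (bm _ cg g01).
    exact: bounded_measurable_indic.
  apply: le_Rint => [||x].
  - apply: bounded_measurable_norm; apply: bounded_measurableB (bm _ cfg fg01).
    by apply: bounded_measurable_indic; exact: measurableU.
  - apply: bounded_measurableD; apply: bounded_measurable_norm.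
      apply: bounded_measurableB (bm _ cf f01).
      exact: bounded_measurable_indic.
    apply: bounded_measurableB (bm _ cg g01).
    exact: bounded_measurable_indic.
  - rewrite !indicE in_setU.
    have /andP[f0 f1] := f01 x; have /andP[g0 g1] := g01 x.
    case: (x \in B); case: (x \in C) => /=; rewrite ?sub0r ?normrN;
      rewrite !ger0_norm ?subr_ge0//; nra.
have sG : sigma_algebra setT [set B | measurable B /\ appr B].
  split => [|B [mB aB]|F mF].
  - by split.
  - by rewrite setTD; split; [exact: measurableC|exact: apprC].
  - have mU : measurable (\bigcup_k F k).
      by apply: bigcup_measurable => k _; case: (mF k).
    have mUn n : measurable (\big[setU/set0]_(i < n) F i).
      by apply: bigsetU_measurable => k _; case: (mF k).
    have aUn n : appr (\big[setU/set0]_(i < n) F i).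
      elim: n => [|n IHn]; first by rewrite big_ord0.
      rewrite big_ord_recr /=; exact: (apprU _ _ (mUn n) (mF n).1 IHn (mF n).2).
    split => // e e0.
    (* Finite unions tend to the countable one in L1, so it is enough to approximate one of them up
       to e / 2. *)
    have : \int[nu]_x `|\1_(\bigcup_k F k) x - \1_(\big[setU/set0]_(i < n) F i) x|
        @[n --> \oo] --> \int[nu]_x (0 : R).
      apply: (@cvg_Rint _ _ _ _ _ _ 1) => [n|n x|x].
      - by have [] := bounded_measurable_norm (bounded_measurableB
          (bounded_measurable_indic R mU) (bounded_measurable_indic R (mUn n))).
      - rewrite normr_id !indicE; case: (x \in _); case: (x \in _);
          by rewrite /= ?subrr ?subr0 ?sub0r ?normrN ?normr1 ?normr0 ?ler01.
      - rewrite -(@normr0 _ R); apply: cvg_norm.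
        rewrite -(subrr (\1_(\bigcup_k F k) x : R)); apply: cvgB.
          exact: cvg_cst.
        apply: cvg_near_cst.
        have [[k _ Fkx]|nF] := pselect ((\bigcup_k F k) x).
          exists k.+1 => // n /= kn; rewrite !indicE.
          have Un : (\big[setU/set0]_(i < n) F i) x.
            by rewrite -bigcup_mkord; exists k.
          have U : (\bigcup_k F k) x by exists k.
          by rewrite (mem_set Un) (mem_set U).
        apply: nearW => n; rewrite !indicE (memNset nF) memNset//.
        by rewrite -bigcup_mkord => -[k _ Fkx]; apply: nF; exists k.
    rewrite Rint_cst => /cvgr0Pnorm_le /(_ (e / 2)).
    rewrite divr_gt0// => /(_ isT) [n _ /(_ n (leqnn n))].
    rewrite ger0_norm; last by apply: Rint_ge0.
    move=> ne; have [|psi [cpsi psi01 psie]] := aUn n (e / 2).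
      by rewrite divr_gt0.
    exists psi; split => //; rewrite (splitr e) (le_trans _ (lerD ne psie))//.
    have b1 := bounded_measurable_indic R mU.
    have b2 := bounded_measurable_indic R (mUn n).
    have b3 := bm _ cpsi psi01.
    have b12 := bounded_measurable_norm (bounded_measurableB b1 b2).
    have b23 := bounded_measurable_norm (bounded_measurableB b2 b3).
    rewrite -RintD//; apply: le_Rint => [||x].
    - exact: bounded_measurable_norm (bounded_measurableB b1 b3).
    - exact: bounded_measurableD.
    - exact: ler_distD.
apply: (smallest_sub sG) mA.
(* The generators are the preimages of Borel sets under single coordinates; for one coordinate,
   Borel sets reduce to rays. *)
elim/big_ind: _ => // [B C sB sC|i _]; first by rewrite subUset.
move=> _ [B mB <-]; rewrite setTI.
have sGi : sigma_algebra setT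
    [set B : set R | measurable ((fun x : 'rV[R]_m => x ord0 i) @^-1` B) /\
                     appr ((fun x : 'rV[R]_m => x ord0 i) @^-1` B)].
  have [G0 GC GU] := sG; split.
  - by rewrite /= preimage_set0; exact: G0.
  - by move=> C GC'; rewrite /= setTD preimage_setC -setTD; exact: GC.
  - by move=> F GF; rewrite /= preimage_bigcup; exact: GU.
have {mB}: (@RGenOInfty.G R).-sigma.-measurable B.
  by rewrite -RGenOInfty.measurableE.
apply: (smallest_sub sGi) => _ [a ->].
pose A' : set 'rV[R]_m := (fun x => x ord0 i) @^-1` `]a, +oo[%classic.
change (measurable A' /\ appr A').
have mA' : measurable A'.
  rewrite /A' -[X in measurable X]setTI.
  by apply: measurable_coord => //; exact: measurable_itv.
split=> // e e0.
pose psi j (x : 'rV[R]_m) := clamp (j%:R * (x ord0 i - a)).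
have cpsi j : continuous (psi j).
  apply: clamp_continuous; apply: continuous_realM; first exact: continuous_real_cst.
  by apply: continuous_realB; [exact: coord_continuous|exact: continuous_real_cst].
have psi01 j x : 0 <= psi j x <= 1 by rewrite clamp_ge0 clamp_le1.
have : \int[nu]_x `|\1_A' x - psi j x| @[j --> \oo] --> \int[nu]_x (0 : R).
  apply: (@cvg_Rint _ _ _ _ _ _ 1) => [n|n x|x].
  - by have [] := bounded_measurable_norm (bounded_measurableB
          (bounded_measurable_indic R mA') (bm _ (cpsi n) (psi01 n))).
  - rewrite normr_id indicE; have /andP[p0 p1] := psi01 n x.
    by case: (x \in A') => /=; [rewrite ger0_norm|rewrite sub0r normrN ger0_norm];
      rewrite ?subr_ge0 ?gerBl.
  - rewrite -(@normr0 _ R); apply: cvg_norm.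
    rewrite -(subrr (\1_A' x : R)); apply: cvgB; first exact: cvg_cst.
    apply: cvg_near_cst; rewrite indicE.
    have [ax|xa] := ltP a (x ord0 i).
      rewrite mem_set; last by rewrite /A'/= in_itv/= ax.
      near=> j; apply: clamp_eq1; rewrite -ler_pdivrMr ?subr_gt0// mul1r.
      by near: j; exact: nbhs_infty_ger.
    rewrite memNset; last by rewrite /A'/= in_itv/= andbT; apply/negP; rewrite -leNgt.
    apply: nearW => j; apply: clamp_eq0.
    by rewrite mulr_ge0_le0// subr_le0.
rewrite Rint_cst => /cvgr0Pnorm_le /(_ e e0) [n _ /(_ n (leqnn n))].
rewrite ger0_norm; last by apply: Rint_ge0.
by move=> ne; exists (psi n).
Unshelve. all: by end_near. Qed.

End density.

(** * Partitions of unity and inner compact sets *)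

Section partition.
Context (R : realType) (T : normedModType R).

Lemma continuous_distance (x : T) : continuous (fun z : T => `|z - x|).
Proof.
by move=> z; apply: cvg_norm; apply: cvgB; [exact: cvg_id|exact: cvg_cst].
Qed.

(** Bumps on finitely many balls that cover K are divided by max(1, S) instead of their sum S: the
    quotient is continuous also where S vanishes, and S >= 1 on K makes the total there exactly
    1. *)
Lemma partition_of_unity (K : set T) (r : T -> R) :
  compact K -> (forall x, K x -> 0 < r x) ->
  exists (s : seq T) (phi : T -> T -> R),
    [/\ forall x, x \in s -> K x,
        forall x, continuous (phi x),
        forall x z, 0 <= phi x z,
        forall z, \sum_(x <- s) phi x z <= 1 /\
                  (K z -> \sum_(x <- s) phi x z = 1) &
        forall x z, x \in s -> phi x z != 0 -> `|z - x| <= r x].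
Proof.
rewrite compact_cover => cK r0.
have [||s sK Ks] := @cK T K (fun x => ball x (r x / 2)).
- by move=> x Kx; apply: ball_open; rewrite divr_gt0 ?r0.
- by move=> x Kx; exists x => //; apply: ballxx; rewrite divr_gt0 ?r0.
(* For r x > 0 this is 1 when |z - x| <= r x / 2 and 0 when |z - x| >= r x. *)
pose b (x z : T) := clamp (2 - 2 * (`|z - x| / r x)).
pose S z := \sum_(x <- finmap.enum_fset s) b x z.
have b0 x z : 0 <= b x z by exact: clamp_ge0.
have S0 z : 0 <= S z by apply: sumr_ge0.
have M0 z : 0 < Num.max 1 (S z) by rewrite lt_max ltr01.
have cb x : continuous (b x).
  apply: clamp_continuous; apply: continuous_realB; first exact: continuous_real_cst.
  apply: continuous_realM; first exact: continuous_real_cst.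
  by apply: continuous_realM; [exact: continuous_distance|exact: continuous_real_cst].
exists (finmap.enum_fset s), (fun x z => b x z / Num.max 1 (S z)); split.
- by move=> x /sK; rewrite inE.
- move=> x; apply: continuous_realM => //; apply: continuous_realV => [z|]; first by rewrite gt_eqF.
  by apply: max_fun_continuous; [exact: continuous_real_cst|exact: continuous_real_sum].
- by move=> x z; rewrite divr_ge0// ltW.
- move=> z; rewrite -mulr_suml -/(S z); split=> [|Kz].
    by rewrite ler_pdivrMr// mul1r le_max lexx orbT.
  suff S1 : 1 <= S z by rewrite (max_idPr S1) divff// gt_eqF// (lt_le_trans ltr01).
  have [x /= xs xz] := Ks z Kz.
  have rx : 0 < r x by apply: r0; move/sK : xs; rewrite inE.
  rewrite /S (big_rem x)//= -[leLHS]addr0 lerD//; last exact: sumr_ge0.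
  rewrite /b clamp_eq1//; move: xz; rewrite -ball_normE /= distrC => xz.
  have : `|z - x| / r x <= 2^-1 by rewrite ler_pdivrMr// mulrC ltW.
  by move=> h; lra.
- move=> x z xs; apply: contraNT; rewrite -ltNge => rz.
  have rx : 0 < r x by apply: r0; move/sK : xs; rewrite inE.
  have : 1 < `|z - x| / r x by rewrite ltr_pdivlMr// mul1r.
  by move=> h; rewrite /b clamp_eq0 ?mul0r//; lra.
Qed.

End partition.

Lemma near_all_in_seq (I : eqType) (s : seq I) (Q : I -> nat -> Prop) :
  (forall i, i \in s -> \forall n \near \oo, Q i n) ->
  \forall n \near \oo, forall i, i \in s -> Q i n.
Proof.
elim: s => [|i s IHs] h; first exact: nearW.
have hi := h i (mem_head _ _).
have {}IHs := IHs (fun j js => h j (mem_behead (s := i :: s) js)).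
near=> n => j; rewrite inE => /orP[/eqP ->|js].
  by near: n.
by move: j js; near: n.
Unshelve. all: by end_near. Qed.

Definition continuous_bounded (R : realType) (T : topologicalType) (f : T -> R) :=
  continuous f /\ exists M, forall x, `|f x| <= M.

Lemma continuous_bounded01 (R : realType) (T : topologicalType) (f : T -> R) :
  continuous f -> (forall x, 0 <= f x <= 1) -> continuous_bounded f.
Proof.
move=> cf f01; split => //; exists 1 => x.
by have /andP[f0 f1] := f01 x; rewrite ger0_norm.
Qed.

Lemma continuous_bounded_measurable (R : realType) m (f : 'rV[R]_m -> R) :
  continuous_bounded f -> bounded_measurable f.
Proof. by move=> [cf bf]; split => //; exact: continuous_measurable_rV. Qed.

(** V is exhausted by the points of norm at most j at distance at least 1/(j+1) from its complement.
    These sets are closed and bounded, and nu is continuous from below. *)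
Lemma open_full_inner_compact (R : realType) m (nu : probability 'rV[R]_m R)
    (V : set 'rV[R]_m) : open V -> nu V = 1%E -> forall e, 0 < e ->
  exists K : set 'rV[R]_m, [/\ compact K, measurable K, K `<=` V & 1 - e <= fine (nu K)].
Proof.
move=> oV nuV e e0.
(* The distance condition is an intersection of closed sets, which also covers V = setT. *)
pose F (j : nat) := [set z : 'rV[R]_m | `|z| <= j%:R] `&`
  \bigcap_(y in ~` V) [set z | j.+1%:R^-1 <= `|z - y|].
have clF j : closed (F j).
  apply: closedI.
    apply: (@preimage_closed _ _ (fun z : 'rV[R]_m => `|z|) [set t | t <= j%:R]).
      by move=> z _; exact: norm_continuous.
    exact: closed_le.
  apply: closed_bigI => y _.
  apply: (@preimage_closed _ _ (fun z : 'rV[R]_m => `|z - y|) [set t | j.+1%:R^-1 <= t]).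
    by move=> z _; exact: continuous_distance.
  exact: closed_ge.
have mF j : measurable (F j).
  rewrite -[X in measurable X]setCK; apply: measurableC.
  by apply: open_measurable_rV; exact: closed_openC.
have FV j : F j `<=` V.
  move=> z [_ Fz]; apply: contrapT => nVz; have := Fz z nVz.
  by rewrite /= subrr normr0 leNgt invr_gt0 ltr0n.
have FE : \bigcup_j F j = V.
  apply/seteqP; split => [z [j _ /FV]//|z Vz].
  have /nbhs_ballP[d /= d0 dV] : nbhs z V by exact: open_nbhs_nbhs.
  have [k kd] : exists k : nat, 0 + k.+1%:R^-1 < d by exact: ltr_add_invr.
  exists (maxn k ((Num.truncn `|z|).+1)) => //; split => /=.
    rewrite (le_trans (ltW (truncnS_gt _)))// ler_nat leq_maxr//.
  move=> y nVy /=; rewrite leNgt; apply: contra_notN nVy => zy; apply: dV.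
  rewrite -ball_normE/=; apply: lt_trans zy _; apply: le_lt_trans kd.
  by rewrite add0r lef_pV2 ?posrE// ler_nat ltnS leq_maxl.
have : nu (F j) @[j --> \oo] --> 1%E.
  rewrite -nuV -FE; apply: nondecreasing_cvg_mu => //.
    by rewrite FE; exact: open_measurable_rV.
  move=> i j ij; apply/subsetPset => z [zi Fz]; split.
    by rewrite /= (le_trans zi)// ler_nat.
  move=> y nVy; rewrite /= (le_trans _ (Fz y nVy))// lef_pV2 ?posrE//.
  by rewrite ler_nat ltnS.
move=> /fine_cvg /cvgrPdist_le /(_ e e0) [j _ /(_ j (leqnn j)) /= je].
exists (F j); split => //.
  apply: bounded_closed_compact => //.
  exists j%:R; split => // M jM z [zj _] /=; exact: le_trans zj (ltW jM).
by move: je; rewrite ler_distl => /andP[_]; rewrite lerBlDr.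
Qed.

(** * Asymptotically equicontinuous regression functions *)

(** The norm is attained at the sign of f, that is 2 * 1_A - 1 with A = {f >= 0}; a continuous psi
    close to 1_A in L1 gives the admissible test function 2 * psi - 1. *)
Lemma L1_norm_dual (R : realType) m (nu : probability 'rV[R]_m R)
    (f : 'rV[R]_m -> R) e : bounded_measurable f ->
  (forall psi : 'rV[R]_m -> R, continuous psi -> (forall x, `|psi x| <= 1) ->
     `|\int[nu]_x (psi x * f x)| <= e) ->
  \int[nu]_x `|f x| <= e.
Proof.
move=> bf he; have [mf [B fB]] := bf.
have B0 : 0 <= B by exact: le_trans (normr_ge0 _) (fB 0).
apply/ler_addgt0Pr => e' e'0.
pose A := [set x | 0 <= f x].
have mA : measurable A.
  rewrite -[X in measurable X]setTI (_ : A = f @^-1` `[0, +oo[).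
    by apply: mf => //; exact: measurable_itv.
  by apply/seteqP; split => x; rewrite /A/= in_itv/= andbT.
(* Replacing the sign costs at most 2 B times this number, hence at most e'; the summand 1 covers B
   = 0. *)
have e2 : 0 < e' / (2 * (B + 1)) by rewrite divr_gt0// mulr_gt0// ltr_wpDl.
have [psi [cpsi psi01 psie]] := measurable_approx_continuous nu mA e2.
pose ps x := 2 * psi x - 1.
have cps : continuous ps.
  apply: continuous_realB; last exact: continuous_real_cst.
  by apply: continuous_realM => //; exact: continuous_real_cst.
have ps1 x : `|ps x| <= 1.
  by have /andP[p0 p1] := psi01 x; rewrite ler_norml /ps; apply/andP; split; lra.
have bps : bounded_measurable ps.
  by apply: continuous_bounded_measurable; split => //; exists 1.
have bpsi := continuous_bounded_measurable (continuous_bounded01 cpsi psi01).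
have bA := bounded_measurable_indic R mA.
have bd := bounded_measurable_norm (bounded_measurableB bA bpsi).
have bpf := bounded_measurableM bps bf.
have b2 := bounded_measurableM (bounded_measurable_cst 'rV[R]_m (2 * B)) bd.
apply: (@le_trans _ _ (\int[nu]_x (ps x * f x + 2 * B * `|\1_A x - psi x|))).
  apply: le_Rint => [||x]; first exact: bounded_measurable_norm.
    exact: bounded_measurableD.
  have -> : `|f x| = (2 * \1_A x - 1) * f x.
    rewrite indicE; have [fx0|fx0] := leP 0 (f x).
      by rewrite mem_set//= ger0_norm//; ring.
    rewrite memNset /A/=; last by apply/negP; rewrite -ltNge.
    by rewrite ltr0_norm//; ring.
  rewrite -lerBlDl /ps.
  have -> : (2 * \1_A x - 1) * f x - (2 * psi x - 1) * f x =
    2 * ((\1_A x - psi x) * f x) by ring.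
  rewrite -mulrA ler_pM2l// (le_trans (ler_norm _))// normrM mulrC ler_wpM2r//.
rewrite RintD// RintZ// lerD//.
  exact: le_trans (ler_norm _) (he _ cps ps1).
apply: (@le_trans _ _ (2 * B * (e' / (2 * (B + 1))))).
  by rewrite ler_wpM2l// mulr_ge0.
rewrite mulrCA ger_pMr// ler_pdivrMr ?mul1r ?mulr_gt0// ?ltr_wpDl//; lra.
Qed.

Section equicontinuous_sequence.
Context (R : realType) (m : nat).
Variables (nun : nat -> probability 'rV[R]_m R) (nu : probability 'rV[R]_m R).
Variables (gn : nat -> 'rV[R]_m -> R) (g : 'rV[R]_m -> R) (V : set 'rV[R]_m).
Variable M : R.
Hypothesis nun_nu : forall phi, continuous_bounded phi ->
  \int[nun n]_x phi x @[n --> \oo] --> \int[nu]_x phi x.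
Hypothesis gn_g : forall phi, continuous_bounded phi ->
  \int[nun n]_x (gn n x * phi x) @[n --> \oo] --> \int[nu]_x (g x * phi x).
Hypothesis mgn : forall n, measurable_fun setT (gn n).
Hypothesis mg : measurable_fun setT g.
Hypothesis gnM : forall n x, `|gn n x| <= M.
Hypothesis gM : forall x, `|g x| <= M.
Hypothesis oV : open V.
Hypothesis nuV : nu V = 1%E.
Hypothesis ae_gn : forall e x, 0 < e -> V x -> exists (delta : R) (n0 : nat),
  0 < delta /\ forall n x', (n0 < n)%N -> `|x' - x| <= delta ->
  `|gn n x' - gn n x| < e.

Let M0 : 0 <= M. Proof. exact: le_trans (normr_ge0 _) (gM 0). Qed.
Let bgn n : bounded_measurable (gn n).
Proof. by split => //; exists M. Qed.
Let bg : bounded_measurable g.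
Proof. by split => //; exists M. Qed.

(* c is the mean of g for the weight phi; for the real numbers gn n x alone no
   convergence is assumed, it follows from that of the means of gn. *)
Let local_constant (x : 'rV[R]_m) (e : R) (phi : 'rV[R]_m -> R) n0 :
  continuous phi -> (forall z, 0 <= phi z <= 1) ->
  (forall n z, (n0 < n)%N -> phi z != 0 -> `|gn n z - gn n x| <= e) ->
  exists c, forall e2, 0 < e2 -> \forall n \near \oo,
   \int[nun n]_z (`|gn n z - c| * phi z) <= 2 * e * \int[nun n]_z phi z + e2.
Proof.
move=> cphi phi01 gphi.
have cbphi := continuous_bounded01 cphi phi01.
have bphi := continuous_bounded_measurable cbphi.
pose a := \int[nu]_z phi z; pose b := \int[nu]_z (g z * phi z).
(* A weight of mass a = 0 forces b = 0, so that c * a = b survives the division by 0. *)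
have ab : `|b| <= M * a.
  rewrite (le_trans (normr_Rint _ (bounded_measurableM bg bphi)))//.
  rewrite -RintZ//; apply: le_Rint => [||z].
  - exact: bounded_measurable_norm (bounded_measurableM bg bphi).
  - exact: bounded_measurableM (bounded_measurable_cst _ _) bphi.
  - by have /andP[p0 p1] := phi01 z; rewrite normrM (ger0_norm p0) ler_wpM2r.
pose c := b / a.
have ca : c * a = b.
  rewrite /c; have [a0|a0] := eqVneq a 0; last by rewrite divfK.
  by move: ab; rewrite a0 !mulr0 normr_le0 => /eqP ->.
exists c => e2 e20.
have h : `|\int[nun n]_z (gn n z * phi z) - c * \int[nun n]_z phi z|
    @[n --> \oo] --> (0 : R).
  rewrite -(@normr0 _ R); apply: cvg_norm; rewrite -(subrr b); apply: cvgB.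
    exact: gn_g.
  by rewrite -ca; apply: cvgM; [exact: cvg_cst|exact: nun_nu].
have {}h : \forall n \near \oo,
    `|\int[nun n]_z (gn n z * phi z) - c * \int[nun n]_z phi z| <= e2.
  move/cvgr0Pnorm_le : h => /(_ e2 e20); apply: filterS => n.
  by rewrite normr_id.
near=> n.
have nn0 : (n0 < n)%N by near: n; exact: nbhs_infty_gt.
set A := \int[nun n]_z phi z.
have bgp := bounded_measurableM (bgn n) bphi.
have bxp : bounded_measurable (fun z => gn n x * phi z).
  exact: bounded_measurableM (bounded_measurable_cst _ _) bphi.
have bD : bounded_measurable (fun z => `|gn n z - gn n x| * phi z).
  apply: bounded_measurableM => //; apply: bounded_measurable_norm.
  by apply: bounded_measurableB => //; exact: bounded_measurable_cst.
have D1 : \int[nun n]_z (`|gn n z - gn n x| * phi z) <= e * A.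
  rewrite -RintZ//; apply: le_Rint => // [|z].
    exact: bounded_measurableM (bounded_measurable_cst _ _) bphi.
  have /andP[p0 p1] := phi01 z; have [->|pz] := eqVneq (phi z) 0.
    by rewrite !mulr0.
  by rewrite ler_wpM2r// gphi.
(* Both [gn n x * A] and [c * A] are close to the integral of [gn n * phi]: the first by the
   oscillation bound, the second by convergence of the means. *)
have D2 : `|gn n x - c| * A <= e * A + e2.
  have A0 : 0 <= A by apply: Rint_ge0 => z; have /andP[] := phi01 z.
  rewrite -(ger0_norm A0) -normrM (ger0_norm A0) mulrBl.
  rewrite (le_trans (ler_distD (\int[nun n]_z (gn n z * phi z)) _ _))// lerD//.
    rewrite -RintZ// -RintB//.
    rewrite (le_trans (normr_Rint _ _))//; first exact: bounded_measurableB.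
    apply: le_trans D1; apply: le_Rint => // [|z].
      exact: bounded_measurable_norm (bounded_measurableB bxp bgp).
    rewrite -mulrBl normrM distrC ler_wpM2l//.
    by rewrite ger0_norm//; have /andP[] := phi01 z.
  by rewrite /A; near: n; exact: h.
apply: (@le_trans _ _ (\int[nun n]_z (`|gn n z - gn n x| * phi z) +
    `|gn n x - c| * A)); last by lra.
rewrite -RintZ// -RintD//; last first.
  exact: bounded_measurableM (bounded_measurable_cst _ _) bphi.
apply: le_Rint => [||z].
- apply: bounded_measurableM => //; apply: bounded_measurable_norm.
  by apply: bounded_measurableB => //; exact: bounded_measurable_cst.
- apply: bounded_measurableD => //.
  exact: bounded_measurableM (bounded_measurable_cst _ _) bphi.
- rewrite -mulrDl ler_wpM2r//; first by have /andP[] := phi01 z.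
  exact: ler_distD.
Unshelve. all: by end_near. Qed.

Lemma equicontinuous_approx e : 0 < e -> exists G, continuous_bounded G /\
  \forall n \near \oo, \int[nun n]_x `|gn n x - G x| <= e.
Proof.
move=> e0.
(* Error budget: oscillation costs at most 2 e1 and the mass outside K at most 2 M e1, together e /
   2; the finitely many centres share the other half as [e2]. *)
pose e1 := e / (4 * (M + 1)).
have M10 : 0 < M + 1 by rewrite ltr_wpDl.
have e10 : 0 < e1 by rewrite divr_gt0// mulr_gt0.
have [K [cK mK KV nuK]] := open_full_inner_compact oV nuV e10.
have dP x : exists dn : R * nat, V x -> 0 < dn.1 /\ forall n x', (dn.2 < n)%N ->
    `|x' - x| <= dn.1 -> `|gn n x' - gn n x| < e1.
  have [Vx|] := pselect (V x); last by exists (0, 0%N).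
  by have [d [n0 h]] := ae_gn e10 Vx; exists (d, n0).
have [dn {}dP] := choice dP.
have [s [phi [sK cphi phi0 phi1 phir]]] :=
  @partition_of_unity R 'rV[R]_m K (fst \o dn) cK (fun x Kx => (dP x (KV x Kx)).1).
have phi01 x : x \in s -> forall z, 0 <= phi x z <= 1.
  move=> xs z; rewrite phi0 (le_trans _ (phi1 z).1)// (big_rem x)//=.
  by rewrite lerDl sumr_ge0.
have cP x : exists c, x \in s -> forall e2, 0 < e2 -> \forall n \near \oo,
   \int[nun n]_z (`|gn n z - c| * phi x z) <= 2 * e1 * \int[nun n]_z phi x z + e2.
  have [xs|] := boolP (x \in s); last by exists 0.
  have [c h] := @local_constant x e1 (phi x) (dn x).2 (cphi x) (phi01 x xs)
    (fun n z nn pz => ltW ((dP x (KV x (sK x xs))).2 n z nn (phir x z xs pz))).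
  by exists c.
have [c {}cP] := choice cP.
pose G z := \sum_(x <- s) c x * phi x z.
pose S z := \sum_(x <- s) phi x z.
have cS : continuous S by exact: continuous_real_sum.
have S01 z : 0 <= S z <= 1 by rewrite (phi1 z).1 andbT sumr_ge0.
have cG : continuous G.
  by apply: continuous_real_sum => x; apply: continuous_realM => //; exact: continuous_real_cst.
have GM : exists B, forall z, `|G z| <= B.
  exists (\sum_(x <- s) `|c x|) => z.
  rewrite (le_trans (ler_norm_sum _ _ _))// big_seq [leRHS]big_seq.
  apply: ler_sum => x xs; rewrite normrM ler_piMr//.
  by have /andP[p0 p1] := phi01 x xs z; rewrite ger0_norm.
exists G; split; first by split.
have cbS := continuous_bounded01 cS S01.
have bS := continuous_bounded_measurable cbS.
have bG : bounded_measurable G by apply: continuous_bounded_measurable; split.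
have nuS : 1 - e1 <= \int[nu]_z S z.
  rewrite (le_trans nuK)// -Rint_indic//; apply: le_Rint => // [|z].
    exact: bounded_measurable_indic.
  rewrite indicE; have [/set_mem Kz|_] := boolP (z \in K).
    by rewrite /S (phi1 z).2.
  by have /andP[] := S01 z.
(* One e1 is lost outside K, the other in passing from nu to [nun n]. The continuous S replaces the
   indicator of K, whose integrals need not converge. *)
have near1 : \forall n \near \oo, 1 - 2 * e1 <= \int[nun n]_z S z.
  have := nun_nu cbS => /cvgr_ge; apply.
  by rewrite (lt_le_trans _ nuS)//; lra.
pose e2 := e / (2 * ((size s)%:R + 1)).
have e20 : 0 < e2 by rewrite divr_gt0// mulr_gt0// ltr_wpDl.
have near2 : \forall n \near \oo, forall x, x \in s ->
   \int[nun n]_z (`|gn n z - c x| * phi x z) <=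
   2 * e1 * \int[nun n]_z phi x z + e2.
  by apply: near_all_in_seq => x xs; exact: cP.
near=> n.
have n1 : 1 - 2 * e1 <= \int[nun n]_z S z by near: n.
have n2 : forall x, x \in s ->
   \int[nun n]_z (`|gn n z - c x| * phi x z) <=
   2 * e1 * \int[nun n]_z phi x z + e2 by near: n.
have bphi x : x \in s -> bounded_measurable (phi x).
  move=> xs; apply: continuous_bounded_measurable.
  exact: continuous_bounded01 (phi01 x xs).
(* [phi x] is known to be bounded only for x in s, hence the value 0 elsewhere. *)
pose F x z := if x \in s then `|gn n z - c x| * phi x z else 0.
have bF x : bounded_measurable (F x).
  rewrite /F; case: (boolP (x \in s)) => xs; last exact: bounded_measurable_cst.
  apply: bounded_measurableM (bphi x xs); apply: bounded_measurable_norm.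
  by apply: bounded_measurableB => //; exact: bounded_measurable_cst.
have b1S : bounded_measurable (fun z => 1 - S z).
  by apply: bounded_measurableB => //; exact: bounded_measurable_cst.
have bM1S : bounded_measurable (fun z => M * (1 - S z)).
  exact: bounded_measurableM (bounded_measurable_cst _ _) b1S.
have bsF := bounded_measurable_sum s bF.
apply: (@le_trans _ _ (\int[nun n]_z (\sum_(x <- s) F x z + M * (1 - S z)))).
  apply: le_Rint => [||z].
  - apply: bounded_measurable_norm; exact: bounded_measurableB.
  - exact: bounded_measurableD.
  (* Since S is the sum of the phi, the difference splits into local deviations from [c x] and a
     remainder bounded by M (1 - S), which is small in mean. *)
  - have -> : gn n z - G z =
       \sum_(x <- s) (gn n z - c x) * phi x z + gn n z * (1 - S z).
      under eq_bigr do rewrite mulrBl.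
      by rewrite sumrB -mulr_sumr -/(S z) -/(G z); ring.
    rewrite (le_trans (ler_normD _ _))// lerD//.
      rewrite (le_trans (ler_norm_sum _ _ _))// big_seq [leRHS]big_seq.
      apply: ler_sum => x xs; rewrite /F xs normrM ler_wpM2l//.
      by rewrite ger0_norm.
    have /andP[_ S1] := S01 z.
    by rewrite normrM ler_pM// ger0_norm// subr_ge0.
rewrite RintD// Rint_sum// RintZ// RintB//; last exact: bounded_measurable_cst.
rewrite Rint_cst.
have sumF : \sum_(x <- s) \int[nun n]_z F x z <=
    2 * e1 * \int[nun n]_z S z + (size s)%:R * e2.
  have -> : \int[nun n]_z S z = \sum_(x <- s) \int[nun n]_z (if x \in s then phi x z else 0).
    rewrite -Rint_sum => [|x]; last first.
      by case: (boolP (x \in s)) => [/bphi//|_]; exact: bounded_measurable_cst.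
    by apply: eq_Rintegral => z _; rewrite /S; apply: eq_big_seq => x ->.
  rewrite mulr_sumr; have -> : (size s)%:R * e2 = \sum_(x <- s) e2.
    by rewrite big_const_seq count_predT iter_addr_0 mulr_natl.
  rewrite -big_split/= big_seq [leRHS]big_seq; apply: ler_sum => x xs.
  by rewrite /F xs n2.
have S1 : \int[nun n]_z S z <= 1.
  by apply: Rint_le_cst => // z; have /andP[] := S01 z.
rewrite (splitr e).
have h1 : 2 * e1 + M * (2 * e1) = e / 2.
  by rewrite /e1; field; rewrite gt_eqF.
have h2 : (size s)%:R * e2 <= e / 2.
  rewrite /e2 mulrCA ler_pM2l// invfM mulrCA ger_pMr ?invr_gt0//.
  by rewrite ler_pdivrMr ?mul1r ?lerDl// ltr_wpDl.
have h3 : M * (1 - \int[nun n]_z S z) <= M * (2 * e1).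
  by rewrite ler_wpM2l//; lra.
have h4 : 2 * e1 * \int[nun n]_z S z <= 2 * e1.
  by rewrite ler_piMr// mulr_ge0// ltW.
lra.
Unshelve. all: by end_near. Qed.

(* The bound passes to the limit because the L1 norm is a supremum of integrals
   against continuous functions. *)
Lemma equicontinuous_approx_limit e G : continuous_bounded G ->
  (\forall n \near \oo, \int[nun n]_x `|gn n x - G x| <= e) ->
  \int[nu]_x `|g x - G x| <= e.
Proof.
move=> cbG ne; have bG := continuous_bounded_measurable cbG.
apply: L1_norm_dual; first exact: bounded_measurableB.
move=> psi cpsi psi1.
have cbpsi : continuous_bounded psi by split => //; exists 1.
have bpsi := continuous_bounded_measurable cbpsi.
have cbpG : continuous_bounded (fun x => psi x * G x).
  split; first by apply: continuous_realM => //; case: cbG.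
  by have [_ h] := bounded_measurableM bpsi bG.
have bpG := continuous_bounded_measurable cbpG.
have h : `|\int[nun n]_x (psi x * (gn n x - G x))| @[n --> \oo] -->
    `|\int[nu]_x (psi x * (g x - G x))|.
  apply: cvg_norm.
  have -> : \int[nu]_x (psi x * (g x - G x)) =
      \int[nu]_x (g x * psi x) - \int[nu]_x (psi x * G x).
    rewrite -RintB//; last exact: bounded_measurableM.
    by apply: eq_Rintegral => x _; ring.
  under eq_fun => n.
    rewrite (_ : \int[nun n]_x (psi x * (gn n x - G x)) =
      \int[nun n]_x (gn n x * psi x) - \int[nun n]_x (psi x * G x)); last first.
      rewrite -RintB//; last exact: bounded_measurableM.
      by apply: eq_Rintegral => x _; ring.
    over.
  by apply: cvgB; [exact: gn_g|exact: nun_nu].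
apply: cvgr_to_le h _; apply: filterS ne => n; apply: le_trans.
have b1 := bounded_measurableB (bgn n) bG.
have b2 := bounded_measurableM bpsi b1.
rewrite (le_trans (normr_Rint _ b2))//; apply: le_Rint => [||x].
- exact: bounded_measurable_norm.
- exact: bounded_measurable_norm.
- by rewrite normrM ler_piMl.
Qed.

End equicontinuous_sequence.

(** * Mixtures, disintegration and Markov products *)

Section probability_kernels.
Context (R : realType) d1 d2 (T1 : measurableType d1) (T2 : measurableType d2).
Variable k : R.-pker T1 ~> T2.

Let pker_set (x : T1) : set T2 -> \bar R := k x.

HB.instance Definition _ x := Measure.on (pker_set x).

Let pker_setT x : pker_set x [set: T2] = 1%E.
Proof. exact: prob_kernel. Qed.

HB.instance Definition _ x :=
  Measure_isProbability.Build _ _ _ (pker_set x) (pker_setT x).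

Definition pker_prob (x : T1) : probability T2 R := pker_set x.

(** Adding the bound M reduces measurability to nonnegative integrands; the kernel has mass 1, so
    the shift can be subtracted again. *)
Lemma bounded_measurable_pker (f : T2 -> R) : bounded_measurable f ->
  bounded_measurable (fun x => \int[pker_prob x]_y f y).
Proof.
move=> bf; have [mf [M fM]] := bf.
have bfM : bounded_measurable (fun y => f y + M).
  by apply: bounded_measurableD => //; exact: bounded_measurable_cst.
have fM0 y : 0 <= f y + M.
  by rewrite -lerBlDr sub0r; have := fM y; rewrite ler_norml => /andP[].
split.
  have -> : (fun x => \int[pker_prob x]_y f y) =
      (fun x => \int[pker_prob x]_y (f y + M) - M).
    apply/funext => x; rewrite RintD//; last exact: bounded_measurable_cst.
    by rewrite Rint_cst addrK.
  apply: measurable_funB => //.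
  apply: (measurableT_comp (f := fine)) => //.
  apply: (@measurable_fun_integral_kernel _ _ T1 T2 R k) => [U mU|y|].
  - exact: measurable_kernel.
  - by rewrite lee_fin.
  - by apply/measurable_EFinP; case: bfM.
exists M => x; rewrite (le_trans (normr_Rint _ bf))//.
by apply: Rint_le_cst => //; exact: bounded_measurable_norm.
Qed.

End probability_kernels.

Section kernel_precomposition.
Context (R : realType) d0 d1 d2 (T0 : measurableType d0) (T1 : measurableType d1)
  (T2 : measurableType d2).
Variables (k : R.-pker T1 ~> T2) (phi : {mfun T0 >-> T1}).

Definition kprecomp (x : T0) : {measure set T2 -> \bar R} := k (phi x).

Let measurable_kprecomp U : measurable U ->
  measurable_fun [set: T0] (kprecomp ^~ U).
Proof. by move=> mU; apply: measurableT_comp (measurable_kernel k U mU) _. Qed.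

HB.instance Definition _ := isKernel.Build _ _ _ _ _ kprecomp measurable_kprecomp.

Let kprecomp_prob x : kprecomp x [set: T2] = 1%E.
Proof. exact: prob_kernel. Qed.

HB.instance Definition _ := Kernel_isProbability.Build _ _ _ _ _
  kprecomp kprecomp_prob.

End kernel_precomposition.

Section kernel_graph.
Context (R : realType) d1 d2 (T1 : measurableType d1) (T2 : measurableType d2).
Variable k : R.-pker T1 ~> T2.

Let pairl (x : T1) (y : T2) : T1 * T2 := (x, y).

Let measurable_pairl x : measurable_fun [set: T2] (pairl x).
Proof. exact: pair1_measurable. Qed.

HB.instance Definition _ x := isMeasurableFun.Build _ _ T2 (T1 * T2)%type
  (pairl x) (measurable_pairl x).

(** The law of (x, y) with y drawn from k x. Keeping x turns mixtures of this kernel into joint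
    laws. *)
Definition kgraph (x : T1) : {measure set (T1 * T2) -> \bar R} :=
  distribution (pker_prob k x) (pairl x).

Let measurable_kgraph U : measurable U ->
  measurable_fun [set: T1] (kgraph ^~ U).
Proof.
move=> mU; have -> : kgraph ^~ U = (fun x => k x (xsection U x)).
  by apply/funext => x; rewrite xsectionE.
by apply: measurable_fun_xsection_finite_kernel; rewrite inE.
Qed.

HB.instance Definition _ := isKernel.Build _ _ _ _ _ kgraph measurable_kgraph.

Let kgraph_prob x : kgraph x [set: T1 * T2] = 1%E.
Proof. by exact: probability_setT. Qed.

HB.instance Definition _ := Kernel_isProbability.Build _ _ _ _ _
  kgraph kgraph_prob.

Lemma Rint_kgraph x (f : T1 * T2 -> R) : bounded_measurable f ->
  \int[pker_prob kgraph x]_y f y = \int[pker_prob k x]_y f (x, y).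
Proof.
move=> bf; congr fine.
apply: (@integral_pushforward _ _ _ _ _ (pairl x) (measurable_pairl x) (k x) setT) => //.
- by apply/measurable_EFinP; case: bf.
- apply: (bounded_integrable (pker_prob k x)).
  exact: bounded_measurable_comp (measurable_pairl x) bf.
Qed.

End kernel_graph.

Section mixture.
Context (R : realType) d1 d2 (T1 : measurableType d1) (T2 : measurableType d2).
Variables (P : probability T1 R) (k : R.-pker T1 ~> T2).

Let cstP : unit -> pprobability T1 R := cst P.
Let mcstP : measurable_fun [set: unit] cstP. Proof. exact: measurable_cst. Qed.
Let l := kprobability mcstP.
Let k' : R.-spker (unit * T1) ~> T2 := kernel.kernel_snd k.

(** The average of the measures k x over P, encoded as a composition of kernels issued from the
    one-point space, with P as the constant first kernel. *)
Definition mixture_measure : {measure set T2 -> \bar R} := mkcomp l k' tt.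

Let mixture_set : set T2 -> \bar R := mixture_measure.

HB.instance Definition _ := Measure.on mixture_set.

Let mixture_setT : mixture_set [set: T2] = 1%E.
Proof.
rewrite /mixture_set /= /kcomp /=.
rewrite (eq_integral (cst 1%E)) => [|x _]; last exact: prob_kernel.
by rewrite integral_cst// mul1e [LHS]probability_setT.
Qed.

HB.instance Definition _ :=
  Measure_isProbability.Build _ _ _ mixture_set mixture_setT.

Definition mixture : probability T2 R := mixture_set.

Lemma ge0_integral_mixture (f : T2 -> \bar R) : (forall y, 0 <= f y)%E ->
  measurable_fun setT f ->
  (\int[mixture]_y f y = \int[P]_x \int[k x]_y f y)%E.
Proof. by move=> f0 mf; exact: (integral_kcomp l k' tt). Qed.

Lemma Rint_mixture (f : T2 -> R) : bounded_measurable f ->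
  \int[mixture]_y f y = \int[P]_x \int[pker_prob k x]_y f y.
Proof.
move=> bf; have [mf [M fM]] := bf.
have bM d (T : measurableType d) : bounded_measurable (cst M : T -> R).
  exact: bounded_measurable_cst.
have bfM : bounded_measurable (fun y => f y + M) by exact: bounded_measurableD.
have fM0 y : 0 <= f y + M.
  by rewrite -lerBlDr sub0r; have := fM y; rewrite ler_norml => /andP[].
suff : \int[mixture]_y (f y + M) = \int[P]_x \int[pker_prob k x]_y (f y + M).
  rewrite RintD// Rint_cst.
  under [in RHS]eq_Rintegral do rewrite RintD// Rint_cst.
  rewrite RintD//; last exact: bounded_measurable_pker.
  by rewrite Rint_cst => /addIr.
rewrite /Rintegral ge0_integral_mixture.
- congr fine; apply: eq_integral => x _.
  by rewrite (EFin_Rintegral (pker_prob k x)).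
- by move=> y; rewrite lee_fin.
- by apply/measurable_EFinP; case: bfM.
Qed.

End mixture.

Lemma Rint_distribution (R : realType) d (Om : measurableType d)
    (P : probability Om R) d' (S : measurableType d') (Z : {RV P >-> S})
    (f : S -> R) : bounded_measurable f ->
  \int[distribution P Z]_z f z = \int[P]_w f (Z w).
Proof.
move=> bf; congr fine; apply: integral_distribution.
  by apply/measurable_EFinP; case: bf.
by apply: bounded_integrable; exact: bounded_measurable_comp.
Qed.

Lemma probability_eq_rectangles (R : realType) d1 d2 (T1 : measurableType d1)
    (T2 : measurableType d2) (m1 m2 : probability (T1 * T2)%type R) :
  (forall A B, measurable A -> measurable B -> m1 (A `*` B) = m2 (A `*` B)) ->
  forall C, measurable C -> m1 C = m2 C.
Proof.
move=> m12 C; apply: (measure_unique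
  [set A `*` B | A in measurable & B in measurable] (fun=> setT)) => //.
- exact: measurable_prod_measurableType.
- move=> _ _ [A1 mA1 [B1 mB1 <-]] [A2 mA2 [B2 mB2 <-]].
  exists (A1 `&` A2); first exact: measurableI.
  by exists (B1 `&` B2); [exact: measurableI|rewrite setXI].
- by move=> _; exists setT => //; exists setT => //; rewrite setXTT.
- exact: bigcup_const.
- by move=> _ [A mA [B mB <-]]; exact: m12.
- by move=> _; rewrite (le_lt_trans (probability_le1 _ _))// ltry.
Qed.

Lemma eq_Rint_probability (R : realType) d (T : measurableType d)
    (m1 m2 : probability T R) (f : T -> R) : bounded_measurable f ->
  (forall A, measurable A -> m1 A = m2 A) -> \int[m1]_x f x = \int[m2]_x f x.
Proof.
move=> bf m12; congr fine; apply: eq_measure_integral => // A mA _.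
exact: m12.
Qed.

Section versions.
Context (R : realType) d (Om : measurableType d) (P : probability Om R).
Context d' (S : measurableType d') (Z : {RV P >-> S}).

Lemma cond_prob_versionP (E : set Om) (g : S -> R) :
  measurable E -> bounded_measurable g ->
  (forall C, measurable C -> \int[P]_w (\1_E w * \1_C (Z w)) =
                             \int[P]_w (g (Z w) * \1_C (Z w))) <->
  cond_prob_version P Z E g.
Proof.
move=> mE bg.
have H C : measurable C ->
    (P (E `&` Z @^-1` C) = (\int[distribution P Z]_(z in C) (g z)%:E)%E) <->
    (\int[P]_w (\1_E w * \1_C (Z w)) = \int[P]_w (g (Z w) * \1_C (Z w))).
  move=> mC.
  have mEC : measurable (E `&` Z @^-1` C).
    by apply: measurableI => //; exact: measurable_funPTI.
  have -> : \int[P]_w (\1_E w * \1_C (Z w)) = fine (P (E `&` Z @^-1` C)).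
    by rewrite -Rint_indic//; apply: eq_Rintegral => w _; rewrite indicI.
  have bgC : bounded_measurable (fun z => g z * \1_C z).
    exact: bounded_measurableM bg (bounded_measurable_indic R mC).
  have -> : (\int[distribution P Z]_(z in C) (g z)%:E)%E =
      (\int[P]_w (g (Z w) * \1_C (Z w)))%:E.
    rewrite -(Rint_distribution Z bgC) -EFin_Rintegral//.
    rewrite integral_mkcond; apply: eq_integral => z _.
    by rewrite restrict_EFin patch_indic.
  split=> [->//|<-]; rewrite fineK//; exact: fin_num_measure.
split=> [h|[_ h] C mC]; last by apply/H => //; exact: h.
split; first exact: (bounded_integrable (distribution P Z)).
by move=> C mC; apply/H => //; exact: h.
Qed.

(** [cond_prob] is an arbitrary choice among the versions; its values are accessible through this
    almost sure uniqueness. *)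
Lemma cond_prob_ae (E : set Om) (g : S -> R) : measurable E ->
  cond_prob_version P Z E g ->
  \forall w \ae P, cond_prob P Z E (Z w) = g (Z w).
Proof.
move=> mE [ig hg]; have [ic hc] := cond_probP Z mE.
have : ae_eq (distribution P Z) setT (EFin \o cond_prob P Z E) (EFin \o g).
  apply: integral_ae_eq => //; first exact: measurable_int ig.
  by move=> C _ mC; rewrite -hc// -hg.
move=> [N [mN N0 hN]].
exists (Z @^-1` N); split => //; first exact: measurable_funPTI.
move=> w /= h; apply: hN => /= h'; apply: h; have := h' I.
by move=> [].
Qed.

Lemma cond_prob_measurable (E : set Om) : measurable E ->
  measurable_fun setT (cond_prob P Z E).
Proof.
move=> mE; have [ic _] := cond_probP Z mE.
by apply/measurable_EFinP; exact: measurable_int ic.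
Qed.

End versions.

Section kernels_as_regular_distributions.
Context (R : realType) d (Om : measurableType d) (P : probability Om R).
Context d' (S : measurableType d') (Z : {RV P >-> S}).
Context d1 (T : measurableType d1) (Y : {RV P >-> T}) (K : R.-pker S ~> T).

Lemma bounded_measurable_kernel (B : set T) : measurable B ->
  bounded_measurable (fun z => fine (K z B)).
Proof.
move=> mB; split.
  by apply: (measurableT_comp (f := fine)) => //; exact: measurable_kernel.
exists 1 => z; rewrite ger0_norm ?fine_ge0//.
rewrite -lee_fin fineK; first exact: (probability_le1 (pker_prob K z)).
exact: (fin_num_measure (pker_prob K z)).
Qed.

Let mZY : measurable_fun [set: Om] (fun w => (Z w, Y w)).
Proof. exact: measurable_fun_pair. Qed.

Let ZY : Om -> S * T := fun w => (Z w, Y w).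
HB.instance Definition _ := isMeasurableFun.Build _ _ Om (S * T)%type ZY mZY.

(** The law of (Z, Y) and the mixture of the graph kernel of K over the law of Z agree on
    rectangles, by the defining property of K, and hence everywhere. *)
Lemma disintegration (F : S * T -> R) : reg_cond_distr P Y Z K ->
  bounded_measurable F ->
  \int[P]_w F (Z w, Y w) = \int[P]_w \int[pker_prob K (Z w)]_y F (Z w, y).
Proof.
move=> hK bF.
pose m2 := mixture (distribution P Z) (kgraph K).
have bG : bounded_measurable (fun z => \int[pker_prob (kgraph K) z]_x F x).
  exact: bounded_measurable_pker.
transitivity (\int[distribution P ZY]_x F x); first by rewrite Rint_distribution.
transitivity (\int[m2]_x F x); last first.
  rewrite Rint_mixture// Rint_distribution//.
  by apply: eq_Rintegral => w _; rewrite Rint_kgraph.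
apply: eq_Rint_probability => // C mC.
apply: probability_eq_rectangles => // A B mA mB.
have bAB : bounded_measurable (\1_(A `*` B) : S * T -> R).
  by apply: bounded_measurable_indic; exact: measurableX.
have bK := bounded_measurable_kernel mB.
have := (cond_prob_versionP Z (measurable_funPTI Y mB) bK).2 (hK B mB) A mA.
have -> : (\int[P]_w (\1_(Y @^-1` B) w * \1_A (Z w)) =
    fine (distribution P ZY (A `*` B))).
  rewrite -Rint_indic ?Rint_distribution//; last exact: measurableX.
  by apply: eq_Rintegral => w _; rewrite !indicE in_setX mulrC -natrM mulnb.
have -> : \int[P]_w (fine (K (Z w) B) * \1_A (Z w)) = fine (m2 (A `*` B)).
  rewrite -Rint_indic; last exact: measurableX.
  rewrite Rint_mixture// Rint_distribution//; last exact: bounded_measurable_pker.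
  apply: eq_Rintegral => w _; rewrite Rint_kgraph//.
  have -> : (fun y => \1_(A `*` B) (Z w, y)) = (fun y => \1_A (Z w) * \1_B y) :> (T -> R).
    by apply/funext => y; rewrite !indicE in_setX -natrM mulnb.
  rewrite RintZ; last exact: bounded_measurable_indic.
  by rewrite mulrC (Rint_indic (pker_prob K (Z w))).
have mAB : measurable (A `*` B) by exact: measurableX.
have f1 := fin_num_measure (distribution P ZY) _ mAB.
have f2 := fin_num_measure m2 _ mAB.
by move=> h; rewrite -(fineK f1) h fineK.
Qed.

End kernels_as_regular_distributions.

(** * Markov products: existence and values on rectangles *)

Section markov_product_existence.
Context (R : realType) d (Om : measurableType d) (P : probability Om R).
Context d' (S : measurableType d') (Z : {RV P >-> S}) (Y : {RV P >-> R}).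
Variable K : R.-pker S ~> R.
Hypothesis hK : reg_cond_distr P Y Z K.

(** Given w, the second coordinate is drawn from K (Z w): it depends on w only through Z, which is
    the source of the conditional independence. *)
Let P1 : probability (Om * R)%type R := mixture P (kgraph (kprecomp K Z)).

Let Rint_P1 (f : Om * R -> R) : bounded_measurable f ->
  \int[P1]_x f x = \int[P]_w \int[pker_prob K (Z w)]_y f (w, y).
Proof.
move=> bf; rewrite Rint_mixture//; apply: eq_Rintegral => w _.
by rewrite Rint_kgraph.
Qed.

Let Y1 : Om * R -> R := fun x => Y x.1.
Let Y2 : Om * R -> R := fun x => x.2.
Let Z1 : Om * R -> S := fun x => Z x.1.
Let Y12 : Om * R -> R * R := fun x => (Y x.1, x.2).

Let mY1 : measurable_fun setT Y1. Proof. exact: measurableT_comp. Qed.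
Let mY2 : measurable_fun setT Y2. Proof. exact: measurable_snd. Qed.
Let mZ1 : measurable_fun setT Z1. Proof. exact: measurableT_comp. Qed.
Let mY12 : measurable_fun setT Y12. Proof. exact: measurable_fun_pair. Qed.
HB.instance Definition _ := isMeasurableFun.Build _ _ (Om * R)%type R Y1 mY1.
HB.instance Definition _ := isMeasurableFun.Build _ _ (Om * R)%type R Y2 mY2.
HB.instance Definition _ := isMeasurableFun.Build _ _ (Om * R)%type S Z1 mZ1.
HB.instance Definition _ :=
  isMeasurableFun.Build _ _ (Om * R)%type (R * R)%type Y12 mY12.

Let P1_fst (A : set Om) : measurable A -> P1 [set x | A x.1] = P A.
Proof.
move=> mA; have mA1 : measurable [set x : Om * R | A x.1].
  by rewrite -[X in measurable X]setTI; exact: measurable_fst.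
have bA1 := bounded_measurable_indic R mA1.
apply/eqP; rewrite -(fineK (fin_num_measure P1 _ mA1)) -(fineK (fin_num_measure P _ mA)).
rewrite eqe -!Rint_indic// Rint_P1//; apply/eqP; apply: eq_Rintegral => w _.
have -> : (fun y : R => \1_[set x : Om * R | A x.1] (w, y)) = cst (\1_A w : R).
  apply/funext => y; rewrite !indicE /=; congr (_%:R);
      by apply/idP/idP => /set_mem h; apply/mem_set.
by rewrite Rint_cst.
Qed.

(** The second coordinate is integrated out first, leaving K (Z w) B, and then Y by disintegration.
    Taking A or B equal to setT gives the two conditional marginals, so that both the regular
    distribution and the independence follow. *)
Let K1_version (A B : set R) : measurable A -> measurable B ->
  cond_prob_version P1 Z1 (Y1 @^-1` A `&` Y2 @^-1` B)
    (fun z => fine (K z A) * fine (K z B)).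
Proof.
move=> mA mB; have bKA := bounded_measurable_kernel K mA.
have bKB := bounded_measurable_kernel K mB.
have bK := bounded_measurableM bKA bKB.
have mE : measurable (Y1 @^-1` A `&` Y2 @^-1` B).
  by apply: measurableI; exact: measurable_funPTI.
apply/cond_prob_versionP => // C mC.
have mZC : measurable (Z1 @^-1` C) by exact: measurable_funPTI.
have bZC := bounded_measurable_indic R mZC.
have bE := bounded_measurable_indic R mE.
have bEC := bounded_measurableM bE bZC.
have bC := bounded_measurable_indic R mC.
transitivity (\int[P]_w (\1_A (Y w) * (\1_C (Z w) * fine (K (Z w) B)))).
  rewrite (Rint_P1 bEC); apply: eq_Rintegral => w _.
  have -> : (fun y : R => \1_(Y1 @^-1` A `&` Y2 @^-1` B) (w, y) * \1_(Z1 @^-1` C) (w, y)) =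
     (fun y => \1_A (Y w) * \1_C (Z w) * \1_B y) :> (R -> R).
    apply/funext => y; rewrite indicI /= mulrAC; congr (_ * _).
  rewrite RintZ; last exact: bounded_measurable_indic.
  by rewrite (Rint_indic (pker_prob K (Z w)))// mulrA.
pose F (zy : S * R) := \1_A zy.2 * (\1_C zy.1 * fine (K zy.1 B)).
have bF : bounded_measurable F.
  apply: bounded_measurableM.
    exact: (bounded_measurable_comp measurable_snd (bounded_measurable_indic R mA)).
  apply: bounded_measurableM.
    exact: (bounded_measurable_comp measurable_fst bC).
  exact: (bounded_measurable_comp measurable_fst bKB).
rewrite (disintegration hK bF) /F /=.
have bKC : bounded_measurable (fun z => fine (K z A) * fine (K z B) * \1_C z).
  exact: bounded_measurableM.
transitivity (\int[P]_w (fine (K (Z w) A) * fine (K (Z w) B) * \1_C (Z w))).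
  apply: eq_Rintegral => w _.
  under eq_Rintegral do rewrite mulrC.
  rewrite RintZ; last exact: bounded_measurable_indic.
  by rewrite (Rint_indic (pker_prob K (Z w)))//; ring.
rewrite (Rint_P1 (bounded_measurable_comp mZ1 bKC)); apply: eq_Rintegral => w _.
by rewrite -[LHS](Rint_cst (pker_prob K (Z w))).
Qed.

Let K1T z : fine (K z setT) = 1. Proof. by rewrite prob_kernel. Qed.

Lemma markov_product_exists : exists mu : probability (R * R)%type R,
  is_markov_product P Y Z K mu /\
  forall f : R * R -> R, bounded_measurable f ->
    \int[mu]_x f x = \int[P]_w \int[pker_prob K (Z w)]_y f (Y w, y).
Proof.
exists (distribution P1 Y12); split; last first.
  move=> f bf; rewrite Rint_distribution// Rint_P1//.
  exact: bounded_measurable_comp.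
exists _, (Om * R)%type, P1, Y1, Y2, Z1; split => //.
- move=> C mC; apply: (P1_fst (A := [set w | C (Y w, Z w)])).
  rewrite -[X in measurable X]setTI.
  have mYZ : measurable_fun setT (fun w => (Y w, Z w)) by exact: measurable_fun_pair.
  exact: mYZ.
- move=> B mB; have := K1_version measurableT mB.
  rewrite preimage_setT setTI; congr (cond_prob_version _ _ _ _).
  by apply/funext => z; rewrite K1T mul1r.
- move=> A B mA mB.
  have vA : cond_prob_version P1 Z1 (Y1 @^-1` A) (fun z => fine (K z A)).
    have := K1_version mA measurableT.
    rewrite preimage_setT setIT; congr (cond_prob_version _ _ _ _).
    by apply/funext => z; rewrite K1T mulr1.
  have vB : cond_prob_version P1 Z1 (Y2 @^-1` B) (fun z => fine (K z B)).
    have := K1_version measurableT mB.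
    rewrite preimage_setT setTI; congr (cond_prob_version _ _ _ _).
    by apply/funext => z; rewrite K1T mul1r.
  have mA1 : measurable (Y1 @^-1` A) by exact: measurable_funPTI.
  have mB1 : measurable (Y2 @^-1` B) by exact: measurable_funPTI.
  have aA := cond_prob_ae mA1 vA.
  have aB := cond_prob_ae mB1 vB.
  have aAB := cond_prob_ae (measurableI _ _ mA1 mB1) (K1_version mA mB).
  by apply: filterS3 aA aB aAB => w -> -> ->.
Qed.

End markov_product_existence.

Section markov_product_rectangles.
Context (R : realType) d (Om : measurableType d) (P : probability Om R).
Context d' (S : measurableType d') (Z : {RV P >-> S}) (Y : {RV P >-> R}).
Variable K : R.-pker S ~> R.
Hypothesis hK : reg_cond_distr P Y Z K.

(** The space behind [is_markov_product] is arbitrary. This formula shows that mu depends only on K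
    and the law of Z, and it is what (b) extracts from the definition. *)
Lemma markov_product_rectangle mu (A B : set R) :
  is_markov_product P Y Z K mu -> measurable A -> measurable B ->
  fine (mu (A `*` B)) = \int[P]_w (fine (K (Z w) A) * fine (K (Z w) B)).
Proof.
move=> [d1 [Om1 [P1 [Y1 [Y2 [Z1 [law hK2 hci hmu]]]]]]] mA mB.
have bKA := bounded_measurable_kernel K mA.
have bKB := bounded_measurable_kernel K mB.
have bK := bounded_measurableM bKA bKB.
have lawZ : forall C, measurable C -> distribution P1 Z1 C = distribution P Z C.
  move=> C mC; have := law (setT `*` C) (measurableX measurableT mC).
  have E (T : Type) (U : T -> R) (V : T -> S) :
      [set w | (setT `*` C) (U w, V w)] = V @^-1` C.
    by apply/seteqP; split => w /=; [case|split].
  by rewrite !E.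
(* K is also a regular conditional distribution of Y1 given Z1, because (Y1, Z1) and (Y, Z) have the
   same law. *)
have v1 D : measurable D -> cond_prob_version P1 Z1 (Y1 @^-1` D) (fun z => fine (K z D)).
  move=> mD; split.
    exact: (bounded_integrable (distribution P1 Z1) (bounded_measurable_kernel K mD)).
  move=> C mC; have [_ h] := hK mD; have := law (D `*` C) (measurableX mD mC).
  have -> : [set w | (D `*` C) (Y1 w, Z1 w)] = Y1 @^-1` D `&` Z1 @^-1` C by [].
  have -> : [set w | (D `*` C) (Y w, Z w)] = Y @^-1` D `&` Z @^-1` C by [].
  move=> ->; rewrite h//; apply: eq_measure_integral => F mF _.
  by first [exact: lawZ|exact/esym/lawZ].
set E := Y1 @^-1` A `&` Y2 @^-1` B.
have mE : measurable E by apply: measurableI; exact: measurable_funPTI.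
have -> : mu (A `*` B) = P1 E by rewrite hmu//; exact: measurableX.
have aeE : \forall w \ae P1, cond_prob P1 Z1 E (Z1 w) = fine (K (Z1 w) A) * fine (K (Z1 w) B).
  have aA := cond_prob_ae (measurable_funPTI Y1 mA) (v1 A mA).
  have aB := cond_prob_ae (measurable_funPTI Y2 mB) (hK2 B mB).
  by apply: filterS3 aA aB (hci A B mA mB) => w -> -> ->.
have [_ /(_ setT measurableT)] := cond_probP Z1 mE.
rewrite preimage_setT setIT => ->.
have mc := cond_prob_measurable Z1 mE.
rewrite (ae_eq_integral (fun z => (fine (K z A) * fine (K z B))%:E))//.
- rewrite -/(Rintegral _ _ _) (_ : \int[distribution P1 Z1]_x _ =
    \int[distribution P Z]_z (fine (K z A) * fine (K z B))); last first.
    by apply: eq_Rint_probability => // C mC; rewrite lawZ.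
  by rewrite Rint_distribution.
- exact/measurable_EFinP.
- by apply/measurable_EFinP; case: bK.
(* The equality holds almost surely on Om1; to read it under the law of Z1, the exceptional set is
   described by a measurable function of z. *)
- pose h z := cond_prob P1 Z1 E z - fine (K z A) * fine (K z B).
  have mh : measurable_fun setT h by apply: measurable_funB => //; case: bK.
  have mN : measurable (~` (h @^-1` [set 0])).
    by apply: measurableC; rewrite -[X in measurable X]setTI; exact: mh.
  have [N [mN' N0 hN]] := aeE.
  exists (~` (h @^-1` [set 0])); split => //.
    apply: (subset_measure0 (B := N)) => //; first exact: measurable_funPTI.
    apply: subset_trans hN => w /=; apply: contra_not; rewrite /h => ->.
    by rewrite subrr.
  move=> z /=; apply: contra_not => hz _; congr EFin.
  by apply/eqP; rewrite -subr_eq0; apply/eqP.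
Qed.

End markov_product_rectangles.

(** * Weak convergence of Markov products *)

Lemma continuous_bounded_measurableR (R : realType) (f : R -> R) :
  continuous_bounded f -> bounded_measurable f.
Proof. by move=> [cf bf]; split => //; exact: continuous_measurable_fun. Qed.

Lemma eq_cvg_seq (R : realType) (u v : nat -> R) (l : R) : u =1 v ->
  v n @[n --> \oo] --> l -> u n @[n --> \oo] --> l.
Proof. by move=> /funext ->. Qed.

Section regression_convergence.
Context (R : realType) (m : nat).
Context (dn : nat -> measure_display) (Omn : forall n, measurableType (dn n))
  (Pn : forall n, probability (Omn n) R)
  d (Om : measurableType d) (P : probability Om R).
Variables (Yn : forall n, {RV (Pn n) >-> R}) (Zn : forall n, {RV (Pn n) >-> 'rV[R]_m}).
Variables (Y : {RV P >-> R}) (Z : {RV P >-> 'rV[R]_m}).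
Variables (Kn : nat -> R.-pker 'rV[R]_m ~> R) (K : R.-pker 'rV[R]_m ~> R).
Variable V : set 'rV[R]_m.
Hypothesis YZ_cvg : forall (h : R -> R) (phi : 'rV[R]_m -> R),
  continuous_bounded h -> continuous_bounded phi ->
  \int[Pn n]_w (h (Yn n w) * phi (Zn n w)) @[n --> \oo] -->
  \int[P]_w (h (Y w) * phi (Z w)).
Hypothesis oV : open V.
Hypothesis PV : P [set w | V (Z w)] = 1%E.
Hypothesis hKn : forall n, reg_cond_distr (Pn n) (Yn n) (Zn n) (Kn n).
Hypothesis hK : reg_cond_distr P Y Z K.

Definition real_equicontinuous (f : nat -> 'rV[R]_m -> R) :=
  forall e x, 0 < e -> V x -> exists (delta : R) (n0 : nat),
  0 < delta /\ forall n x', (n0 < n)%N -> `|x' - x| <= delta ->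
  `|f n x' - f n x| < e.

(** Triangle inequality through G: the bound B of h carries L1-closeness over to expectations, and
    E[h(Y_n) G(Z_n)] converges by hypothesis. Each of the three comparisons costs e / 3. *)
Lemma regression_cvg (u h : R -> R) : continuous_bounded u ->
  continuous_bounded h ->
  real_equicontinuous (fun n z => \int[pker_prob (Kn n) z]_y u y) ->
  \int[Pn n]_w (h (Yn n w) * \int[pker_prob (Kn n) (Zn n w)]_y u y)
    @[n --> \oo] -->
  \int[P]_w (h (Y w) * \int[pker_prob K (Z w)]_y u y).
Proof.
move=> cbu cbh ae.
have bu := continuous_bounded_measurableR cbu.
have bh := continuous_bounded_measurableR cbh.
have [M uM] := cbu.2.
pose gn n z := \int[pker_prob (Kn n) z]_y u y.
pose g z := \int[pker_prob K z]_y u y.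
have bgn n : bounded_measurable (gn n) by exact: bounded_measurable_pker.
have bg : bounded_measurable g by exact: bounded_measurable_pker.
have intM (k : R.-pker 'rV[R]_m ~> R) z : `|\int[pker_prob k z]_y u y| <= M.
  rewrite (le_trans (normr_Rint _ bu))//; apply: Rint_le_cst => //.
  exact: bounded_measurable_norm.
have cb1 : continuous_bounded (cst 1 : R -> R).
  by split; [exact: continuous_real_cst|exists 1 => x; rewrite normr1].
have nun_nu (phi : 'rV[R]_m -> R) : continuous_bounded phi ->
    \int[distribution (Pn n) (Zn n)]_x phi x @[n --> \oo] -->
    \int[distribution P Z]_x phi x.
  move=> cbphi; have bphi := continuous_bounded_measurable cbphi.
  have E d0 (O0 : measurableType d0) (Q : probability O0 R)
      (Y0 : {RV Q >-> R}) (Z0 : {RV Q >-> 'rV[R]_m}) :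
      \int[distribution Q Z0]_x phi x = \int[Q]_w (cst 1 (Y0 w) * phi (Z0 w)).
    by rewrite Rint_distribution//; apply: eq_Rintegral => w _; rewrite mul1r.
  rewrite (E _ _ _ Y); apply: eq_cvg_seq (YZ_cvg cb1 cbphi) => n; exact: E.
have disint d0 (O0 : measurableType d0) (Q : probability O0 R)
    (Y0 : {RV Q >-> R}) (Z0 : {RV Q >-> 'rV[R]_m}) (K0 : R.-pker 'rV[R]_m ~> R)
    (phi : 'rV[R]_m -> R) : reg_cond_distr Q Y0 Z0 K0 -> bounded_measurable phi ->
    \int[distribution Q Z0]_z ((\int[pker_prob K0 z]_y u y) * phi z) =
    \int[Q]_w (u (Y0 w) * phi (Z0 w)).
  move=> hK0 bphi; pose F (zy : 'rV[R]_m * R) := u zy.2 * phi zy.1.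
  have bF : bounded_measurable F.
    apply: bounded_measurableM.
      exact: (bounded_measurable_comp measurable_snd bu).
    exact: (bounded_measurable_comp measurable_fst bphi).
  rewrite Rint_distribution; last first.
    by apply: bounded_measurableM => //; exact: bounded_measurable_pker.
  rewrite [RHS](_ : _ = \int[Q]_w F (Z0 w, Y0 w))//.
  rewrite (disintegration hK0 bF); apply: eq_Rintegral => w _.
  under [RHS]eq_Rintegral do rewrite /F/= mulrC.
  by rewrite RintZ// mulrC.
(* By disintegration the weighted mean of [gn n] is E[u(Y_n) phi(Z_n)], in which no regression
   function appears. *)
have gn_g (phi : 'rV[R]_m -> R) : continuous_bounded phi ->
    \int[distribution (Pn n) (Zn n)]_x (gn n x * phi x) @[n --> \oo] -->
    \int[distribution P Z]_x (g x * phi x).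
  move=> cbphi; have bphi := continuous_bounded_measurable cbphi.
  rewrite (disint _ _ _ Y)//; apply: eq_cvg_seq (YZ_cvg cbu cbphi) => n.
  exact: disint.
have [B hB] := cbh.2.
have B0 : 0 <= B by exact: le_trans (normr_ge0 _) (hB 0).
have bhY d0 (O0 : measurableType d0) (Q : probability O0 R) (Y0 : {RV Q >-> R}) :
    bounded_measurable (h \o Y0).
  exact: (bounded_measurable_comp (measurable_funPT Y0) bh).
have bfZ d0 (O0 : measurableType d0) (Q : probability O0 R)
    (Z0 : {RV Q >-> 'rV[R]_m}) (f : 'rV[R]_m -> R) :
    bounded_measurable f -> bounded_measurable (f \o Z0).
  exact: (bounded_measurable_comp (measurable_funPT Z0)).
have close d0 (O0 : measurableType d0) (Q : probability O0 R) (Y0 : {RV Q >-> R})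
    (Z0 : {RV Q >-> 'rV[R]_m}) (f1 f2 : 'rV[R]_m -> R) :
    bounded_measurable f1 -> bounded_measurable f2 ->
    `|\int[Q]_w (h (Y0 w) * f1 (Z0 w)) - \int[Q]_w (h (Y0 w) * f2 (Z0 w))| <=
    B * \int[distribution Q Z0]_z `|f1 z - f2 z|.
  move=> b1 b2.
  have bd := bounded_measurable_norm (bounded_measurableB b1 b2).
  have bh1 := bounded_measurableM (bhY _ _ _ Y0) (bfZ _ _ _ Z0 _ b1).
  have bh2 := bounded_measurableM (bhY _ _ _ Y0) (bfZ _ _ _ Z0 _ b2).
  rewrite -RintB// (le_trans (normr_Rint _ (bounded_measurableB bh1 bh2)))//.
  have bdZ := bfZ _ _ _ Z0 _ bd.
  rewrite Rint_distribution// -RintZ//; apply: le_Rint => [||w].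
  - exact: bounded_measurable_norm (bounded_measurableB bh1 bh2).
  - exact: bounded_measurableM (bounded_measurable_cst _ _) bdZ.
  - by rewrite /= -mulrBr normrM ler_wpM2r.
apply/cvgrPdist_le => e e0.
pose e1 := e / (3 * (B + 1)).
have B10 : 0 < B + 1 by rewrite ltr_wpDl.
have e10 : 0 < e1 by rewrite divr_gt0// mulr_gt0.
have Be1 : B * e1 <= e / 3.
  rewrite /e1 mulrCA ler_pM2l// invfM mulrCA ger_pMr ?invr_gt0//.
  by rewrite ler_pdivrMr ?mul1r ?lerDl.
have [G [cbG nG]] := equicontinuous_approx nun_nu gn_g (fun n => (bgn n).1)
  bg.1 (fun n => intM (Kn n)) (intM K) oV PV ae e10.
have lG := equicontinuous_approx_limit nun_nu gn_g (fun n => (bgn n).1)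
  bg.1 (fun n => intM (Kn n)) (intM K) cbG nG.
have bG := continuous_bounded_measurable cbG.
have e30 : 0 < e / 3 by rewrite divr_gt0.
have := YZ_cvg cbh cbG => /cvgrPdist_le /(_ _ e30) nH.
near=> n.
have h1 := close _ _ _ Y Z _ _ bg bG.
have h2 : `|\int[P]_w (h (Y w) * G (Z w)) - \int[Pn n]_w (h (Yn n w) * G (Zn n w))|
  <= e / 3 by near: n; exact: nH.
have h3 := close _ _ _ (Yn n) (Zn n) _ _ (bgn n) bG.
have h4 : \int[distribution (Pn n) (Zn n)]_x `|gn n x - G x| <= e1 by near: n.
have h5 := le_trans h1 (le_trans (ler_wpM2l B0 lG) Be1).
have h6 := le_trans h3 (le_trans (ler_wpM2l B0 h4) Be1).
rewrite distrC in h6.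
have -> : e = e / 3 + e / 3 + e / 3 by field.
rewrite (le_trans (ler_distD (\int[Pn n]_w (h (Yn n w) * G (Zn n w))) _ _))//.
rewrite lerD// (le_trans (ler_distD (\int[P]_w (h (Y w) * G (Z w))) _ _))//.
exact: lerD.
Unshelve. all: by end_near. Qed.

End regression_convergence.

(* Replacing phi by 0 with probability 1 - c turns the weight c into a genuine
   law, whose integrals are affine in those of c * f \o phi: this avoids the
   division by the mass of c. *)
Section thinning.
Context (R : realType) d (T : measurableType d) (rho : probability T R).
Variables (c : T -> R) (phi : T -> R).
Hypothesis mc : measurable_fun setT c.
Hypothesis c01 : forall x, 0 <= c x <= 1.
Hypothesis mphi : measurable_fun setT phi.

Let coin : T -> pprobability bool R := fun x => bernoulli_prob (c x).
Let mcoin : measurable_fun setT coin.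
Proof. exact: (measurableT_comp (@measurable_bernoulli_prob R) mc). Qed.

Let W0 := mixture rho (kgraph (kprobability mcoin)).

Let X (xb : T * bool) : R := if xb.2 then phi xb.1 else 0.

Let XE : X = fun xb => \1_[set true] xb.2 * phi xb.1.
Proof.
apply/funext => -[x b]; rewrite /X /= indicE.
by case: b; [rewrite mem_set// mul1r|rewrite memNset// mul0r].
Qed.

Let mX : measurable_fun setT X.
Proof.
rewrite XE; apply: measurable_funM; last exact: measurableT_comp.
by apply: measurableT_comp => //; exact: measurable_indic.
Qed.

HB.instance Definition _ := isMeasurableFun.Build _ _ (T * bool)%type R X mX.

Definition thinned_law : probability R R := distribution W0 X.

Lemma Rint_thinned_law (f : R -> R) : bounded_measurable f ->
  \int[thinned_law]_y f y =
  \int[rho]_x (c x * f (phi x)) + (1 - \int[rho]_x c x) * f 0.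
Proof.
move=> bf; rewrite Rint_distribution//.
have bfX : bounded_measurable (f \o X) by exact: bounded_measurable_comp mX bf.
rewrite Rint_mixture//.
have bfphi : bounded_measurable (f \o phi) by exact: bounded_measurable_comp mphi bf.
have bc : bounded_measurable c.
  by split => //; exists 1 => x; have /andP[c0 c1] := c01 x; rewrite ger0_norm.
have b1 := bounded_measurableM bc bfphi.
have b2 : bounded_measurable (fun x => 1 - c x).
  by apply: bounded_measurableB => //; exact: bounded_measurable_cst.
have b3 := bounded_measurableM (bounded_measurable_cst T (f 0)) b2.
transitivity (\int[rho]_x (c x * f (phi x) + f 0 * (1 - c x))); last first.
  rewrite RintD// RintZ// RintB//; last exact: bounded_measurable_cst.
  by rewrite Rint_cst [f 0 * _]mulrC.
apply: eq_Rintegral => x _; rewrite Rint_kgraph//.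
have B (b b' : bool) : (b \in [set b']) = (b == b').
  by apply/idP/eqP => [/set_mem//|->]; exact: mem_set.
have bt b : bounded_measurable (\1_[set b] : bool -> R).
  exact: bounded_measurable_indic.
have -> : (fun y : bool => f (X (x, y))) =
    (fun y => f (phi x) * \1_[set true] y + f 0 * \1_[set false] y).
  apply/funext => b; rewrite /X /= !indicE !B.
  by case: b; rewrite /= mulr1 mulr0 ?addr0 ?add0r.
rewrite RintD; last 2 first.
- exact: bounded_measurableM (bounded_measurable_cst _ _) (bt true).
- exact: bounded_measurableM (bounded_measurable_cst _ _) (bt false).
rewrite !RintZ//.
rewrite (Rint_indic (pker_prob (kprobability mcoin) x))//.
rewrite (Rint_indic (pker_prob (kprobability mcoin) x))//.
have E b : pker_prob (kprobability mcoin) x [set b] = bernoulli_prob (c x) [set b].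
  by [].
rewrite !E !bernoulli_probE// !diracE.
by rewrite !B /= !mulr1 !mulr0 addr0 add0r mulrC.
Qed.

End thinning.

Lemma expectation_Rint (R : realType) d (T : measurableType d)
    (P : probability T R) (f : T -> R) : bounded_measurable f ->
  'E_P[f]%E = (\int[P]_x f x)%:E.
Proof. by move=> bf; rewrite unlock EFin_Rintegral. Qed.

(** The plane carries the product sigma-algebra; f is factored through row vectors of length 2,
    where continuity already gives measurability. *)
Lemma continuous_bounded_measurableR2 (R : realType) (f : R * R -> R) :
  continuous_bounded f -> bounded_measurable f.
Proof.
move=> [cf bf]; split => //.
pose unpack (v : 'rV[R]_2) : R * R := (v ord0 ord0, v ord0 ord_max).
pose pack (x : R * R) : 'rV[R]_2 := \row_(i < 2) if i == ord0 then x.1 else x.2.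
have -> : f = (f \o unpack) \o pack.
  by apply/funext => -[x y]; rewrite /= /unpack /pack !mxE /=.
apply: measurableT_comp.
  apply: continuous_measurable_rV => v; apply: (@continuous_comp _ _ _ unpack f); last exact: cf.
  exact: (cvg_pair (@coord_continuous R 1 2 ord0 ord0 v)
    (@coord_continuous R 1 2 ord0 ord_max v)).
apply: measurable_fun_rV => i; under eq_fun do rewrite mxE.
by case: (i == ord0); [exact: measurable_fst|exact: measurable_snd].
Qed.

(** Only p is confined to C: the centres of the partition of unity will lie in a square, while the
    point compared with them may lie outside. *)
Lemma compact_uniform_continuous (R : realType) (T : normedModType R) (C : set T)
    (f : T -> R) e : compact C -> continuous f -> 0 < e ->
  exists2 delta, 0 < delta & forall p q, C p -> `|q - p| <= delta -> `|f q - f p| <= e.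
Proof.
rewrite compact_cover => cC cf e0.
have e20 : 0 < e / 2 by rewrite divr_gt0.
have dP p : exists delta, 0 < delta /\ forall q, `|p - q| < delta -> `|f p - f q| <= e / 2.
  have /cvgrPdist_le /(_ _ e20) /nbhs_ballP [delta /= d0 h] := cf p.
  by exists delta; split => // q pq; apply: h; rewrite -ball_normE.
have [r {}dP] := choice dP.
have [||s sC Cs] := @cC T C (fun p => ball p (r p / 2)).
- by move=> p Cp; apply: ball_open; rewrite divr_gt0// (dP p).1.
- by move=> p Cp; exists p => //; apply: ballxx; rewrite divr_gt0// (dP p).1.
(* From |c - p| < r c / 2 and |p - q| <= r c / 4, both p and q are within r c of the centre c. *)
pose delta := \big[Num.min/1]_(p <- finmap.enum_fset s) (r p / 4).
exists delta.
  rewrite /delta; elim/big_ind: _ => // [x y x0 y0|p _]; first by rewrite lt_min x0.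
  by rewrite divr_gt0// (dP p).1.
have dle p : p \in finmap.enum_fset s -> delta <= r p / 4.
  move=> ps; rewrite /delta; elim: (finmap.enum_fset s) ps => // a l IHl.
  rewrite inE big_cons ge_min => /orP[/eqP->|/IHl ->]; first by rewrite lexx.
  by rewrite orbT.
move=> p q Cp pq.
have [c /= cs] := Cs p Cp; rewrite -ball_normE /= => cp.
have rc := (dP c).1.
have h1 : `|f c - f p| <= e / 2.
  by apply: (dP c).2; rewrite (lt_trans cp)//; lra.
have h2 : `|f c - f q| <= e / 2.
  apply: (dP c).2; rewrite (le_lt_trans (ler_distD p _ _))//.
  rewrite [`|p - q|]distrC; have := dle c cs; lra.
rewrite (splitr e) (le_trans (ler_distD (f c) _ _))// lerD// distrC//.
Qed.

Lemma cvg_seq_sum (R : realType) I (s : seq I) (u : I -> nat -> R) (l : I -> R) :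
  (forall i, u i n @[n --> \oo] --> l i) ->
  \sum_(i <- s) u i n @[n --> \oo] --> \sum_(i <- s) l i.
Proof.
move=> ul; elim: s => [|i s IHs].
  by rewrite big_nil; apply: eq_cvg_seq (cvg_cst 0) => n; rewrite big_nil.
rewrite big_cons; apply: eq_cvg_seq (cvgD (ul i) IHs) => n.
by rewrite big_cons.
Qed.

(** * Weak convergence in the plane from products of test functions *)

Section product_test_functions.
Context (R : realType).
Variables (mun : nat -> probability (R * R)%type R) (mu : probability (R * R)%type R).
Hypothesis cvg_ab : forall a b : R -> R, continuous a -> (forall x, 0 <= a x <= 1) ->
  continuous_bounded b ->
  \int[mun n]_x (a x.1 * b x.2) @[n --> \oo] --> \int[mu]_x (a x.1 * b x.2).

Let bm2 (a b : R -> R) : continuous_bounded a -> continuous_bounded b ->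
  bounded_measurable (fun x : R * R => a x.1 * b x.2).
Proof.
move=> ca cb; apply: bounded_measurableM.
  exact: (bounded_measurable_comp measurable_fst (continuous_bounded_measurableR ca)).
exact: (bounded_measurable_comp measurable_snd (continuous_bounded_measurableR cb)).
Qed.

Lemma square_tight e : 0 < e -> exists j : nat,
  1 - e <= fine (mu (`[- j%:R, j%:R] `*` `[- j%:R, j%:R])%classic).
Proof.
move=> e0; pose F (j : nat) := (`[- j%:R, j%:R] `*` `[- j%:R, j%:R])%classic : set (R * R).
have mF j : measurable (F j) by apply: measurableX; exact: measurable_itv.
have : mu (F j) @[j --> \oo] --> 1%E.
  have FT : \bigcup_j F j = setT.
    apply/seteqP; split => // -[x y] _.
    exists (maxn (Num.truncn `|x|).+1 (Num.truncn `|y|).+1) => //.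
    rewrite /F; split; rewrite /= in_itv /= -ler_norml.
      by rewrite (le_trans (ltW (truncnS_gt _)))// ler_nat leq_maxl.
    by rewrite (le_trans (ltW (truncnS_gt _)))// ler_nat leq_maxr.
  rewrite -(probability_setT mu) -FT; apply: nondecreasing_cvg_mu => //.
    by rewrite FT.
  move=> i j ij; apply/subsetPset => -[x y] [] /=; rewrite !in_itv /= -!ler_norml => xi yi.
  split; rewrite /= in_itv /= -ler_norml.
    by rewrite (le_trans xi)// ler_nat.
  by rewrite (le_trans yi)// ler_nat.
move=> /fine_cvg /cvgrPdist_le /(_ e e0) [j _ /(_ j (leqnn j)) /= je].
by exists j; move: je; rewrite ler_distl => /andP[_]; rewrite lerBlDr.
Qed.

(** The error of approximating f by a sum of products is at most e / 8 plus M (1 - S(x) S(y)). As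
    S(x) S(y) is itself an admissible product, tightness of mu alone controls this error under
    [mun n] for large n. *)
Lemma weak_cvg_R2_products : weak_cvg_R2 mun mu.
Proof.
move=> f cf [M fM].
have cbf : continuous_bounded f by split => //; exists M.
have bf := continuous_bounded_measurableR2 cbf.
have M0 : 0 <= M by exact: le_trans (normr_ge0 _) (fM 0).
rewrite expectation_Rint//; apply: cvg_EFin.
  by apply: nearW => n; rewrite expectation_Rint.
suff : \int[mun n]_x f x @[n --> \oo] --> \int[mu]_x f x.
  by apply: eq_cvg_seq => n; rewrite /= expectation_Rint.
apply/cvgrPdist_le => e e0.
(* Total error: e / 8 + M e1 under mu, e / 8 + 2 M e1 under [mun n] and e / 8 for G, at most 6 e / 8
   since M e1 <= e / 8. *)
pose e1 := e / (8 * (M + 1)).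
have M10 : 0 < M + 1 by rewrite ltr_wpDl.
have e10 : 0 < e1 by rewrite divr_gt0// mulr_gt0.
have e80 : 0 < e / 8 by rewrite divr_gt0.
have Me1 : M * e1 <= e / 8.
  rewrite /e1 mulrCA ler_pM2l// invfM mulrCA ger_pMr ?invr_gt0//.
  by rewrite ler_pdivrMr ?mul1r ?lerDl.
have [j hj] := square_tight e10.
pose I : set R := `[- j%:R, j%:R]%classic.
have cI : compact I by exact: segment_compact.
have [delta d0 hd] := compact_uniform_continuous (compact_setX cI cI) cf e80.
have [s [phi [sI cphi phi0 phi1 phir]]] :=
  @partition_of_unity R R I (cst delta) cI (fun _ _ => d0).
pose S y := \sum_(x <- s) phi x y.
have cS : continuous S by exact: continuous_real_sum.
have S01 z : 0 <= S z <= 1 by rewrite (phi1 z).1 andbT sumr_ge0.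
pose SS (z : R * R) := S z.1 * S z.2.
have SS01 z : 0 <= SS z <= 1.
  have /andP[a0 a1] := S01 z.1; have /andP[b0 b1] := S01 z.2.
  by rewrite /SS mulr_ge0//= mulr_ile1.
have bSS : bounded_measurable SS by apply: bm2; exact: continuous_bounded01.
have bSS1 : bounded_measurable (fun z => 1 - SS z).
  by apply: bounded_measurableB => //; exact: bounded_measurable_cst.
(* No upper bound on [phi p] is at hand for p outside s; the value 0 there makes every [psi p]
   admissible in [cvg_ab]. *)
pose psi p y := if p \in s then phi p y else 0.
have psi0 p y : 0 <= psi p y by rewrite /psi; case: ifP.
have psi1 p y : psi p y <= 1.
  rewrite /psi; case: ifP => // ps.
  by rewrite (le_trans _ (phi1 y).1)// (big_rem p)//= lerDl sumr_ge0.
have cpsi p : continuous (psi p).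
  by rewrite /psi; case: (p \in s) => //; exact: continuous_real_cst.
have psi01 p y : 0 <= psi p y <= 1 by rewrite psi0 psi1.
have SE y : S y = \sum_(x <- s) psi x y.
  by rewrite /S; apply: eq_big_seq => x xs; rewrite /psi xs.
pose G (z : R * R) := \sum_(p <- s) \sum_(q <- s) (f (p, q) * (psi p z.1 * psi q z.2)).
have bpq p q : bounded_measurable (fun z : R * R => psi p z.1 * psi q z.2).
  by apply: bm2; apply: continuous_bounded01.
have bfpq p q : bounded_measurable (fun z : R * R => f (p, q) * (psi p z.1 * psi q z.2)).
  exact: bounded_measurableM (bounded_measurable_cst _ _) (bpq p q).
have bG : bounded_measurable G.
  by apply: bounded_measurable_sum => p; exact: bounded_measurable_sum.
have GE (nu : probability (R * R)%type R) : \int[nu]_z G z =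
    \sum_(p <- s) \sum_(q <- s) (f (p, q) * \int[nu]_z (psi p z.1 * psi q z.2)).
  rewrite Rint_sum => [|p]; last exact: bounded_measurable_sum.
  apply: eq_bigr => p _; rewrite Rint_sum//; apply: eq_bigr => q _.
  by rewrite RintZ.
have cvgG : \int[mun n]_z G z @[n --> \oo] --> \int[mu]_z G z.
  rewrite GE; apply: eq_cvg_seq (fun n => GE (mun n)) _.
  apply: cvg_seq_sum => p; apply: cvg_seq_sum => q; apply: cvgM; first exact: cvg_cst.
  by apply: cvg_ab => //; exact: continuous_bounded01.
have cvgSS : \int[mun n]_z SS z @[n --> \oo] --> \int[mu]_z SS z.
  by apply: cvg_ab => //; exact: continuous_bounded01.
have fG z : `|f z - G z| <= e / 8 + M * (1 - SS z).
  have -> : f z - G z = \sum_(p <- s) \sum_(q <- s)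
      ((f z - f (p, q)) * (psi p z.1 * psi q z.2)) + f z * (1 - SS z).
    have -> : f z * (1 - SS z) = f z - \sum_(p <- s) \sum_(q <- s)
       (f z * (psi p z.1 * psi q z.2)).
      rewrite mulrBr mulr1 /SS !SE mulr_suml mulr_sumr; congr (_ - _).
      by apply: eq_bigr => p _; rewrite !mulr_sumr.
    rewrite [_ + (f z - _)]addrC addrAC -addrA; congr (_ + _).
    rewrite /G -!sumrN -big_split/=; apply: eq_bigr => p _.
    rewrite -!sumrN -big_split/=; apply: eq_bigr => q _; ring.
  rewrite (le_trans (ler_normD _ _))// lerD//; last first.
    have /andP[s0 s1] := SS01 z.
    by rewrite normrM ler_pM// ger0_norm// subr_ge0.
  rewrite (le_trans (ler_norm_sum _ _ _))//.
  apply: (@le_trans _ _ (e / 8 * SS z)); last first.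
    by have /andP[s0 s1] := SS01 z; rewrite ler_piMr// ltW.
  rewrite /SS !SE mulr_suml mulr_sumr big_seq [leRHS]big_seq.
  apply: ler_sum => p ps; rewrite (le_trans (ler_norm_sum _ _ _))//.
  rewrite !mulr_sumr big_seq [leRHS]big_seq.
  apply: ler_sum => q qs; rewrite normrM (ger0_norm (mulr_ge0 _ _))//.
  have [->|pz] := eqVneq (psi p z.1) 0; first by rewrite !mul0r !mulr0.
  have [->|qz] := eqVneq (psi q z.2) 0; first by rewrite !mulr0.
  rewrite ler_wpM2r ?mulr_ge0//; apply: hd; first by split; exact: sI.
  move: pz qz; rewrite /psi ps qs => pz qz.
  by rewrite prod_normE ge_max/= (phir _ _ ps pz) (phir _ _ qs qz).
have bfG := bounded_measurableB bf bG.
have close (nu : probability (R * R)%type R) :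
    `|\int[nu]_z f z - \int[nu]_z G z| <= e / 8 + M * (1 - \int[nu]_z SS z).
  rewrite -RintB// (le_trans (normr_Rint _ bfG))//.
  apply: (@le_trans _ _ (\int[nu]_z (e / 8 + M * (1 - SS z)))).
    apply: le_Rint => //; first exact: bounded_measurable_norm.
    apply: bounded_measurableD; first exact: bounded_measurable_cst.
    exact: bounded_measurableM (bounded_measurable_cst _ _) bSS1.
  rewrite RintD ?Rint_cst ?RintZ// ?RintB// ?Rint_cst//.
  - exact: bounded_measurable_cst.
  - exact: bounded_measurable_cst.
  - exact: bounded_measurableM (bounded_measurable_cst _ _) bSS1.
have muSS : 1 - e1 <= \int[mu]_z SS z.
  have mII : measurable (I `*` I) by apply: measurableX; exact: measurable_itv.
  rewrite (le_trans hj)// -Rint_indic//; apply: le_Rint => // [|z].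
    exact: bounded_measurable_indic.
  rewrite indicE; have [/set_mem [I1 I2]|_] := boolP (z \in _).
    by rewrite /SS /S (phi1 z.1).2// (phi1 z.2).2// mulr1.
  by have /andP[] := SS01 z.
have nSS : \forall n \near \oo, 1 - 2 * e1 <= \int[mun n]_z SS z.
  by move/cvgr_ge : cvgSS; apply; rewrite (lt_le_trans _ muSS)//; lra.
have nG : \forall n \near \oo, `|\int[mu]_z G z - \int[mun n]_z G z| <= e / 8.
  by move/cvgrPdist_le : cvgG; apply.
near=> n.
have h1 := close mu; have h2 := close (mun n).
have h3 : 1 - 2 * e1 <= \int[mun n]_z SS z by near: n.
have h4 : `|\int[mu]_z G z - \int[mun n]_z G z| <= e / 8 by near: n.
rewrite (le_trans (ler_distD (\int[mun n]_z G z) _ _))//.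
have h5 : M * (1 - \int[mu]_z SS z) <= M * e1 by rewrite ler_wpM2l//; lra.
have h6 : M * (1 - \int[mun n]_z SS z) <= M * (2 * e1) by rewrite ler_wpM2l//; lra.
have h7 := ler_distD (\int[mu]_z G z) (\int[mu]_z f z) (\int[mun n]_z G z).
rewrite [`|\int[mun n]_z G z - _|]distrC; lra.
Unshelve. all: by end_near. Qed.

End product_test_functions.

(** * Real and imaginary parts of test functions *)

Section complex_valued.
Context (R : realType).
Implicit Types z : cplx R.

Lemma normc_ge_Im z : (`|complex.Im z|%:C)%C <= `|z|.
Proof.
rewrite -normrN -ReiNIm (le_trans (normc_ge_Re _))// normrM.
suff -> : `|'i%C : R[i]| = 1 by rewrite mulr1.
by rewrite normc_def /= expr0n expr1n add0r sqrtr1.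
Qed.

Lemma normc_le_ReIm z : `|z| <= ((`|complex.Re z| + `|complex.Im z|)%:C)%C.
Proof.
rewrite normc_def lecR; set a := complex.Re z; set b := complex.Im z.
have ab : a ^+ 2 + b ^+ 2 <= (`|a| + `|b|) ^+ 2.
  rewrite sqrrD !real_normK ?num_real// lerD2r lerDl mulrn_wge0// mulr_ge0.
by rewrite (le_trans (ler_wsqrtr ab))// sqrtr_sqr ger0_norm// addr_ge0.
Qed.

(** In the order of the complex numbers a positive element is real, so the radius in a complex limit
    is a real number. *)
Lemma cplx_gt0E (e : cplx R) : 0 < e -> e = ((complex.Re e)%:C)%C /\ 0 < complex.Re e.
Proof.
case: e => a b; rewrite ltcE /= => /andP[/eqP -> a0]; split => //.
Qed.

Lemma continuous_Re (u : R -> cplx R) : continuous u -> continuous (fun y => complex.Re (u y)).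
Proof.
move=> cu x; apply/cvgrPdist_lt => e e0.
have e0' : 0 < (e%:C)%C :> cplx R by rewrite ltcR.
have /cvgrPdist_lt /(_ _ e0') := cu x; apply: filterS => y /(le_lt_trans (normc_ge_Re _)).
by rewrite ltcR raddfB.
Qed.

Lemma continuous_Im (u : R -> cplx R) : continuous u -> continuous (fun y => complex.Im (u y)).
Proof.
move=> cu x; apply/cvgrPdist_lt => e e0.
have e0' : 0 < (e%:C)%C :> cplx R by rewrite ltcR.
have /cvgrPdist_lt /(_ _ e0') := cu x; apply: filterS => y /(le_lt_trans (normc_ge_Im _)).
by rewrite ltcR raddfB.
Qed.

Lemma continuous_bounded_ReIm (u : R -> cplx R) : continuous u ->
  (exists M : cplx R, forall y, `|u y| <= M) ->
  continuous_bounded (fun y => complex.Re (u y)) /\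
  continuous_bounded (fun y => complex.Im (u y)).
Proof.
move=> cu [M uM].
have h z : `|z| <= M -> `|complex.Re z| <= complex.Re M /\ `|complex.Im z| <= complex.Re M.
  move=> zM; split.
    by have := le_trans (normc_ge_Re z) zM; rewrite lecE /= => /andP[].
  by have := le_trans (normc_ge_Im z) zM; rewrite lecE /= => /andP[].
split; split; [exact: continuous_Re| |exact: continuous_Im|];
  by exists (complex.Re M) => y; have [] := h _ (uM y).
Qed.

Lemma cvg_complex (a b : nat -> R) (a0 b0 : R) :
  a n @[n --> \oo] --> a0 -> b n @[n --> \oo] --> b0 ->
  ((a n +i* b n)%C : cplx R) @[n --> \oo] --> ((a0 +i* b0)%C : cplx R).
Proof.
move=> ca cb; apply/cvgrPdist_le => e /cplx_gt0E [-> e0].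
have e20 : 0 < complex.Re e / 2 by rewrite divr_gt0.
move/cvgrPdist_le : ca => /(_ _ e20) na.
move/cvgrPdist_le : cb => /(_ _ e20) nb.
near=> n; apply: le_trans (normc_le_ReIm _) _.
rewrite lecR (splitr (complex.Re e)) /=; apply: lerD.
  by near: n.
by near: n.
Unshelve. all: by end_near. Qed.

End complex_valued.

Section markov_convergence.
Context (R : realType) (m : nat).
Context (dn : nat -> measure_display) (Omn : forall n, measurableType (dn n))
  (Pn : forall n, probability (Omn n) R)
  d (Om : measurableType d) (P : probability Om R).
Variables (Yn : forall n, {RV (Pn n) >-> R}) (Zn : forall n, {RV (Pn n) >-> 'rV[R]_m}).
Variables (Y : {RV P >-> R}) (Z : {RV P >-> 'rV[R]_m}).
Variables (Kn : nat -> R.-pker 'rV[R]_m ~> R) (K : R.-pker 'rV[R]_m ~> R).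
Variable V : set 'rV[R]_m.
Hypothesis YZ_cvg : forall (h : R -> R) (phi : 'rV[R]_m -> R),
  continuous_bounded h -> continuous_bounded phi ->
  \int[Pn n]_w (h (Yn n w) * phi (Zn n w)) @[n --> \oo] -->
  \int[P]_w (h (Y w) * phi (Z w)).
Hypothesis oV : open V.
Hypothesis PV : P [set w | V (Z w)] = 1%E.
Hypothesis hKn : forall n, reg_cond_distr (Pn n) (Yn n) (Zn n) (Kn n).
Hypothesis hK : reg_cond_distr P Y Z K.
Variable U : set (R -> cplx R).
Hypothesis U_cvg_det : cvg_determining_class U.
Hypothesis ae_U : forall u, U u ->
  asymp_equicontinuous (fun n => cond_expectation (Kn n) u) V.

Lemma markov_product_cvg :
  exists (mun : nat -> probability (R * R)%type R) (mu : probability (R * R)%type R),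
    [/\ forall n, is_markov_product (Pn n) (Yn n) (Zn n) (Kn n) (mun n),
        is_markov_product P Y Z K mu & weak_cvg_R2 mun mu].
Proof.
have [mun munP] := choice (fun n => markov_product_exists (hKn n)).
have [mu [mu_mp muE]] := markov_product_exists hK.
exists mun, mu; split => //; first by move=> n; have [] := munP n.
have munE n := (munP n).2.
apply: weak_cvg_R2_products => a b ca a01 cbb.
have cba := continuous_bounded01 ca a01.
have ba := continuous_bounded_measurableR cba.
have bb := continuous_bounded_measurableR cbb.
have bprod (v : R -> R) : bounded_measurable v ->
    bounded_measurable (fun x : R * R => a x.1 * v x.2).
  move=> bv; apply: bounded_measurableM.
    exact: (bounded_measurable_comp measurable_fst ba).
  exact: (bounded_measurable_comp measurable_snd bv).
have ba1 : bounded_measurable (fun x : R * R => a x.1).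
  exact: (bounded_measurable_comp measurable_fst ba).
have intE d0 (O0 : measurableType d0) (Q : probability O0 R) (Y0 : {RV Q >-> R})
    (Z0 : {RV Q >-> 'rV[R]_m}) (K0 : R.-pker 'rV[R]_m ~> R) (v : R -> R) :
    bounded_measurable v ->
    \int[Q]_w \int[pker_prob K0 (Z0 w)]_y (a (Y0 w) * v y) =
    \int[Q]_w (a (Y0 w) * \int[pker_prob K0 (Z0 w)]_y v y).
  by move=> bv; apply: eq_Rintegral => w _; rewrite RintZ.
(* The mass of the weight enters the formula for [W] separately, so it has to converge on its
   own. *)
have cvg_a : \int[mun n]_x a x.1 @[n --> \oo] --> \int[mu]_x a x.1.
  have E d0 (O0 : measurableType d0) (Q : probability O0 R) (Y0 : {RV Q >-> R})
      (Z0 : {RV Q >-> 'rV[R]_m}) (K0 : R.-pker 'rV[R]_m ~> R) :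
      \int[Q]_w \int[pker_prob K0 (Z0 w)]_y a (Y0 w) =
      \int[Q]_w (a (Y0 w) * cst 1 (Z0 w)).
    by apply: eq_Rintegral => w _; rewrite Rint_cst mulr1.
  rewrite muE// E; apply: eq_cvg_seq (YZ_cvg cba _) => [n|].
    by rewrite munE// E.
  by split; [exact: continuous_real_cst|exists 1 => x; rewrite normr1].
have cvg_v (v : R -> R) : continuous_bounded v ->
    real_equicontinuous V (fun n z => \int[pker_prob (Kn n) z]_y v y) ->
    \int[mun n]_x (a x.1 * v x.2) @[n --> \oo] --> \int[mu]_x (a x.1 * v x.2).
  move=> cbv aev; have bv := continuous_bounded_measurableR cbv.
  have bav := bprod v bv.
  rewrite (etrans (muE _ bav) (intE _ _ _ _ _ _ _ bv)).
  apply: eq_cvg_seq (regression_cvg YZ_cvg oV PV hKn hK cbv cba aev) => n.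
  exact: etrans (munE n _ bav) (intE _ _ _ _ _ _ _ bv).
have m1 : measurable_fun setT (fun x : R * R => a x.1) by case: ba1.
have a1 (x : R * R) : 0 <= a x.1 <= 1 by exact: a01.
pose W (nu : probability (R * R)%type R) := thinned_law nu m1 (@measurable_snd _ _ R R).
have WE nu (v : R -> R) : bounded_measurable v -> \int[W nu]_y v y =
    \int[nu]_x (a x.1 * v x.2) + (1 - \int[nu]_x a x.1) * v 0.
  exact: Rint_thinned_law.
have cvgW (v : R -> R) : continuous_bounded v ->
    real_equicontinuous V (fun n z => \int[pker_prob (Kn n) z]_y v y) ->
    \int[W (mun n)]_y v y @[n --> \oo] --> \int[W mu]_y v y.
  move=> cbv aev; have bv := continuous_bounded_measurableR cbv.
  rewrite WE//; apply: eq_cvg_seq (fun n => WE (mun n) v bv) _.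
  apply: cvgD; first exact: cvg_v.
  by apply: cvgM; [apply: cvgB => //; exact: cvg_cst|exact: cvg_cst].
(* The determining class acts here; u in U enters through its real and imaginary parts, which
   inherit asymptotic equicontinuity. *)
have wW : weak_cvg_R (fun n => W (mun n)) (W mu).
  apply: U_cvg_det.2 => u Uu; have [cu bu] := U_cvg_det.1 u Uu.
  have [cbRe cbIm] := continuous_bounded_ReIm cu bu.
  apply: cvg_complex.
    apply: cvgW cbRe _ => e x e0 Vx; have [delta [n0 [d0 h]]] := ae_U Uu e0 Vx.
    exists delta, n0; split => // n x' nn xx'.
    have := le_lt_trans (normc_ge_Re _) (h n x' nn xx').
    by rewrite ltcR raddfB.
  apply: cvgW cbIm _ => e x e0 Vx; have [delta [n0 [d0 h]]] := ae_U Uu e0 Vx.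
  exists delta, n0; split => // n x' nn xx'.
  have := le_lt_trans (normc_ge_Im _) (h n x' nn xx').
  by rewrite ltcR raddfB.
have cvgWb : \int[W (mun n)]_y b y @[n --> \oo] --> \int[W mu]_y b y.
  have [cb bB] := cbb; have := wW b cb bB.
  rewrite expectation_Rint// => /fine_cvg; apply: eq_cvg_seq => n.
  by rewrite /= expectation_Rint.
(* The contribution that thinning adds at 0 is subtracted again, which leaves the integral of a(x)
   b(y). *)
have sub (x y : R) : x = x + y - y by rewrite addrK.
rewrite (sub (\int[mu]_x _) ((1 - \int[mu]_x a x.1) * b 0)) -WE//.
apply: eq_cvg_seq (fun n => sub _ ((1 - \int[mun n]_x a x.1) * b 0)) _.
apply: cvgB; first by apply: eq_cvg_seq cvgWb => n; rewrite WE.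
by apply: cvgM; [apply: cvgB => //; exact: cvg_cst|exact: cvg_cst].
Qed.

End markov_convergence.

Lemma continuous_reindex (R : realType) m n (s : 'I_n -> 'I_m) :
  continuous (fun v : 'rV[R]_m => \row_(k < n) v ord0 (s k) : 'rV[R]_n).
Proof.
move=> v A /nbhs_ballP[e /= e0 eA]; apply/nbhs_ballP; exists e => // w [_ h].
by apply: eA; split => // i j; rewrite !mxE; exact: h.
Qed.

Section convergence_of_subvectors.
Context (R : realType) (q p : nat).
Context d (Om : measurableType d) (P : probability Om R).
Variables (Y : {RV P >-> 'rV[R]_q}) (X : {RV P >-> 'rV[R]_p}).
Context (dn : nat -> measure_display) (Omn : forall n, measurableType (dn n))
  (Pn : forall n, probability (Omn n) R).
Variables (Yn : forall n, {RV (Pn n) >-> 'rV[R]_q})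
  (Xn : forall n, {RV (Pn n) >-> 'rV[R]_p}).
Hypothesis YX_cvg :
  cvg_in_distribution Pn (fun n => rv_joint (Yn n) (Xn n)) P (rv_joint Y X).

(** Both kinds of conditioning vector are selections s of coordinates of (Y, X), so that h(Y_i)
    phi(Z) is one bounded continuous function of (Y, X). *)
Lemma subvector_cvg (i : 'I_q) m (s : 'I_m -> 'I_(q + p))
  (Z : {RV P >-> 'rV[R]_m}) (Zn : forall n, {RV (Pn n) >-> 'rV[R]_m}) :
  (forall w, Z w = \row_k rv_joint Y X w ord0 (s k)) ->
  (forall n w, Zn n w = \row_k rv_joint (Yn n) (Xn n) w ord0 (s k)) ->
  forall (h : R -> R) (phi : 'rV[R]_m -> R),
  continuous_bounded h -> continuous_bounded phi ->
  \int[Pn n]_w (h (rv_coord (Yn n) i w) * phi (Zn n w)) @[n --> \oo] -->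
  \int[P]_w (h (rv_coord Y i w) * phi (Z w)).
Proof.
move=> ZE ZnE h phi [ch [M hM]] [cphi [N phiN]].
pose F (v : 'rV[R]_(q + p)) := h (v ord0 (lshift p i)) * phi (\row_k v ord0 (s k)).
have cF : continuous F.
  apply: continuous_realM => v.
    by apply: continuous_comp; [exact: coord_continuous|exact: ch].
  by apply: continuous_comp; [exact: continuous_reindex|exact: cphi].
have FB : exists B, forall v, `|F v| <= B.
  by exists (M * N) => v; rewrite normrM ler_pM.
have bF : bounded_measurable F.
  by apply: continuous_bounded_measurable; split.
have bFJ d0 (O0 : measurableType d0) (Q : probability O0 R)
   (J : {RV Q >-> 'rV[R]_(q + p)}) : bounded_measurable (F \o J).
  exact: (bounded_measurable_comp (measurable_funPT J) bF).
have bJ := bFJ _ _ P (rv_joint Y X).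
have bJn n := bFJ _ _ (Pn n) (rv_joint (Yn n) (Xn n)).
have := YX_cvg cF FB; rewrite (expectation_Rint _ bJ) => /fine_cvg.
have FE d0 (O0 : measurableType d0) (Q : probability O0 R)
    (Y0 : {RV Q >-> 'rV[R]_q}) (X0 : {RV Q >-> 'rV[R]_p}) (Z0 : {RV Q >-> 'rV[R]_m}) :
    (forall w, Z0 w = \row_k rv_joint Y0 X0 w ord0 (s k)) ->
    \int[Q]_w (h (rv_coord Y0 i w) * phi (Z0 w)) =
    \int[Q]_w (F \o rv_joint Y0 X0) w.
  move=> Z0E; apply: eq_Rintegral => w _.
  by rewrite /F /= Z0E /rv_coord /rv_joint row_mxEl.
rewrite (FE _ _ _ Y X)//; apply: eq_cvg_seq => n.
by rewrite /= (expectation_Rint _ (bJn n)); exact: FE.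
Qed.

Lemma past_reindex d0 (O0 : measurableType d0) (Q : probability O0 R)
    (Y0 : {RV Q >-> 'rV[R]_q}) (X0 : {RV Q >-> 'rV[R]_p}) (i : 'I_q) w :
  rv_past Y0 i w = \row_k rv_joint Y0 X0 w ord0
     (lshift p (widen_ord (ltnW (ltn_ord i)) k)).
Proof. by apply/rowP => k; rewrite [LHS]mxE [RHS]mxE /rv_joint row_mxEl. Qed.

Lemma joint_past_reindex d0 (O0 : measurableType d0) (Q : probability O0 R)
    (Y0 : {RV Q >-> 'rV[R]_q}) (X0 : {RV Q >-> 'rV[R]_p}) (i : 'I_q) w :
  rv_joint (rv_past Y0 i) X0 w = \row_k rv_joint Y0 X0 w ord0
     (match fintype.split k with
      | inl j => lshift p (widen_ord (ltnW (ltn_ord i)) j)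
      | inr l => rshift q l
      end).
Proof.
apply/rowP => k; rewrite [RHS]mxE /rv_joint -[in LHS](fintype.splitK k).
case: (fintype.split k) => j /=.
  by rewrite !row_mxEl !mxE.
by rewrite !row_mxEr.
Qed.

End convergence_of_subvectors.

(** * Quantiles *)

Section quantile_function.
Context (R : realType) d (Om : measurableType d) (P : probability Om R).
Variable Y : {RV P >-> R}.

Definition cdfR (y : R) : R := fine (cdf Y y).
(** The left limit of the distribution function; the probability P(Y >= y) inside xi is its
    complement to 1. *)
Definition lcdf (y : R) : R := fine (distribution P Y `]-oo, y[).
Let q := @quantile R d Om P Y.

Let law := distribution P Y.
Let finlaw A : measurable A -> law A \is a fin_num.
Proof. exact: fin_num_measure. Qed.

Lemma cdfRE y : (cdfR y)%:E = cdf Y y.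
Proof. by rewrite /cdfR fineK//; exact: finlaw. Qed.

Let law_le A B : measurable A -> measurable B -> A `<=` B ->
  fine (law A) <= fine (law B).
Proof. by move=> mA mB AB; rewrite fine_le ?finlaw// le_measure ?inE. Qed.

Let law_le1 A : measurable A -> fine (law A) <= 1.
Proof.
move=> mA; rewrite -lee_fin fineK ?finlaw//; exact: probability_le1.
Qed.

Lemma cdfR_le x y : x <= y -> cdfR x <= cdfR y.
Proof. by move=> xy; apply: law_le => //; apply: subset_itvl; rewrite bnd_simp. Qed.

Lemma lcdf_le x y : x <= y -> lcdf x <= lcdf y.
Proof. by move=> xy; apply: law_le => //; apply: subset_itvl; rewrite bnd_simp. Qed.

Lemma lcdf_le_cdfR y : lcdf y <= cdfR y.
Proof. by apply: law_le => //; apply: subset_itvl; rewrite bnd_simp. Qed.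

Lemma cdfR_le_lcdf x y : x < y -> cdfR x <= lcdf y.
Proof. by move=> xy; apply: law_le => //; apply: subset_itvl; rewrite bnd_simp. Qed.

Lemma lcdf_ge0 y : 0 <= lcdf y. Proof. exact: fine_ge0. Qed.
Lemma lcdf_le1 y : lcdf y <= 1. Proof. exact: law_le1. Qed.
Lemma cdfR_le1 y : cdfR y <= 1. Proof. exact: law_le1. Qed.

(** Continuity from below, in a form that hands over a point strictly below a and so leaves room for
    a ramp between the two. *)
Lemma lcdf_approx a e : 0 < e -> exists2 b, b < a & lcdf a - e <= cdfR b.
Proof.
move=> e0; pose S k := `]-oo, a - k.+1%:R^-1]%classic.
have SE : \bigcup_k S k = `]-oo, a[%classic.
  apply/seteqP; split => [y [k _]|y]; rewrite /S /= !in_itv/=.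
    by move=> yk; rewrite (le_lt_trans yk)// ltrBlDr ltrDl invr_gt0.
  rewrite -subr_gt0 => /ltr_add_invr[k]; rewrite add0r => kd.
  by exists k => //=; rewrite in_itv/=; rewrite lerBrDl -lerBrDr ltW.
have : law (S k) @[k --> \oo] --> law `]-oo, a[%classic.
  rewrite -SE; apply: nondecreasing_cvg_mu => [k||i j ij].
  - exact: measurable_itv.
  - by rewrite SE; exact: measurable_itv.
  apply/subsetPset; apply: subset_itvl.
  by rewrite bnd_simp lerD2l lerN2 lef_pV2 ?posrE// ler_nat.
rewrite -(fineK (finlaw (measurable_itv `]-oo, a[))).
move=> /fine_cvg /cvgrPdist_le /(_ e e0) [k _ /(_ k (leqnn k)) /= ke].
exists (a - k.+1%:R^-1); first by rewrite ltrBlDr ltrDl invr_gt0.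
move: ke; rewrite ler_distl => /andP[_].
by rewrite -lerBlDr.
Qed.

Variable t : R.
Hypothesis t01 : 0 < t < 1.

Let A := [set y | (t%:E <= cdf Y y)%E].

Let AE y : A y <-> t <= cdfR y.
Proof. by rewrite /A /= -cdfRE lee_fin. Qed.

Let A0 : A !=set0.
Proof.
have /andP[_ t1] := t01.
have := cvg_cdfy1 Y; move=> /fine_cvg /cvgrPdist_lt /(_ (1 - t)).
rewrite subr_gt0 => /(_ t1) [M [_ /(_ (M + 1))]] /=.
rewrite ltrDl ltr01 => /(_ isT) h.
have {}h : `|1 - cdfR (M + 1)| < 1 - t by exact: h.
exists (M + 1); apply/AE; move: h.
by rewrite ltr_distl => /andP[_ h]; rewrite ltW//; lra.
Qed.

Let Alb : has_lbound A.
Proof.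
have /andP[t0 _] := t01.
have := cvg_cdfNy0 Y; move=> /fine_cvg /cvgrPdist_lt /(_ t t0) [M [_ h]].
exists (M - 1) => y /AE ty; rewrite leNgt; apply/negP => yM.
have := h y; rewrite /= (lt_trans yM) ?ltrBlDr ?ltrDl// => /(_ isT).
rewrite sub0r normrN ltNge => /negP; apply.
by rewrite (le_trans ty)// ler_norm.
Qed.

Lemma quantile_le y : t <= cdfR y -> q t <= y.
Proof. by move=> /AE; apply: ge_inf. Qed.

(** The infimum is attained by right continuity: otherwise F would stay below t slightly to the
    right of q(t). *)
Lemma le_cdfR_quantile : t <= cdfR (q t).
Proof.
rewrite leNgt; apply/negP => Ft.
have := @cdf_right_continuous _ _ _ P Y (q t).
rewrite -cdfRE => /fine_cvg /cvgrPdist_lt /(_ (t - cdfR (q t))).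
rewrite subr_gt0 => /(_ Ft) [e /= e0 h].
have : q t + e / 2 <= q t.
  apply: lb_le_inf => // y /AE ty; rewrite leNgt; apply/negP => ye.
  have h1 : cdfR (q t + e / 2) < t.
    have := h (q t + e / 2); rewrite /ball_/= opprD addrA subrr sub0r normrN.
    rewrite gtr0_norm ?divr_gt0// ltr_pdivrMr// mulr_natr mulr2n ltrDr e0.
    rewrite ltrDl divr_gt0// => /(_ isT isT); rewrite -/(cdfR _).
    rewrite distrC => /(le_lt_trans (ler_norm _)).
    by rewrite ltrD2r.
  by have := lt_le_trans h1 (le_trans ty (cdfR_le (ltW ye))); rewrite ltxx.
by rewrite gerDl leNgt divr_gt0.
Qed.

Lemma quantile_leP y : q t <= y <-> t <= cdfR y.
Proof.
split; last exact: quantile_le.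
by move=> /cdfR_le; apply: le_trans; exact: le_cdfR_quantile.
Qed.

Lemma lt_quantile y : y < q t -> cdfR y < t.
Proof. by move=> yq; rewrite ltNge; apply/negP => /quantile_leP; rewrite leNgt yq. Qed.

Lemma lcdf_quantile_le : lcdf (q t) <= t.
Proof.
apply/ler_addgt0Pr => e e0; have [b bq] := lcdf_approx (q t) e0.
by rewrite lerBlDr => /le_trans; apply; rewrite lerD2r ltW// lt_quantile.
Qed.

End quantile_function.

Lemma quantile_homo (R : realType) d (Om : measurableType d) (P : probability Om R)
    (Y : {RV P >-> R}) s t : 0 < s < 1 -> 0 < t < 1 -> s <= t ->
  @quantile R d Om P Y s <= @quantile R d Om P Y t.
Proof.
by move=> s01 t01 st; apply: quantile_le => //; apply: le_trans st (le_cdfR_quantile _ _).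
Qed.

Lemma probability_eq_rays (R : realType) (m1 m2 : probability R R) :
  (forall x, m1 `]x, +oo[%classic = m2 `]x, +oo[%classic) ->
  forall A, measurable A -> m1 A = m2 A.
Proof.
move=> m12 A mA; apply: (measure_unique (@RGenOInfty.G R)
  (fun k : nat => `](- k%:R)%R, +oo[%classic)) => //.
- exact: RGenOInfty.measurableE.
- move=> _ _ [x ->] [y ->]; exists (Num.max x y).
  apply/seteqP; split => z /=; rewrite !in_itv/= !andbT gt_max; first by case=> -> ->.
  by move=> /andP[].
- by move=> k; exists (- k%:R).
- apply/seteqP; split => // x _; exists (Num.truncn `|x|).+1 => //=.
  rewrite in_itv/= andbT ltrNl (le_lt_trans _ (truncnS_gt _))//.
  by rewrite -normrN ler_norm.
- by move=> _ [x ->]; exact: m12.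
- by move=> k; rewrite (le_lt_trans (probability_le1 _ _))// ltry.
Qed.

Section uniform01.
Context (R : realType).

Let unif_measure : {measure set (measurableTypeR R) -> \bar R} :=
  mrestr (@lebesgue_measure R) (measurable_itv `]0%R, 1%R[).

Let unif_set : set (measurableTypeR R) -> \bar R := unif_measure.

HB.instance Definition _ := Measure.on unif_set.

Let unif_setT : unif_set setT = 1%E.
Proof.
rewrite /unif_set /= /mrestr setTI lebesgue_measure_itv/= lte_fin ltr01.
by rewrite -EFinB subr0.
Qed.

HB.instance Definition _ := Measure_isProbability.Build _ _ _ unif_set unif_setT.

Definition unif01 : probability (measurableTypeR R) R := unif_set.

Lemma unif01E A : unif01 A = lebesgue_measure (A `&` `]0, 1[).
Proof. by []. Qed.

Lemma ae_unif01 (Q : R -> Prop) :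
  (\forall t \ae lebesgue_measure, t \in `]0, 1[ -> Q t) ->
  \forall t \ae unif01, Q t.
Proof.
move=> [N [mN N0 hN]]; exists (N `|` ~` `]0, 1[); split.
- by apply: measurableU => //; apply: measurableC; exact: measurable_itv.
- rewrite unif01E setIUl setICl setU0; apply: (subset_measure0 (B := N)) => //.
  by apply: measurableI => //; exact: measurable_itv.
- move=> t /= nQ; have [t01|t01] := pselect (t \in `]0, 1[); last by right.
  by left; apply: hN => /= h; apply: nQ; exact: h.
Qed.

End uniform01.

Section quantile_transform.
Context (R : realType) d (Om : measurableType d) (P : probability Om R).
Variable Y : {RV P >-> R}.

(* Outside ]0, 1[ the quantile is the junk infimum of an empty or unbounded set. *)
Definition quantile01 (t : measurableTypeR R) : R :=
  if t \in `]0, 1[ then @quantile R d Om P Y t else 0.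

(** On ]0, 1[ this is the equivalence of q(t) <= x and t <= F(x); outside, the default value 0
    exceeds x exactly when x < 0. *)
Let quantile01_ray x : quantile01 @^-1` `]x, +oo[ =
  (`]cdfR Y x, 1[ `|` (if x < 0 then ~` `]0, 1[ else set0))%classic.
Proof.
have F0 : 0 <= cdfR Y x by exact: fine_ge0.
apply/seteqP; split => t /=; rewrite !in_itv/= andbT /quantile01.
  case: ifPn => [t01|t01 x0]; last by right; rewrite x0 /=; exact/negP.
  rewrite in_itv/= in t01; move=> xq; left; have /andP[_ ->] := t01.
  by rewrite andbT; exact: lt_quantile.
case=> [/andP[tF t1]|].
  have t01 : 0 < t < 1 by rewrite (le_lt_trans F0).
  rewrite in_itv/= t01 ltNge; apply/negP => /(quantile_leP _ t01).
  by rewrite leNgt tF.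
by case: ifPn => // x0 /negP/negbTE ->.
Qed.

Lemma measurable_quantile01 : measurable_fun setT quantile01.
Proof.
apply: (measurability (@RGenOInfty.G R)); first exact: RGenOInfty.measurableE.
move=> _ [_ [x ->] <-]; rewrite setTI quantile01_ray.
apply: measurableU; first exact: measurable_itv.
by case: ifP => // _; apply: measurableC; exact: measurable_itv.
Qed.

HB.instance Definition _ :=
  isMeasurableFun.Build _ _ (measurableTypeR R) R quantile01 measurable_quantile01.

(** Laws on the line are determined by open upper rays, and ]F(x), 1[ has length P(Y > x). *)
Lemma quantile_transform (g : R -> R) : bounded_measurable g ->
  \int[distribution P Y]_y g y = \int[@unif01 R]_t g (quantile01 t).
Proof.
move=> bg; rewrite -(Rint_distribution (P := @unif01 R) quantile01)//.
apply: eq_Rint_probability => // A mA; apply: probability_eq_rays => // x.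
rewrite [RHS](_ : _ = lebesgue_measure (quantile01 @^-1` `]x, +oo[ `&` `]0, 1[))//.
rewrite quantile01_ray setIUl.
have F0 : 0 <= cdfR Y x by exact: fine_ge0.
have -> : ((if x < 0 then ~` `]0, 1[ else set0) `&` `]0, 1[ = set0 :> set R)%classic.
  by case: ifP => _; [rewrite setICl|rewrite set0I].
have -> : (`]cdfR Y x, 1[ `&` `]0, 1[ = `]cdfR Y x, 1[ :> set R)%classic.
  apply/seteqP; split => t /=; rewrite !in_itv/=; first by case.
  by move=> /andP[Ft t1]; rewrite Ft t1 (le_lt_trans F0).
rewrite setU0 lebesgue_measure_itv/= lte_fin.
have -> : (`]x, +oo[ = ~` `]-oo, x])%classic by rewrite setCitvl.
transitivity (1 - (cdfR Y x)%:E)%E.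
  by rewrite [LHS]probability_setC// cdfRE.
case: ltP => [_|F1]; first by rewrite -EFinB.
have -> : cdfR Y x = 1 by apply/eqP; rewrite eq_le F1 cdfR_le1.
by rewrite subee.
Qed.

End quantile_transform.

(** * Convergence of rank correlations *)

(** Such a t is the right end of the nonempty interval from P(Y < q(t)) to t. For s < t these
    intervals are disjoint, since q(s) < q(t) gives s = F(q(s)) <= P(Y < q(t)); a rational chosen in
    each makes the set countable. *)
Lemma quantile_plateau_ends_countable (R : realType) d (Om : measurableType d)
    (P : probability Om R) (Y : {RV P >-> R}) :
  countable [set t | [/\ 0 < t < 1, cdfR Y (@quantile R d Om P Y t) = t &
                        lcdf Y (@quantile R d Om P Y t) < t]].
Proof.
set E := (X in countable X); set q := @quantile R d Om P Y.
have rP t : exists r : rat, E t -> lcdf Y (q t) < ratr r < t.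
  have [[_ _ ht]|] := pselect (E t); last by exists 0.
  by have [r] := rat_in_itvoo ht; rewrite in_itv/= => hr; exists r.
have [r {}rP] := choice rP.
apply/countable_injP; exists (choice.pickle \o r) => s t.
rewrite !inE => Es Et /(pcan_inj choice.pickleK) rst.
wlog st : s t Es Et rst / s <= t => [wlg|].
  by have [st|/ltW ts] := leP s t; [exact: wlg|exact/esym/wlg].
have [s01 Fs Hs] := Es; have [t01 Ft Ht] := Et.
have : q s <= q t by exact: quantile_homo.
rewrite le_eqVlt => /predU1P[qst|/(cdfR_le_lcdf Y)]; first by rewrite -Fs -Ft /= -/q qst.
rewrite /q Fs => sH.
have /andP[_ h1] := rP s Es; have /andP[h2 _] := rP t Et.
by have := lt_trans h1 (le_lt_trans sH h2); rewrite rst ltxx.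
Qed.

Section common_marginals.
Context (R : realType) d (Om : measurableType d) (P : probability Om R).
Variables (Y : {RV P >-> R}) (mu : probability (R * R)%type R).
Hypothesis marg1 : forall A, measurable A -> mu (A `*` setT) = distribution P Y A.
Hypothesis marg2 : forall A, measurable A -> mu (setT `*` A) = distribution P Y A.

Definition upper_square (nu : probability (R * R)%type R) (y : R) : R :=
  fine (nu (`[y, +oo[ `*` `[y, +oo[)%classic).

Let law := distribution P Y.

Let proj1 : R * R -> R := fst.
Let proj2 : R * R -> R := snd.
Let mproj1 : measurable_fun setT proj1. Proof. exact: measurable_fst. Qed.
Let mproj2 : measurable_fun setT proj2. Proof. exact: measurable_snd. Qed.
HB.instance Definition _ := isMeasurableFun.Build _ _ (R * R)%type R proj1 mproj1.
HB.instance Definition _ := isMeasurableFun.Build _ _ (R * R)%type R proj2 mproj2.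

Lemma Rint_marginal1 (f : R -> R) : bounded_measurable f ->
  \int[mu]_x f x.1 = \int[law]_y f y.
Proof.
move=> bf; rewrite -(Rint_distribution (P := mu) proj1)//.
apply: eq_Rint_probability => // A mA; apply: etrans (marg1 mA).
by congr (mu _); apply/seteqP; split => -[x y] //= [].
Qed.

Lemma Rint_marginal2 (f : R -> R) : bounded_measurable f ->
  \int[mu]_x f x.2 = \int[law]_y f y.
Proof.
move=> bf; rewrite -(Rint_distribution (P := mu) proj2)//.
apply: eq_Rint_probability => // A mA; apply: etrans (marg2 mA).
by congr (mu _); apply/seteqP; split => -[x y] //= [].
Qed.

Lemma Rint_upper_ray a : \int[law]_y (\1_`[a, +oo[ y) = 1 - lcdf Y a.
Proof.
rewrite Rint_indic; last exact: measurable_itv.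
have -> : (`[a, +oo[ = ~` `]-oo, a[)%classic by rewrite setCitvl.
rewrite probability_setC; last exact: measurable_itv.
rewrite /lcdf fineB//; exact: fin_num_measure.
Qed.

Lemma Rint_open_upper_ray a : \int[law]_y (\1_`]a, +oo[ y) = 1 - cdfR Y a.
Proof.
rewrite Rint_indic; last exact: measurable_itv.
have -> : (`]a, +oo[ = ~` `]-oo, a])%classic by rewrite setCitvl.
rewrite probability_setC; last exact: measurable_itv.
rewrite /cdfR fineB//; exact: fin_num_measure.
Qed.

(** With i the indicator of the ray, r(x) r(y) - i(x) i(y) lies between 0 and (r - i)(x) + (r -
    i)(y). Both terms have the same mean because the marginals coincide, whence the factor 2. *)
Lemma upper_square_approx (r : R -> R) a : measurable_fun setT r ->
  (forall y, 0 <= r y <= 1) -> (forall y, a <= y -> r y = 1) ->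
  `|\int[mu]_x (r x.1 * r x.2) - upper_square mu a| <=
  2 * (\int[law]_y r y - (1 - lcdf Y a)).
Proof.
move=> mr r01 r1.
have br : bounded_measurable r.
  by split => //; exists 1 => y; have /andP[h1 h2] := r01 y; rewrite ger0_norm.
pose i : R -> R := \1_`[a, +oo[.
have bi : bounded_measurable i by apply: bounded_measurable_indic; exact: measurable_itv.
have iE y : i y = if a <= y then 1 else 0.
  by rewrite /i indicE mem_setE in_itv/= andbT; case: ifP.
have ir y : i y <= r y by rewrite iE; case: ifP => [/r1 ->//|_]; case/andP: (r01 y).
have i01 y : 0 <= i y <= 1 by rewrite iE; case: ifP; rewrite ?lexx ?ler01.
have b1 (f : R -> R) : bounded_measurable f -> bounded_measurable (fun x : R * R => f x.1).
  exact: (bounded_measurable_comp measurable_fst).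
have b2 (f : R -> R) : bounded_measurable f -> bounded_measurable (fun x : R * R => f x.2).
  exact: (bounded_measurable_comp measurable_snd).
have brr := bounded_measurableM (b1 r br) (b2 r br).
have bii := bounded_measurableM (b1 i bi) (b2 i bi).
have -> : upper_square mu a = \int[mu]_x (i x.1 * i x.2).
  rewrite /upper_square -Rint_indic; last by apply: measurableX; exact: measurable_itv.
  by apply: eq_Rintegral => -[x y] _; rewrite /i !indicE in_setX -natrM mulnb.
have bri := bounded_measurableB br bi.
rewrite -Rint_upper_ray -RintB// -RintB// ger0_norm; last first.
  apply: Rint_ge0 => x; rewrite subr_ge0.
  have /andP[h1 h2] := i01 x.1; have /andP[h3 h4] := i01 x.2.
  by apply: ler_pM.
have -> : 2 * \int[law]_y (r y - \1_`[a, +oo[ y) =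
    \int[mu]_x (r x.1 - i x.1) + \int[mu]_x (r x.2 - i x.2).
  by rewrite (Rint_marginal1 bri) (Rint_marginal2 bri) mulr2n mulrDl mul1r.
rewrite -RintD//; [|exact: (b1 _ bri)|exact: (b2 _ bri)].
apply: le_Rint => [||x].
- exact: bounded_measurableB.
- exact: bounded_measurableD (b1 _ bri) (b2 _ bri).
- have /andP[h1 h2] := i01 x.1; have /andP[h3 h4] := r01 x.2.
  have := ir x.1; have := ir x.2 => h5 h6; nra.
Qed.

Lemma upper_square_le a : upper_square mu a <= 1 - lcdf Y a.
Proof.
have ma : measurable (`[a, +oo[%classic : set R) by exact: measurable_itv.
rewrite -Rint_upper_ray Rint_indic//.
apply: (@le_trans _ _ (fine (mu (`[a, +oo[ `*` setT)%classic))); last by rewrite marg1.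
rewrite /upper_square fine_le//.
- by apply: fin_num_measure; exact: measurableX.
- by apply: fin_num_measure; exact: measurableX.
- by apply: le_measure; rewrite ?inE; [exact: measurableX|exact: measurableX|move=> x []].
Qed.

End common_marginals.

Section ramp.
Context (R : realType).
Variables (b b' : R).
Hypothesis bb' : b < b'.

Definition ramp (y : R) := clamp ((y - b) / (b' - b)).

Lemma ramp_continuous : continuous ramp.
Proof.
apply: clamp_continuous; apply: continuous_realM; last exact: continuous_real_cst.
by apply: continuous_realB; [move=> y; exact: cvg_id|exact: continuous_real_cst].
Qed.

Lemma ramp01 y : 0 <= ramp y <= 1.
Proof. by rewrite clamp_ge0 clamp_le1. Qed.

Lemma ramp_bounded : continuous_bounded ramp.
Proof. exact: continuous_bounded01 ramp_continuous ramp01. Qed.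

Lemma ramp0 y : y <= b -> ramp y = 0.
Proof.
by move=> yb; rewrite /ramp clamp_eq0// mulr_le0_ge0 ?subr_le0// invr_ge0 subr_ge0 ltW.
Qed.

Lemma ramp1 y : b' <= y -> ramp y = 1.
Proof.
move=> yb; rewrite /ramp clamp_eq1// ler_pdivlMr ?subr_gt0// mul1r.
by rewrite lerD2r.
Qed.

(** Links weak convergence to [lcdf] and [cdfR] without asking b or b' to be continuity points. *)
Lemma ramp_between d (Om : measurableType d) (P : probability Om R) (Y : {RV P >-> R}) :
  1 - lcdf Y b' <= \int[distribution P Y]_y ramp y <= 1 - cdfR Y b.
Proof.
have br := continuous_bounded_measurableR ramp_bounded.
rewrite -Rint_upper_ray -Rint_open_upper_ray; apply/andP; split.
  apply: le_Rint => // [|y].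
    by apply: bounded_measurable_indic; exact: measurable_itv.
  rewrite indicE mem_setE in_itv/= andbT; case: (leP b' y) => [/ramp1 ->//|_].
  by have /andP[] := ramp01 y.
apply: le_Rint => // [|y].
  by apply: bounded_measurable_indic; exact: measurable_itv.
rewrite indicE mem_setE in_itv/= andbT; case: (ltP b y) => [_|/ramp0 ->//].
by have /andP[] := ramp01 y.
Qed.

End ramp.

(** * Convergence at the quantiles *)

Section quantile_convergence.
Context (R : realType).
Context (dn : nat -> measure_display) (Omn : forall n, measurableType (dn n))
  (Pn : forall n, probability (Omn n) R)
  d (Om : measurableType d) (P : probability Om R).
Variables (Yn : forall n, {RV (Pn n) >-> R}) (Y : {RV P >-> R}).
Variables (mun : nat -> probability (R * R)%type R) (mu : probability (R * R)%type R).
Hypothesis marg1n : forall n A, measurable A ->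
  mun n (A `*` setT) = distribution (Pn n) (Yn n) A.
Hypothesis marg2n : forall n A, measurable A ->
  mun n (setT `*` A) = distribution (Pn n) (Yn n) A.
Hypothesis marg1 : forall A, measurable A -> mu (A `*` setT) = distribution P Y A.
Hypothesis marg2 : forall A, measurable A -> mu (setT `*` A) = distribution P Y A.
Hypothesis mu_cvg : weak_cvg_R2 mun mu.

Let qn n := @quantile R _ _ (Pn n) (Yn n).
Let q := @quantile R _ _ P Y.

Hypothesis cdf_quantile_cvg : \forall t \ae lebesgue_measure, t \in `]0, 1[ ->
  cdf (P := Pn n) (Yn n) (qn n t) @[n --> \oo] --> cdf (P := P) Y (q t).

Let weak_Rint (f : R * R -> R) : continuous_bounded f ->
  \int[mun n]_x f x @[n --> \oo] --> \int[mu]_x f x.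
Proof.
move=> cbf; have bf := continuous_bounded_measurableR2 cbf.
have [cf fM] := cbf; have := mu_cvg cf fM.
rewrite expectation_Rint// => /fine_cvg; apply: eq_cvg_seq => n.
by rewrite /= expectation_Rint.
Qed.

Let cb1 (r : R -> R) : continuous_bounded r -> continuous_bounded (fun x : R * R => r x.1).
Proof.
move=> [cr [M rM]]; split; last by exists M => x; exact: rM.
by move=> x; apply: continuous_comp; [exact: cvg_fst|exact: cr].
Qed.

Let cb2 (r : R -> R) : continuous_bounded r -> continuous_bounded (fun x : R * R => r x.2).
Proof.
move=> [cr [M rM]]; split; last by exists M => x; exact: rM.
by move=> x; apply: continuous_comp; [exact: cvg_snd|exact: cr].
Qed.

Let law_cvg (r : R -> R) : continuous_bounded r ->
  \int[distribution (Pn n) (Yn n)]_y r y @[n --> \oo] --> \int[distribution P Y]_y r y.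
Proof.
move=> cbr; have br := continuous_bounded_measurableR cbr.
rewrite -(Rint_marginal1 marg1 br); apply: eq_cvg_seq (weak_Rint (cb1 cbr)) => n.
by rewrite (Rint_marginal1 (marg1n n) br).
Qed.

(** F((b + q(t)) / 2) < t, so the ramp starting at b has limiting mean above 1 - t; for large n this
    forces 1 - F_n(b) > 1 - t. *)
Let near_lt_quantile t b : 0 < t < 1 -> b < q t ->
  \forall n \near \oo, b < qn n t.
Proof.
move=> t01 bq; have bc : b < (b + q t) / 2 by lra.
have cq : (b + q t) / 2 < q t by lra.
have cbr := ramp_bounded b ((b + q t) / 2).
have h0 : 1 - t < \int[distribution P Y]_y ramp b ((b + q t) / 2) y.
  have /andP[h _] := ramp_between bc Y; apply: lt_le_trans h.
  by rewrite ltrD2l ltrN2 (le_lt_trans (lcdf_le_cdfR _ _))// lt_quantile.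
have := law_cvg cbr => /cvgr_gt /(_ _ h0); apply: filterS => n hn.
have /andP[_ h] := ramp_between bc (Yn n).
rewrite ltNge; apply/negP => /quantile_leP => /(_ t01) tF.
by have := lt_le_trans hn h; rewrite ltrD2l ltrN2 ltNge tF.
Qed.

(** With c = (b + q(t)) / 2, the ramp from b to c gives P(Y_n < c) >= F(b) - e / 2 for large n, and
    eventually c < q_n(t). *)
Let near_lcdf_ge t e : 0 < t < 1 -> 0 < e ->
  \forall n \near \oo, lcdf Y (q t) - e <= lcdf (Yn n) (qn n t).
Proof.
move=> t01 e0; have e20 : 0 < e / 2 by rewrite divr_gt0.
have [b bq hb] := lcdf_approx Y (q t) e20.
have bc : b < (b + q t) / 2 by lra.
have cq : (b + q t) / 2 < q t by lra.
have cbr := ramp_bounded b ((b + q t) / 2).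
have := law_cvg cbr => /cvgrPdist_le /(_ _ e20) h1.
have h2 := near_lt_quantile t01 cq.
near=> n.
have h3 : (b + q t) / 2 < qn n t by near: n.
have : `|\int[distribution P Y]_y ramp b ((b + q t) / 2) y -
    \int[distribution (Pn n) (Yn n)]_y ramp b ((b + q t) / 2) y| <= e / 2 by near: n.
rewrite ler_norml => /andP[h4 _].
have /andP[_ h5] := ramp_between bc Y.
have /andP[h6 _] := ramp_between bc (Yn n).
have h7 := lcdf_le (Yn n) (ltW h3).
have h8 := lcdf_le_cdfR (Yn n) b.
lra.
Unshelve. all: by end_near. Qed.

Let cdf_good x y : 0 <= x -> x < y -> y <= 1 -> exists s, [/\ x < s < y &
   cdfR (Yn n) (qn n s) @[n --> \oo] --> cdfR Y (q s)].
Proof.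
move=> x0 xy y1; have [N [mN N0 hN]] := cdf_quantile_cvg.
apply: contrapT => hs.
have : lebesgue_measure `]x, y[%classic = 0%E.
  apply: (subset_measure0 (B := N)) => // s /=; rewrite in_itv/= => /andP[xs sy].
  apply: hN => /= h; apply: hs; exists s; split; first by rewrite xs sy.
  have s01 : s \in `]0, 1[ by rewrite in_itv/= (le_lt_trans x0 xs) (lt_le_trans sy y1).
  by have := h s01; rewrite -cdfRE => /fine_cvg.
rewrite lebesgue_measure_itv/= lte_fin xy -EFinB => -[] /eqP.
by rewrite subr_eq0 gt_eqF.
Qed.

(* At the excluded t, the right ends of the plateaus of q, an atom of Yn n may
   end just below t, so that qn n t misses the atom of Y at q t. *)
Definition plateau_interior t := [/\ 0 < t < 1 &
  lcdf Y (q t) = t \/ t < cdfR Y (q t)].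

Lemma lcdf_quantile_cvg t : plateau_interior t ->
  lcdf (Yn n) (qn n t) @[n --> \oo] --> lcdf Y (q t).
Proof.
move=> [t01 tgood]; apply/cvgrPdist_le => e e0.
have n1 := near_lcdf_ge t01 e0.
have n2 : \forall n \near \oo, lcdf (Yn n) (qn n t) <= lcdf Y (q t) + e.
  (* Here the target is t itself, and P(Y_n < q_n(t)) never exceeds t. *)
  have [Ht|Ht] := eqVneq (lcdf Y (q t)) t.
    apply: nearW => n; rewrite Ht (le_trans (lcdf_quantile_le _ t01))//.
    by rewrite lerDl ltW.
  have tF : t < cdfR Y (q t) by case: tgood => // H; rewrite H eqxx in Ht.
  have {Ht} Ht : lcdf Y (q t) < t by rewrite lt_neqAle Ht lcdf_quantile_le.
  have m1 : Num.min t (lcdf Y (q t) + e) <= 1.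
    by rewrite ge_min; case/andP: t01 => _ /ltW ->.
  have m2 : lcdf Y (q t) < Num.min t (lcdf Y (q t) + e).
    by rewrite lt_min Ht ltrDl.
  (* As s lies strictly between P(Y < q(t)) and t, q(s) = q(t). Condition (iv) at s makes
     F_n(q_n(s)) exceed t for large n, hence q_n(t) <= q_n(s), while P(Y_n < q_n(s)) <= s. *)
  have [s [/andP[Hs +] cs]] := cdf_good (lcdf_ge0 Y (q t)) m2 m1.
  rewrite lt_min => /andP[st se].
  have s01 : 0 < s < 1.
    rewrite (le_lt_trans (lcdf_ge0 Y (q t)) Hs) (lt_trans st)//.
    by case/andP: t01.
  have qst : q s = q t.
    apply/eqP; rewrite eq_le quantile_homo//=; last exact: ltW.
    rewrite leNgt; apply/negP => /(cdfR_le_lcdf Y) h.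
    have := le_lt_trans (le_trans (le_cdfR_quantile Y s01) h) Hs.
    by rewrite ltxx.
  rewrite qst in cs; move/cvgr_gt : cs => /(_ _ tF); apply: filterS => n tFn.
  have qts : qn n t <= qn n s by apply: quantile_le => //; exact: ltW.
  rewrite (le_trans (lcdf_le _ qts))// (le_trans (lcdf_quantile_le _ s01))//.
  exact: ltW.
near=> n; rewrite ler_distl; apply/andP; split.
  by rewrite lerBlDr; near: n.
by rewrite -lerBlDr; near: n.
Unshelve. all: by end_near. Qed.

(** One ramp serves mu and all large n, because its upper end c lies below q(t) and eventually below
    q_n(t). *)
Lemma upper_square_quantile_cvg t : plateau_interior t ->
  upper_square (mun n) (qn n t) @[n --> \oo] --> upper_square mu (q t).
Proof.
move=> tgood; have [t01 _] := tgood; apply/cvgrPdist_le => e e0.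
(* In tenths of e: 1 for the integrals of the product ramp, 2 for its error under mu, and 6 under
   [mun n], where [hb], [h2] and [h3] add up and are doubled. *)
have e80 : 0 < e / 10 by rewrite divr_gt0.
have [b bq hb] := lcdf_approx Y (q t) e80.
set c := (b + q t) / 2.
have bc : b < c by rewrite /c; lra.
have cq : c < q t by rewrite /c; lra.
have cbr := ramp_bounded b c.
have [cr _] := cbr.
have br := continuous_bounded_measurableR cbr.
have r01 := ramp01 b c.
have cbrr : continuous_bounded (fun x : R * R => ramp b c x.1 * ramp b c x.2).
  split; first by apply: continuous_realM; [case: (cb1 cbr)|case: (cb2 cbr)].
  exists 1 => x; have /andP[p0 p1] := r01 x.1; have /andP[p2 p3] := r01 x.2.
  by rewrite ger0_norm ?mulr_ge0// mulr_ile1.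
have := weak_Rint cbrr => /cvgrPdist_le /(_ _ e80) n1.
have := law_cvg cbr => /cvgrPdist_le /(_ _ e80) n2.
have := lcdf_quantile_cvg tgood => /cvgrPdist_le /(_ _ e80) n3.
have n4 := near_lt_quantile t01 cq.
near=> n.
have h1 : `|\int[mu]_x (ramp b c x.1 * ramp b c x.2) -
   \int[mun n]_x (ramp b c x.1 * ramp b c x.2)| <= e / 10 by near: n.
have h2 : `|\int[distribution P Y]_y ramp b c y -
    \int[distribution (Pn n) (Yn n)]_y ramp b c y| <= e / 10 by near: n.
have h3 : `|lcdf Y (q t) - lcdf (Yn n) (qn n t)| <= e / 10 by near: n.
have h4 : c < qn n t by near: n.
have h5 := upper_square_approx marg1 marg2 br.1 r01
  (fun y qy => ramp1 bc (le_trans (ltW cq) qy)).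
have h6 := upper_square_approx (marg1n n) (marg2n n) br.1 r01
  (fun y qy => ramp1 bc (le_trans (ltW h4) qy)).
have /andP[h7 h8] := ramp_between bc Y.
move: h1 h2 h3 h5 h6; rewrite !ler_norml => /andP[? ?] /andP[? ?] /andP[? ?]
  /andP[? ?] /andP[? ?].
by apply/andP; split; lra.
Unshelve. all: by end_near. Qed.

End quantile_convergence.

Section variance_of_versions.
Context (R : realType) d (T : measurableType d) (P : probability T R).

(** f will be a chosen version, known only almost surely and perhaps unbounded; the computation is
    carried out on the bounded g. *)
Lemma variance_ae (f g : T -> R) : measurable_fun setT f -> bounded_measurable g ->
  (\forall x \ae P, f x = g x) ->
  'V_P[f] = (\int[P]_x (g x ^+ 2) - (\int[P]_x g x) ^+ 2)%:E.
Proof.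
move=> mf bg fg; have [mg _] := bg.
have Ef : 'E_P[f]%E = (\int[P]_x g x)%:E.
  rewrite unlock -EFin_Rintegral//; apply: ae_eq_integral => //.
  - exact/measurable_EFinP.
  - exact/measurable_EFinP.
  - by apply: filterS fg => x -> _.
rewrite /variance covariance.unlock Ef /=.
set m := \int[P]_x g x.
have bgm : bounded_measurable (fun x => (g x - m) * (g x - m)).
  by apply: bounded_measurableM; apply: bounded_measurableB => //; exact: bounded_measurable_cst.
transitivity (\int[P]_x ((g x - m) * (g x - m)))%:E.
  rewrite unlock -EFin_Rintegral//; apply: ae_eq_integral => //.
  - apply/measurable_EFinP; apply: measurable_funM; apply: measurable_funB => //.
  - by apply/measurable_EFinP; case: bgm.
  - by apply: filterS fg => x fgx _ /=; rewrite -fgx.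
congr EFin.
have bg2 : bounded_measurable (fun x => g x ^+ 2) by exact: bounded_measurableM.
have bmg : bounded_measurable (fun x => 2 * m * g x).
  exact: bounded_measurableM (bounded_measurable_cst _ _) bg.
have bB := bounded_measurableB bg2 bmg.
transitivity (\int[P]_x (g x ^+ 2 - 2 * m * g x + m ^+ 2)).
  by apply: eq_Rintegral => x _; ring.
rewrite RintD//; last exact: bounded_measurable_cst.
by rewrite RintB// RintZ// Rint_cst -/m; ring.
Qed.

Lemma variance_indic (E : set T) : measurable E ->
  'V_P[\1_E] = (fine (P E) - (fine (P E)) ^+ 2)%:E.
Proof.
move=> mE; have bE := bounded_measurable_indic R mE.
rewrite (variance_ae bE.1 bE (aeW P (fun=> erefl))).
rewrite -Rint_indic//; congr (_ - _)%:E; apply: eq_Rintegral => x _.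
by rewrite indicE; case: (_ \in _); rewrite ?expr1n ?expr0n.
Qed.

End variance_of_versions.

Section xi_numerator_denominator.
Context (R : realType) d (Om : measurableType d) (P : probability Om R).
Variable Y : {RV P >-> R}.

Definition xi_num (mu : probability (R * R)%type R) : R :=
  \int[distribution P Y]_y (upper_square mu y - (1 - lcdf Y y) ^+ 2).

Definition xi_den : R :=
  \int[distribution P Y]_y ((1 - lcdf Y y) - (1 - lcdf Y y) ^+ 2).

Lemma bounded_measurable_ucdf : bounded_measurable (fun y => 1 - lcdf Y y).
Proof.
apply: bounded_measurableB; first exact: bounded_measurable_cst.
split; first by apply: nondecreasing_measurable => // x y; exact: lcdf_le.
by exists 1 => y; rewrite ger0_norm ?lcdf_ge0// lcdf_le1.
Qed.

Lemma bounded_measurable_upper_square (mu : probability (R * R)%type R) :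
  bounded_measurable (upper_square mu).
Proof.
have msq y : measurable (`[y, +oo[ `*` `[y, +oo[ : set (R * R))%classic.
  by apply: measurableX; exact: measurable_itv.
have fsq y : mu (`[y, +oo[ `*` `[y, +oo[)%classic \is a fin_num.
  exact: fin_num_measure.
split.
  have -> : upper_square mu = (fun y => - (- upper_square mu y)).
    by apply/funext => y; rewrite opprK.
  apply: measurable_funN; apply: nondecreasing_measurable => // x y xy.
  rewrite lerN2 /upper_square fine_le// le_measure ?inE// => -[a b] [] /=.
  rewrite !in_itv/= !andbT => ya yb; split; rewrite /= ?in_itv/= ?andbT.
    exact: le_trans xy ya.
  exact: le_trans xy yb.
exists 1 => y; rewrite /upper_square ger0_norm ?fine_ge0//.
by rewrite -lee_fin fineK//; exact: probability_le1.
Qed.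

Lemma measurable_upper_event y : measurable [set w | y <= Y w].
Proof.
have -> : [set w | y <= Y w] = Y @^-1` `[y, +oo[.
  by apply/seteqP; split => w; rewrite /= ?in_itv/= ?andbT.
by apply: measurable_funPTI; exact: measurable_itv.
Qed.

Lemma prob_upper_event y : fine (P [set w | y <= Y w]) = 1 - lcdf Y y.
Proof.
rewrite -Rint_upper_ray Rint_indic; last exact: measurable_itv.
congr (fine (P _)); apply/seteqP; split => w; rewrite /= ?in_itv/= ?andbT//.
Qed.

Lemma xi_denE :
  fine (\int[distribution P Y]_y 'V_P[\1_[set w | y <= Y w]%R]) = xi_den.
Proof.
congr fine; apply: eq_integral => y _.
by rewrite variance_indic ?prob_upper_event//; exact: measurable_upper_event.
Qed.

Section markov.
Context d' (S : measurableType d') (Z : {RV P >-> S}) (K : R.-pker S ~> R).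
Hypothesis hK : reg_cond_distr P Y Z K.
Variable mu : probability (R * R)%type R.
Hypothesis hmu : is_markov_product P Y Z K mu.

Lemma Rint_kernel A : measurable A ->
  \int[P]_w fine (K (Z w) A) = fine (distribution P Y A).
Proof.
move=> mA; have mYA := measurable_funPTI Y mA.
have bK := bounded_measurable_kernel K mA.
have := (cond_prob_versionP Z mYA bK).2 (hK mA) setT measurableT.
under eq_Rintegral do rewrite indicT mulr1.
by under [X in _ = X -> _]eq_Rintegral do rewrite indicT mulr1; rewrite Rint_indic.
Qed.

Lemma markov_marginal1 A : measurable A -> mu (A `*` setT) = distribution P Y A.
Proof.
move=> mA; have mAT : measurable (A `*` [set: R]) by exact: measurableX.
rewrite -(fineK (fin_num_measure mu _ mAT)) (markov_product_rectangle hK hmu)//.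
rewrite -[RHS](fineK (fin_num_measure (distribution P Y) _ mA)) -Rint_kernel//.
by congr EFin; apply: eq_Rintegral => w _; rewrite [K _ setT]prob_kernel mulr1.
Qed.

Lemma markov_marginal2 A : measurable A -> mu (setT `*` A) = distribution P Y A.
Proof.
move=> mA; have mAT : measurable ([set: R] `*` A) by exact: measurableX.
rewrite -(fineK (fin_num_measure mu _ mAT)) (markov_product_rectangle hK hmu)//.
rewrite -[RHS](fineK (fin_num_measure (distribution P Y) _ mA)) -Rint_kernel//.
by congr EFin; apply: eq_Rintegral => w _; rewrite [K _ setT]prob_kernel mul1r.
Qed.

(* phi and psi make Z and Z' generate the same sigma-algebra. *)
Lemma xiE d2 (S' : measurableType d2) (Z' : {RV P >-> S'}) (phi : S -> S') (psi : S' -> S) :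
  measurable_fun setT phi -> measurable_fun setT psi ->
  (forall w, Z' w = phi (Z w)) -> (forall w, Z w = psi (Z' w)) ->
  xi P Y Z' = xi_num mu / xi_den.
Proof.
move=> mphi mpsi Z'E ZE; rewrite /xi xi_denE; congr (_ / _).
congr fine; apply: eq_integral => y _.
have mI : measurable (`[y, +oo[%classic : set R) by exact: measurable_itv.
have mE := measurable_upper_event y.
have bK := bounded_measurable_kernel K mI.
have bKpsi := bounded_measurable_comp mpsi bK.
have EE : [set w | y <= Y w] = Y @^-1` `[y, +oo[.
  by apply/seteqP; split => w; rewrite /= ?in_itv/= ?andbT.
(* K composed with psi is a version given Z', because Z' and Z generate the same events. *)
have v : cond_prob_version P Z' [set w | y <= Y w] (fun z => fine (K (psi z) `[y, +oo[%classic)).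
  apply/cond_prob_versionP => // C mC.
  have mYI := measurable_funPTI Y mI.
  have mphiC : measurable (phi @^-1` C) by rewrite -[X in measurable X]setTI; exact: mphi.
  have := (cond_prob_versionP Z mYI bK).2 (hK mI) (phi @^-1` C) mphiC.
  rewrite -EE.
  have indE w : \1_(phi @^-1` C) (Z w) = \1_C (Z' w) :> R.
    rewrite Z'E !indicE; congr (_%:R); apply/idP/idP => /set_mem h; exact/mem_set.
  under eq_Rintegral do rewrite indE.
  move=> ->; apply: eq_Rintegral => w _.
  by rewrite indE ZE.
have bg : bounded_measurable (fun w => fine (K (Z w) `[y, +oo[%classic)).
  exact: (bounded_measurable_comp (measurable_funPT Z) bK).
rewrite (variance_ae (g := fun w => fine (K (Z w) `[y, +oo[%classic)))//; last 2 first.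
- by apply: measurableT_comp => //; exact: cond_prob_measurable.
- by apply: filterS (cond_prob_ae mE v) => w /= ->; rewrite -ZE.
congr EFin; congr (_ - _ ^+ 2).
  by rewrite /upper_square (markov_product_rectangle hK hmu).
by rewrite Rint_kernel// -Rint_upper_ray Rint_indic.
Qed.

(** A square has at most the mass of the strip over the same ray; with a positive denominator this
    gives xi <= 1. *)
Lemma xi_num_le_den : xi_num mu <= xi_den.
Proof.
have b1 := bounded_measurable_ucdf.
have b2 := bounded_measurable_upper_square mu.
have b3 := bounded_measurableM b1 b1.
apply: le_Rint => [||y]; [exact: bounded_measurableB|exact: bounded_measurableB|].
by rewrite lerD2r; exact: (upper_square_le markov_marginal1).
Qed.

End markov.

End xi_numerator_denominator.

Lemma quantile01E (R : realType) d (Om : measurableType d) (P : probability Om R)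
    (Y : {RV P >-> R}) t : 0 < t < 1 -> quantile01 Y t = @quantile R d Om P Y t.
Proof. by rewrite /quantile01 in_itv /= => ->. Qed.

Lemma ae_plateau_interior (R : realType) d (Om : measurableType d)
    (P : probability Om R) (Y : {RV P >-> R}) :
  \forall t \ae @unif01 R, plateau_interior Y t.
Proof.
apply: ae_unif01; have cE := quantile_plateau_ends_countable Y.
set E := (X in countable X) in cE; exists E; split.
- exact: countable_measurable.
- exact: countable_lebesgue_measure0.
move=> t /= nt; have t01 : 0 < t < 1.
  apply: contrapT => t01; apply: nt => t01'; exfalso; apply: t01.
  by move: t01'; rewrite in_itv.
have tF := le_cdfR_quantile Y t01; have Ht := lcdf_quantile_le Y t01.
apply: contrapT => nE; apply: nt => _; split => //.
have [Hl|Hn] := eqVneq (lcdf Y (quantile P Y t)) t; first by left.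
right; rewrite lt_neqAle tF andbT; apply/eqP => Ft; apply: nE; split => //.
by rewrite lt_neqAle Hn.
Qed.

(** * Positivity of the denominator of xi *)

Section xi_den_positive.
Context (R : realType) d (Om : measurableType d) (P : probability Om R).
Variable Y : {RV P >-> R}.
Let q := @quantile R _ _ P Y.

Let G y := (1 - lcdf Y y) - (1 - lcdf Y y) ^+ 2.

Let GE y : G y = (1 - lcdf Y y) * lcdf Y y. Proof. by rewrite /G; ring. Qed.

Let G_ge0 y : 0 <= G y.
Proof. by rewrite GE mulr_ge0 ?subr_ge0 ?lcdf_le1 ?lcdf_ge0. Qed.

Let bG : bounded_measurable G.
Proof.
have b := bounded_measurable_ucdf Y.
by apply: bounded_measurableB => //; exact: bounded_measurableM.
Qed.

(** The integrand P(Y >= y) P(Y < y) vanishes at q(s) for almost every s. Its first factor there is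
    at least 1 - s > 0, so the second is 0, and monotonicity passes this to every t < s. *)
Let lcdf_quantile_eq0 : xi_den Y = 0 -> forall t, 0 < t < 1 -> lcdf Y (q t) = 0.
Proof.
rewrite /xi_den (quantile_transform Y bG) => G0 t t01.
have /andP[t0 t1] := t01.
have bGq : bounded_measurable (fun s => G (quantile01 Y s)).
  exact: (bounded_measurable_comp (@measurable_quantile01 _ _ _ _ Y) bG).
have : ae_eq (@unif01 R) setT (fun s => (G (quantile01 Y s))%:E) (cst 0%E).
  apply/ae_eq_integral_abs => //; first by apply/measurable_EFinP; case: bGq.
  under eq_integral do rewrite gee0_abs ?lee_fin//.
  by rewrite EFin_Rintegral// G0.
move=> [N [mN N0 hN]].
have [s /andP[ts s1] Gs] : exists2 s, t < s < 1 & G (quantile01 Y s) = 0.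
  apply: contrapT => hs.
  have : @unif01 R `]t, 1[%classic = 0%E.
    apply: (subset_measure0 (B := N)) => // s /=; rewrite in_itv/= => ts1.
    apply: hN => /= h; apply: hs; exists s => //.
    by have := h I => -[].
  have -> : @unif01 R `]t, 1[%classic = lebesgue_measure (`]t, 1[%classic : set R).
    rewrite unif01E; congr lebesgue_measure; apply/seteqP; split => s /=.
      by case.
    rewrite !in_itv/= => /andP[ts s1]; rewrite ts s1; split => //.
    by rewrite (lt_trans t0 ts).
  rewrite lebesgue_measure_itv/= lte_fin t1 -EFinB => -[] /eqP.
  by rewrite subr_eq0 gt_eqF.
have s01 : 0 < s < 1 by rewrite (lt_trans t0 ts).
move/eqP: Gs; rewrite quantile01E// GE mulf_eq0 => /orP[|/eqP Hs].
  rewrite subr_eq0 => /eqP H1; have := lcdf_quantile_le Y s01.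
  by rewrite -H1 leNgt s1.
apply/eqP; rewrite eq_le lcdf_ge0 andbT -Hs; apply: lcdf_le.
by apply: quantile_homo => //; exact: ltW.
Qed.

(** Otherwise no mass lies below any quantile. Then Y sits at the median c, since a quantile above c
    would have mass at least 1/2 strictly below it. *)
Lemma xi_den_gt0 : nondegenerate_RV P Y -> 0 < xi_den Y.
Proof.
move=> nondeg; rewrite lt_neqAle eq_sym Rint_ge0 ?andbT//.
apply/eqP => /lcdf_quantile_eq0 H0; apply: nondeg.
have h01 : 0 < (2^-1 : R) < 1 by apply/andP; split; lra.
set c := q 2^-1; exists c.
have F1 : cdfR Y c = 1.
  apply/eqP; rewrite eq_le cdfR_le1/=; apply/ler_addgt0Pr => e e0.
  rewrite -lerBlDr; have [e1|e1] := leP 1 e.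
    by rewrite (le_trans _ (fine_ge0 _))// subr_le0.
  have t01 : 0 < 1 - e < 1 by rewrite subr_gt0 e1 gtrBl.
  apply: le_trans (le_cdfR_quantile Y t01) _; apply: cdfR_le.
  rewrite leNgt; apply/negP => /(cdfR_le_lcdf Y); rewrite H0// => h.
  have := le_trans (le_cdfR_quantile Y h01) h.
  by rewrite leNgt invr_gt0 ltr0n.
have h1 : distribution P Y `]-oo, c]%classic = 1%E.
  by have := cdfRE Y c; rewrite F1.
have h0 : distribution P Y `]-oo, c[%classic = 0%E.
  rewrite -(fineK (fin_num_measure (distribution P Y) _ (measurable_itv _))).
  by congr EFin; exact: H0.
have hU : distribution P Y `]-oo, c]%classic =
    (distribution P Y `]-oo, c[%classic + distribution P Y [set c])%E.
  have -> : (`]-oo, c] = `]-oo, c[ `|` [set c])%classic.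
    by rewrite setUitv1// bnd_simp.
  apply: measureU => //; apply/seteqP; split => x //= -[].
  by rewrite in_itv/= => xc xE; rewrite xE ltxx in xc.
by rewrite h1 h0 add0e in hU; rewrite hU.
Qed.

End xi_den_positive.

Section xi_convergence.
Context (R : realType).
Context (dn : nat -> measure_display) (Omn : forall n, measurableType (dn n))
  (Pn : forall n, probability (Omn n) R)
  d (Om : measurableType d) (P : probability Om R).
Variables (Yn : forall n, {RV (Pn n) >-> R}) (Y : {RV P >-> R}).
Variables (mun : nat -> probability (R * R)%type R) (mu : probability (R * R)%type R).
Hypothesis marg1n : forall n A, measurable A ->
  mun n (A `*` setT) = distribution (Pn n) (Yn n) A.
Hypothesis marg2n : forall n A, measurable A ->
  mun n (setT `*` A) = distribution (Pn n) (Yn n) A.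
Hypothesis marg1 : forall A, measurable A -> mu (A `*` setT) = distribution P Y A.
Hypothesis marg2 : forall A, measurable A -> mu (setT `*` A) = distribution P Y A.
Hypothesis mu_cvg : weak_cvg_R2 mun mu.
Hypothesis cdf_quantile_cvg : \forall t \ae lebesgue_measure, t \in `]0, 1[ ->
  cdf (P := Pn n) (Yn n) (@quantile R _ _ (Pn n) (Yn n) t) @[n --> \oo] -->
  cdf (P := P) Y (@quantile R _ _ P Y t).
Hypothesis Y_nondeg : nondegenerate_RV P Y.

(** The quantile transform replaces the varying laws by one fixed measure, so pointwise convergence
    at almost every t and a common bound suffice. *)
Let law_integral_cvg (gn : nat -> R -> R) (g : R -> R) M :
  (forall n, bounded_measurable (gn n)) -> bounded_measurable g ->
  (forall n y, `|gn n y| <= M) ->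
  (forall t, plateau_interior Y t ->
     gn n (@quantile R _ _ (Pn n) (Yn n) t) @[n --> \oo] -->
     g (@quantile R _ _ P Y t)) ->
  \int[distribution (Pn n) (Yn n)]_y gn n y @[n --> \oo] -->
  \int[distribution P Y]_y g y.
Proof.
move=> bgn bg gnM cg; rewrite (quantile_transform Y bg).
apply: (eq_cvg_seq (fun n => quantile_transform (Yn n) (bgn n))).
apply: (@cvg_Rint_ae _ _ _ _ _ _ M) => //.
- move=> n; have [mg _] := bgn n.
  exact: (measurableT_comp mg (@measurable_quantile01 _ _ _ _ (Yn n))).
- exact: (bounded_measurable_comp (@measurable_quantile01 _ _ _ _ Y) bg).
- have [N [mN N0 hN]] := ae_plateau_interior Y.
  exists N; split => //; apply: subset_trans hN => t /=.
  apply: contra_not => tp; have [t01 _] := tp.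
  rewrite quantile01E//; apply: eq_cvg_seq (cg t tp) => n.
  by rewrite quantile01E.
Qed.

Let ucdf01 d0 (O0 : measurableType d0) (Q : probability O0 R) (V : {RV Q >-> R}) y :
  0 <= 1 - lcdf V y <= 1.
Proof. by rewrite subr_ge0 lcdf_le1 gerBl lcdf_ge0. Qed.

Let ucdf_cvg t : plateau_interior Y t ->
  1 - lcdf (Yn n) (@quantile R _ _ (Pn n) (Yn n) t) @[n --> \oo] -->
  1 - lcdf Y (@quantile R _ _ P Y t).
Proof.
move=> tp; apply: cvgB; first exact: cvg_cst.
exact: (lcdf_quantile_cvg marg1n marg1 mu_cvg cdf_quantile_cvg tp).
Qed.

Lemma xi_ratio_cvg :
  xi_num (Yn n) (mun n) / xi_den (Yn n) @[n --> \oo] --> xi_num Y mu / xi_den Y.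
Proof.
have b1 := bounded_measurable_ucdf Y; have b1n n := bounded_measurable_ucdf (Yn n).
have b2 := bounded_measurableM b1 b1.
have b2n n := bounded_measurableM (b1n n) (b1n n).
apply: cvgM.
  apply: (@law_integral_cvg (fun n y => upper_square (mun n) y - (1 - lcdf (Yn n) y) ^+ 2)
    (fun y => upper_square mu y - (1 - lcdf Y y) ^+ 2) 2).
  - move=> n; apply: bounded_measurableB (b2n n).
    exact: bounded_measurable_upper_square.
  - by apply: bounded_measurableB b2; exact: bounded_measurable_upper_square.
  - move=> n y; have /andP[h0 h1] := ucdf01 (Yn n) y.
    have h2 := upper_square_le (marg1n n) y.
    have h3 : 0 <= upper_square (mun n) y by exact: fine_ge0.
    by rewrite ler_norml; apply/andP; split; nra.
  - move=> t tp; apply: cvgB.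
      exact: (upper_square_quantile_cvg marg1n marg2n marg1 marg2 mu_cvg cdf_quantile_cvg tp).
    by apply: cvgM; exact: ucdf_cvg.
apply: cvgV; first by rewrite gt_eqF// xi_den_gt0.
apply: (@law_integral_cvg (fun n y => 1 - lcdf (Yn n) y - (1 - lcdf (Yn n) y) ^+ 2)
    (fun y => 1 - lcdf Y y - (1 - lcdf Y y) ^+ 2) 2).
- by move=> n; exact: (bounded_measurableB (b1n n) (b2n n)).
- exact: (bounded_measurableB b1 b2).
- move=> n y; have /andP[h0 h1] := ucdf01 (Yn n) y.
  by rewrite ler_norml; apply/andP; split; nra.
- by move=> t tp; apply: cvgB; [|apply: cvgM]; exact: ucdf_cvg.
Qed.

End xi_convergence.

Section xi_reordering.
Context (R : realType) d (Om : measurableType d) (P : probability Om R).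
Context (q p : nat) (Y : {RV P >-> 'rV[R]_q}) (X : {RV P >-> 'rV[R]_p}) (i : 'I_q).

(** xi conditions on X followed by the past in reverse order, the Markov product on the past
    followed by X; phi and psi are inverse rearrangements of the coordinates. *)
Lemma xi_joint (K : R.-pker 'rV[R]_(i + p) ~> R) mu :
  reg_cond_distr P (rv_coord Y i) (rv_joint (rv_past Y i) X) K ->
  is_markov_product P (rv_coord Y i) (rv_joint (rv_past Y i) X) K mu ->
  xi P (rv_coord Y i) (rv_joint X (rv_rpast Y i)) =
  xi_num (P := P) (rv_coord Y i) mu / xi_den (P := P) (rv_coord Y i).
Proof.
move=> hK hmu.
pose phi (v : 'rV[R]_(i + p)) : 'rV[R]_(p + i) :=
  row_mx (\row_k v ord0 (rshift i k)) (\row_j v ord0 (lshift p (rev_ord j))).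
pose psi (v : 'rV[R]_(p + i)) : 'rV[R]_(i + p) :=
  row_mx (\row_j v ord0 (rshift p (rev_ord j))) (\row_k v ord0 (lshift i k)).
have mphi : measurable_fun setT phi.
  apply: measurable_fun_rV => j; rewrite -(fintype.splitK j).
  case: (fintype.split j) => k /=.
    by under eq_fun do rewrite row_mxEl mxE; exact: measurable_coord.
  by under eq_fun do rewrite row_mxEr mxE; exact: measurable_coord.
have mpsi : measurable_fun setT psi.
  apply: measurable_fun_rV => j; rewrite -(fintype.splitK j).
  case: (fintype.split j) => k /=.
    by under eq_fun do rewrite row_mxEl mxE; exact: measurable_coord.
  by under eq_fun do rewrite row_mxEr mxE; exact: measurable_coord.
apply: (xiE hK hmu mphi mpsi) => w.
- rewrite /phi /= /rv_joint; congr row_mx; apply/rowP => j; rewrite mxE.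
    by rewrite row_mxEr.
  by rewrite row_mxEl !mxE.
- rewrite /psi /= /rv_joint; congr row_mx; apply/rowP => j; rewrite [RHS]mxE.
    by rewrite row_mxEr !mxE rev_ordK.
  by rewrite row_mxEl.
Qed.

Lemma xi_rpast (L : R.-pker 'rV[R]_i ~> R) mu :
  reg_cond_distr P (rv_coord Y i) (rv_past Y i) L ->
  is_markov_product P (rv_coord Y i) (rv_past Y i) L mu ->
  xi P (rv_coord Y i) (rv_rpast Y i) =
  xi_num (P := P) (rv_coord Y i) mu / xi_den (P := P) (rv_coord Y i).
Proof.
move=> hL hmu; pose phi (v : 'rV[R]_i) : 'rV[R]_i := \row_j v ord0 (rev_ord j).
have mphi : measurable_fun setT phi.
  apply: measurable_fun_rV => j.
  by under eq_fun do rewrite mxE; exact: measurable_coord.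
apply: (xiE hL hmu mphi mphi) => w; apply/rowP => j; rewrite !mxE//.
by rewrite rev_ordK.
Qed.

End xi_reordering.

(** * Assembly over the coordinates *)

Theorem corollary4p1 (R : realType) (q p : nat) (q_gt0 : (0 < q)%N)
  (p_gt0 : (0 < p)%N)
  (d : measure_display) (Om : measurableType d) (P : probability Om R)
  (Y : {RV P >-> 'rV[R]_q}) (X : {RV P >-> 'rV[R]_p})
  (dn : nat -> measure_display) (Omn : forall n, measurableType (dn n))
  (Pn : forall n, probability (Omn n) R)
  (Yn : forall n, {RV (Pn n) >-> 'rV[R]_q})
  (Xn : forall n, {RV (Pn n) >-> 'rV[R]_p})
  (Y_nondeg : forall i : 'I_q, nondegenerate_RV P (rv_coord Y i))
  (Yn_nondeg : forall n (i : 'I_q),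
     nondegenerate_RV (Pn n) (rv_coord (Yn n) i))
  (U : set (R -> cplx R)) (U_cvg_det : cvg_determining_class U)
  (V : forall i : 'I_q, set 'rV[R]_(i + p))
  (V_open : forall i, open (V i))
  (PV : forall i, P [set w | V i (rv_joint (rv_past Y i) X w)] = 1%E)
  (W : forall i : 'I_q, set 'rV[R]_i)
  (W_open : forall i : 'I_q, (0 < i)%N -> open (W i))
  (PW : forall i : 'I_q, (0 < i)%N -> P [set w | W i (rv_past Y i w)] = 1%E)
  (K : forall i : 'I_q, R.-pker 'rV[R]_(i + p) ~> R)
  (K_version : forall i,
     reg_cond_distr P (rv_coord Y i) (rv_joint (rv_past Y i) X) (K i))
  (L : forall i : 'I_q, R.-pker 'rV[R]_i ~> R)
  (L_version : forall i : 'I_q, (0 < i)%N ->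
     reg_cond_distr P (rv_coord Y i) (rv_past Y i) (L i))
  (Kn : nat -> forall i : 'I_q, R.-pker 'rV[R]_(i + p) ~> R)
  (Kn_version : forall n i, reg_cond_distr (Pn n) (rv_coord (Yn n) i)
     (rv_joint (rv_past (Yn n) i) (Xn n)) (Kn n i))
  (Ln : nat -> forall i : 'I_q, R.-pker 'rV[R]_i ~> R)
  (Ln_version : forall n (i : 'I_q), (0 < i)%N ->
     reg_cond_distr (Pn n) (rv_coord (Yn n) i) (rv_past (Yn n) i) (Ln n i)) :
  let cond_i :=
    cvg_in_distribution Pn (fun n => rv_joint (Yn n) (Xn n)) P (rv_joint Y X) in
  let cond_ii :=
    forall u, U u -> forall i : 'I_q,
      asymp_equicontinuous (fun n => cond_expectation (Kn n i) u) (V i) /\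
      ((0 < i)%N ->
        asymp_equicontinuous (fun n => cond_expectation (Ln n i) u) (W i)) in
  let cond_iii :=
    forall i : 'I_q,
      (exists (mun : nat -> probability (R * R)%type R)
         (mu : probability (R * R)%type R),
        [/\ forall n, is_markov_product (Pn n) (rv_coord (Yn n) i)
              (rv_joint (rv_past (Yn n) i) (Xn n)) (Kn n i) (mun n),
            is_markov_product P (rv_coord Y i) (rv_joint (rv_past Y i) X)
              (K i) mu &
            weak_cvg_R2 mun mu]) /\
      ((0 < i)%N ->
        exists (mun : nat -> probability (R * R)%type R)
          (mu : probability (R * R)%type R),
        [/\ forall n, is_markov_product (Pn n) (rv_coord (Yn n) i)
              (rv_past (Yn n) i) (Ln n i) (mun n),
            is_markov_product P (rv_coord Y i) (rv_past Y i) (L i) mu &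
            weak_cvg_R2 mun mu]) in
  let cond_iv :=
    forall i : 'I_q, \forall t \ae lebesgue_measure, t \in `]0, 1[ ->
      cdf (P := Pn n) (rv_coord (Yn n) i)
        (quantile (Pn n) (rv_coord (Yn n) i) t)
        @[n --> \oo] -->
      cdf (P := P) (rv_coord Y i) (quantile P (rv_coord Y i) t) in
  (cond_i /\ cond_ii -> cond_iii) /\
  (cond_iii /\ cond_iv ->
   chatterjee_T (Pn n) (Yn n) (Xn n) @[n --> \oo] -->
   chatterjee_T P Y X).
Proof.
move=> cond_i cond_ii cond_iii cond_iv; split.
  move=> [ci cii] i; split.
    apply: (markov_product_cvg (subvector_cvg ci (joint_past_reindex Y X i)
      (fun n => joint_past_reindex (Yn n) (Xn n) i)) (V_open i) (PV i)
      (fun n => Kn_version n i) (K_version i) U_cvg_det) => u Uu.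
    by have [] := cii u Uu i.
  move=> i0; apply: (markov_product_cvg (subvector_cvg ci (past_reindex Y X i)
    (fun n => past_reindex (Yn n) (Xn n) i)) (W_open i i0) (PW i i0)
    (fun n => Ln_version n i i0) (L_version i i0) U_cvg_det) => u Uu.
  by have [_] := cii u Uu i; apply.
move=> [ciii civ].
(* For the first coordinate the past is empty, so this includes xi(Y_1, X). *)
have cvg_joint i :
    xi (Pn n) (rv_coord (Yn n) i) (rv_joint (Xn n) (rv_rpast (Yn n) i))
      @[n --> \oo] --> xi P (rv_coord Y i) (rv_joint X (rv_rpast Y i)).
  have [[mun [mu [hmun hmu mu_cvg]]] _] := ciii i.
  rewrite (xi_joint (K_version i) hmu).
  apply: (eq_cvg_seq (fun n => xi_joint (Kn_version n i) (hmun n))).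
  exact: (xi_ratio_cvg (fun n => markov_marginal1 (Kn_version n i) (hmun n))
    (fun n => markov_marginal2 (Kn_version n i) (hmun n))
    (markov_marginal1 (K_version i) hmu) (markov_marginal2 (K_version i) hmu)
    mu_cvg (civ i) (Y_nondeg i)).
have cvg_past i : xi_past (Pn n) (Yn n) i @[n --> \oo] --> xi_past P Y i.
  rewrite /xi_past; case: (posnP i) => [_|i0].
    by apply: (eq_cvg_seq (fun n => erefl)); exact: cvg_cst.
  have [_ /(_ i0) [mun [mu [hmun hmu mu_cvg]]]] := ciii i.
  rewrite (xi_rpast (L_version i i0) hmu).
  apply: (eq_cvg_seq (fun n => xi_rpast (Ln_version n i i0) (hmun n))).
  exact: (xi_ratio_cvg (fun n => markov_marginal1 (Ln_version n i i0) (hmun n))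
    (fun n => markov_marginal2 (Ln_version n i i0) (hmun n))
    (markov_marginal1 (L_version i i0) hmu) (markov_marginal2 (L_version i i0) hmu)
    mu_cvg (civ i) (Y_nondeg i)).
(* The bound 0 at the first coordinate comes from the convention; it is what makes the denominator
   of T strictly positive. *)
have past_le1 (i : 'I_q) : xi_past P Y i <= (0 < i)%N%:R.
  rewrite /xi_past; case: (posnP i) => [_|i0]; first by [].
  have [_ /(_ i0) [mun [mu [_ hmu _]]]] := ciii i.
  rewrite (xi_rpast (L_version i i0) hmu).
  rewrite ler_pdivrMr ?xi_den_gt0 // mul1r.
  exact (xi_num_le_den (L_version i i0) hmu).
have den_gt0 : 0 < q%:R - \sum_(i < q) xi_past P Y i.
  rewrite subr_gt0.
  have : \sum_(i < q) xi_past P Y i <= \sum_(i < q) ((0 < i)%N%:R : R).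
    exact: ler_sum.
  move=> /le_lt_trans; apply; rewrite -natr_sum ltr_nat.
  case: q q_gt0 {Y Yn Y_nondeg Yn_nondeg V V_open PV W W_open PW K K_version L
    L_version Kn Kn_version Ln Ln_version cond_i cond_ii cond_iii cond_iv ciii
    civ cvg_joint cvg_past past_le1} => // q' _.
  (* Splitting off the first summand, which is 0, bounds the sum by q - 1. *)
  rewrite big_ord_recl /= add0n ltnS.
  apply: (@leq_trans (\sum_(i < q') 1)); first by apply: leq_sum => i _; rewrite ?leq_b1.
  by rewrite sum1_card card_ord.
rewrite /chatterjee_T; apply: cvgB; first exact: cvg_cst.
apply: cvgM.
  by apply: cvgB; [exact: cvg_cst|exact: cvg_seq_sum].
apply: cvgV; first by rewrite gt_eqF.
by apply: cvgB; [exact: cvg_cst|exact: cvg_seq_sum].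
Qed.
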